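(* Let $\theta,\sigma>0$ and let $u=u(t,x)$ be the solution of the one-dimensional heat equation with additive space-only white noise $$\dot u(t,x)-\theta u_{xx}(t,x)=\sigma\dot W(x),\ t>0,\ 0<x<\pi,\qquad u(t,0)=u(t,\pi)=0,\quad u(0,x)=0,$$ as made precise in the context. Fix $t>0$ and $[a,b]\subseteq[0,\pi]$, $a<b$, and for $M\ge1$ let $x_j=a+(b-a)j/M$, $j=0,\dots,M$. Define $$\check\theta^2_M=\frac{\sigma^2(b-a)}{\sum_{j=1}^M\big(u_x(t,x_j)-u_x(t,x_{j-1})\big)^2},\qquad \check\sigma^2_M=\frac{\theta^2\sum_{j=1}^M\big(u_x(t,x_j)-u_x(t,x_{j-1})\big)^2}{b-a}.$$ If $\sigma$ is known, then $\check\theta^2_M$, as an estimator of $\theta^2$, is strongly consistent: $\lim_{M\to\infty}\check\theta^2_M=\theta^2$ $\mathbb{P}$-a.s., and asymptotically normal: $\lim_{M\to\infty}\sqrt M\big(\check\theta^2_M-\theta^2\big)=\mathcal N(0,2\theta^4)$ in distribution. If $\theta$ is known, then $\check\sigma^2_M$, as an estimator of $\sigma^2$, is strongly consistent: $\lim_{M\to\infty}\check\sigma^2_M=\sigma^2$ $\mathbb{P}$-a.s., and asymptotically normal: $\lim_{M\to\infty}\sqrt M\big(\check\sigma^2_M-\sigma^2\big)=\mathcal N(0,2\sigma^4)$ in distribution.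
   Context: Here $h_k(x)=\sqrt{2/\pi}\,\sin(kx)$, $k\in\mathbb{N}$, $\dot W(x)=\sum_{k\ge1}\xi_kh_k(x)$ with $\xi_k$ i.i.d. standard normal random variables on $(\Omega,\mathcal F,\mathbb P)$, and the solution is $u(t,x)=\sum_{k\ge1}u_k(t)h_k(x)$ with $$u_k(t)=\frac{\sigma}{\theta}\,\xi_k\,\frac{1-e^{-k^2\theta t}}{k^2}.$$ With probability one $u$ is differentiable in $x$, and $$u_x(t,x)=\sum_{k=1}^\infty\sqrt{\frac2\pi}\,\frac\sigma\theta\,\xi_k\,(1-e^{-k^2\theta t})\,\frac{\cos(kx)}{k};$$ the process $x\mapsto u_x(t,x)$ is taken in its continuous version on $[0,\pi]$. $\mathcal N(0,v)$ denotes a Gaussian random variable with mean zero and variance $v$. *)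

(* Defs.v *)
From HB Require Import structures.
From mathcomp Require Import all_boot all_order all_algebra.
From mathcomp Require Import all_classical all_reals all_analysis.

Set Implicit Arguments.
Unset Strict Implicit.
Unset Printing Implicit Defensive.

Import Order.TTheory GRing.Theory Num.Theory.
Import numFieldNormedType.Exports.

Local Open Scope classical_set_scope.
Local Open Scope ring_scope.

Definition mutually_independent (R : realType) (d : measure_display)
    (T : measurableType d) (P : probability T R)
    (I : set nat) (X : nat -> {RV P >-> R}) : Prop :=
  forall (s : seq nat) (A : nat -> set R),
    uniq s -> [set` s] `<=` I -> (forall k, measurable (A k)) ->
    P (\bigcap_(k in [set` s]) (X k @^-1` A k)) =
    (\prod_(k <- s) P (X k @^-1` A k))%E.

(* [normal_prob m s] takes the standard deviation [s], not the variance.  The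
   laws are compared on measurable sets only: as total functions on [set R]
   they need not agree on the other sets. *)
Definition iid_standard_normal (R : realType) (d : measure_display)
    (T : measurableType d) (P : probability T R)
    (I : set nat) (X : nat -> {RV P >-> R}) : Prop :=
  mutually_independent I X /\
  forall k, I k -> forall A : set R, measurable A ->
    distribution P (X k) A = normal_prob 0 1 A.

(* Convergence in distribution of random variables: weak convergence of their
   laws to [mu], tested on bounded continuous functions. *)
Definition cvg_in_distribution (R : realType) (d : measure_display)
    (T : measurableType d) (P : probability T R)
    (X : nat -> T -> R) (mu : probability (measurableTypeR R) R) : Prop :=
  (forall n, measurable_fun setT (X n)) /\
  forall f : R -> R, continuous f -> (exists C, forall x, `|f x| <= C) ->
    (\int[P]_w (f (X n w))%:E)%E @[n --> \oo] --> (\int[mu]_x (f x)%:E)%E.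

Section heat_equation.
Context (R : realType) (d : measure_display) (T : measurableType d)
  (P : probability T R).
Variables (xi : nat -> {RV P >-> R}) (theta sigma : R).

Definition sine_mode (k : nat) (x : R) : R :=
  Num.sqrt (2 / pi) * sin (k%:R * x).

Definition heat_coef (k : nat) (t : R) (w : T) : R :=
  sigma / theta * xi k w * ((1 - expR (- (k%:R ^+ 2 * theta * t))) / k%:R ^+ 2).

(* The series converges almost surely (absolutely, for all [x] at once);
   [heat_sol] is unspecified on the null set where it does not. *)
Definition heat_sol (t x : R) (w : T) : R :=
  limn (fun n => \sum_(1 <= k < n) heat_coef k t w * sine_mode k x).

Definition heat_dx_partial (n : nat) (t x : R) (w : T) : R :=
  \sum_(1 <= k < n) Num.sqrt (2 / pi) * (sigma / theta) * xi k w *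
    (1 - expR (- (k%:R ^+ 2 * theta * t))) * (cos (k%:R * x) / k%:R).

(* [v] is the process [x |-> u_x(t, x)] on [0, pi], in its continuous version. *)
Definition continuous_heat_dx (t : R) (v : R -> {RV P >-> R}) : Prop :=
  [/\ {ae P, forall w, {within `[0, pi], continuous (fun x => v x w)}},
      {ae P, forall w, forall x, x \in `]0, pi[ ->
         is_derive x 1 (fun y => heat_sol t y w) (v x w)}
    & forall x, x \in `[0, pi] ->
        {ae P, forall w, heat_dx_partial n t x w @[n --> \oo] --> v x w}].

End heat_equation.

Section estimators.
Context (R : realType) (T : Type).
Variables (v : R -> T -> R) (a b : R).

Definition grid (M j : nat) : R := a + (b - a) * j%:R / M%:R.

Definition quadratic_variation (M : nat) (w : T) : R :=
  \sum_(1 <= j < M.+1) (v (grid M j) w - v (grid M j.-1) w) ^+ 2.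

Definition theta2_check (sigma : R) (M : nat) (w : T) : R :=
  sigma ^+ 2 * (b - a) / quadratic_variation M w.

Definition sigma2_check (theta : R) (M : nat) (w : T) : R :=
  theta ^+ 2 * quadratic_variation M w / (b - a).

End estimators.

(* Main.v *)
(* Divided by [sigma sqrt h / theta], [h] the grid step, the vector of the [M]
   increments of [u_x(t, .)] is the limit [n -> oo] of linear images [B xi] of the
   first [n] standard normal variables.  The Fourier series
   [sum (1 - cos kz) / k^2 = pi z / 2 - z^2 / 4] shows that the undamped increments
   are orthonormal, so [B B^T <= 1] (Bessel), while the damping factors
   [1 - exp (- k^2 theta t)] only cost [M - tr (B B^T) = O(1)] uniformly in [M].

   Put [H = (|B xi|^2 - M) / sqrt (2 M)].  Gaussian integration by parts gives
   [E (H phi(H)) = E phi'(H) + O(M^(-1/2))] for bounded [C^1] functions [phi] with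
   bounded derivative.  Taking [phi] to be a truncated cube bounds [E H^4]; taking
   [phi] to be the solution of Stein's equation bounds [|E g(H) - N(g)|] by
   [C sup |g| / sqrt M].  Both bounds pass to the limit [n -> oo].

   The quadratic variation divided by its limit is [rho = 1 + H sqrt (2 / M)].
   As [E (rho - 1)^4 = O(M^-2)] is summable, [rho] converges to 1 almost surely.
   Since [sigma2_check = sigma^2 rho] and [theta2_check = theta^2 / rho], the Stein
   bound gives asymptotic normality of the first estimator, and of the second
   because it holds uniformly over test functions with a common sup bound. *)
Require Import Defs.
From HB Require Import structures.
From mathcomp Require Import all_boot all_order all_algebra.
From mathcomp Require Import all_classical all_reals all_analysis.
From mathcomp Require Import measurable_realfun ring lra.

Set Implicit Arguments.
Unset Strict Implicit.
Unset Printing Implicit Defensive.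

Import Order.TTheory GRing.Theory Num.Theory.
Import numFieldNormedType.Exports.

Local Open Scope classical_set_scope.
Local Open Scope ring_scope.

(** * Gaussian integration by parts *)

(** The damping and the cut at [n] modes make the increments correlated, so no central limit theorem
    for independent summands applies to the quadratic form. Stein's method stays short because
    [B B^T <= 1] has a sign. Its remainder is [1 - |B^T B xi|^2 / M]. With [Q = |B xi|^2] this
    splits into [1 - Q / M], which is just [- H sqrt (2 / M)], and [(Q - |B^T B xi|^2) / M], which
    is nonnegative. For [G = B B^T] the numerator of the second part has mean
    [tr G - tr (G^2) <= M - tr G]. The trace defect thus controls an L1 norm, and the variance of
    the squared gradient never has to be estimated.

    Test functions are bounded with bounded derivative, so that every integrability condition in the
    integration by parts is automatic. This is why the fourth moment is reached through a
    truncation, with a bound free of the truncation parameter. *)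

Section normal_density_integral.
Context (R : realType).
Notation mu := (@lebesgue_measure R).

(** Change of variables holds with the Radon-Nikodym derivative, which agrees with [normal_pdf]
    almost everywhere because both have the same integral over every measurable set. *)
Lemma ge0_integral_normal_prob (m s : R) (f : R -> \bar R) :
  (forall x, (0 <= f x)%E) -> measurable_fun [set: R] f ->
  (\int[normal_prob m s]_x f x =
   \int[mu]_x (f x * (normal_pdf m s x)%:E))%E.
Proof.
move=> f0 mf.
pose nu : {finite_measure set (measurableTypeR R) -> \bar R} := normal_prob m s.
have dom : nu `<< mu := @normal_prob_dominates R m s.
rewrite -(Radon_Nikodym_SigmaFinite.change_of_variables dom f0)//.
have mpdf : measurable_fun setT (EFin \o @normal_pdf R m s).
  by apply/measurable_EFinP; exact: measurable_normal_pdf.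
have mg := measurable_int _ (Radon_Nikodym_SigmaFinite.f_integrable dom).
apply: ae_eq_integral => //.
- exact: emeasurable_funM.
- exact: emeasurable_funM.
- apply: ae_eqe_mul2l; apply: integral_ae_eq => //=.
  + exact: Radon_Nikodym_SigmaFinite.f_integrable.
  + by move=> E _ mE; rewrite -(Radon_Nikodym_SigmaFinite.f_integral dom).
Qed.

Lemma integrable_normal_prob (m s : R) (f : R -> R) : measurable_fun [set: R] f ->
  mu.-integrable setT (EFin \o (fun x => f x * normal_pdf m s x)) ->
  (normal_prob m s).-integrable setT (EFin \o f).
Proof.
move=> mf /integrableP[_ i]; apply/integrableP; split.
  exact/measurable_EFinP.
rewrite ge0_integral_normal_prob//; last first.
  by apply: measurableT_comp => //; exact/measurable_EFinP.
apply: le_lt_trans i; rewrite le_eqVlt; apply/orP; left; apply/eqP.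
apply: eq_integral => x _ /=.
by rewrite -EFinM normrM (ger0_norm (normal_pdf_ge0 _ _ _)).
Qed.

Lemma Rintegral_normal_prob (m s : R) (f : R -> R) : measurable_fun [set: R] f ->
  (normal_prob m s).-integrable setT (EFin \o f) ->
  \int[normal_prob m s]_x f x = \int[mu]_x (f x * normal_pdf m s x).
Proof.
move=> mf fi; rewrite /Rintegral; congr fine.
rewrite integralE [RHS]integralE.
have mfp : measurable_fun setT (EFin \o f) by exact/measurable_EFinP.
rewrite ge0_integral_normal_prob//; last exact: measurable_funepos.
rewrite ge0_integral_normal_prob//; last exact: measurable_funeneg.
congr (_ - _)%E; apply: eq_integral => x _.
  rewrite !funeposE EFinM maxe_pMl ?lee_fin ?normal_pdf_ge0//.
  by rewrite mul0e.
rewrite !funenegE EFinM -mulNe maxe_pMl ?lee_fin ?normal_pdf_ge0//.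
by rewrite mul0e.
Qed.

End normal_density_integral.

Section gaussian_ibp.
Context (R : realType).
Notation mu := (@lebesgue_measure R).

Lemma is_derive_continuous (f : R -> R) (x a : R) :
  is_derive x 1 f a -> {for x, continuous f}.
Proof. by move=> [df _]; exact/differentiable_continuous/derivable1_diffP. Qed.

Lemma cvg_invn : (fun n : nat => n%:R^-1 : R) @ \oo --> (0 : R).
Proof.
apply/gtr0_cvgV0; last exact: cvgr_idn.
by near=> n; rewrite ltr0n; near: n; exists 1%N.
Unshelve. all: by end_near. Qed.

Lemma normal_pdf0E (s x : R) : s != 0 ->
  normal_pdf 0 s x = normal_peak s * expR (- x ^+ 2 / (s ^+ 2 *+ 2)).
Proof. by move=> s0; rewrite normal_pdfE// /normal_fun subr0. Qed.

Lemma is_derive_normal_pdf (s x : R) : s != 0 ->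
  is_derive x 1 (normal_pdf 0 s) (- (x / s ^+ 2) * normal_pdf 0 s x).
Proof.
move=> s0; rewrite normal_pdf0E//.
rewrite (_ : normal_pdf 0 s = (fun y => normal_peak s * expR (- (s ^+ 2 *+ 2)^-1 * y ^+ 2))); last first.
  by apply/funext => y; rewrite normal_pdf0E//; congr (_ * expR _); ring.
apply: is_derive_eq; rewrite /GRing.scale/= -mulr_natr.
set e := expR _; set e' := expR _; have -> : e = e' by congr expR; ring.
by field.
Qed.

Lemma expRN_le_inv (u : R) : 0 < u -> expR (- u) <= u^-1.
Proof.
move=> u0; rewrite expRN lef_pV2 ?posrE ?expR_gt0//.
by rewrite (le_trans _ (expR_ge1Dx _))// lerDr.
Qed.

(** A quadratic factor is absorbed by widening the Gaussian: [exp (- x^2 / 2) = exp (- 3 x^2 / 8)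
    exp (- x^2 / 8)] and [x^2 exp (- 3 x^2 / 8) <= 8 / 3]. The right side is a multiple of a
    density, hence integrable. *)
Lemma sqr_normal_pdf_le (x : R) : x ^+ 2 * normal_pdf 0 1 x <=
  (8 / 3 * normal_peak 1 / normal_peak 2) * normal_pdf 0 2 x.
Proof.
rewrite !normal_pdf0E//.
rewrite (_ : - x ^+ 2 / (1 ^+ 2 *+ 2) = - (3 / 8 * x ^+ 2) + (- x ^+ 2 / (2 ^+ 2 *+ 2))); last by field.
rewrite expRD.
have p2 : 0 < normal_peak (2 : R) by rewrite normal_peak_gt0.
rewrite [leRHS](_ : _ = 8 / 3 * (normal_peak 1 * expR (- x ^+ 2 / (2 ^+ 2 *+ 2)))); last by field; rewrite gt_eqF.
rewrite [leLHS](_ : _ = (x ^+ 2 * expR (- (3 / 8 * x ^+ 2))) * (normal_peak 1 * expR (- x ^+ 2 / (2 ^+ 2 *+ 2)))); last by ring.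
rewrite ler_wpM2r ?mulr_ge0 ?expR_ge0 ?normal_peak_ge0//.
have [->|x0] := eqVneq x 0; first by rewrite expr0n/= mul0r; lra.
have x20 : 0 < x ^+ 2 by rewrite exprn_even_gt0.
have := @expRN_le_inv (3 / 8 * x ^+ 2) ltac:(by rewrite mulr_gt0// divr_gt0).
move=> /(ler_wpM2l (ltW x20)) /le_trans; apply.
by rewrite le_eqVlt; apply/orP; left; apply/eqP; field.
Qed.

Lemma integrable_sqr_normal :
  (normal_prob 0 1).-integrable setT (fun x : R => (1 + x ^+ 2)%:E).
Proof.
have m : measurable_fun [set: R] (fun x : R => 1 + x ^+ 2).
  by apply: measurable_funD => //; exact: measurable_funX.
apply: (@integrable_normal_prob R 0 1 (fun x => 1 + x ^+ 2) m).
set C := 8 / 3 * normal_peak (1 : R) / normal_peak 2.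
have C0 : 0 <= C by rewrite !mulr_ge0 ?invr_ge0 ?normal_peak_ge0.
apply: (@le_integrable _ (measurableTypeR R) _ _ _ _ _
  (fun x => (normal_pdf 0 1 x)%:E + C%:E * (normal_pdf 0 2 x)%:E)%E) => //.
- by apply/measurable_EFinP; apply: measurable_funM => //; exact: measurable_normal_pdf.
- move=> x _ /=; rewrite lee_fin !ger0_norm.
  + by rewrite mulrDl mul1r lerD2l; exact: sqr_normal_pdf_le.
  + by rewrite addr_ge0 ?normal_pdf_ge0// mulr_ge0// normal_pdf_ge0.
  + by rewrite mulr_ge0 ?normal_pdf_ge0 ?addr_ge0 ?sqr_ge0.
- apply: integrableD => //; first exact: integrable_normal_pdf.
  by apply: integrableZl => //; exact: integrable_normal_pdf.
Qed.

Lemma normal_integrable_quadratic (f : R -> R) (C : R) :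
  measurable_fun [set: R] f -> (forall x, `|f x| <= C * (1 + x ^+ 2)) ->
  (normal_prob 0 1).-integrable setT (EFin \o f).
Proof.
move=> mf fC; apply: (@le_integrable _ (measurableTypeR R) _ _ _ _ _
  (fun x => C%:E * (1 + x ^+ 2)%:E)%E) => //.
- exact/measurable_EFinP.
- by move=> x _ /=; rewrite lee_fin (le_trans (fC x))// ler_norm.
- by apply: integrableZl => //; exact: integrable_sqr_normal.
Qed.

(** The integrand times the density is the derivative of [- psi p]; integrate over [[-n, n]] and let
    [n] grow. The growth allowances are those of a linear form times a bounded function of a
    quadratic form. *)
Lemma gaussian_ibp (psi dpsi : R -> R) (C : R) :
  (forall x : R, is_derive x 1 psi (dpsi x)) -> continuous dpsi ->
  (forall x, `|psi x| <= C * (1 + `|x|)) ->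
  (forall x, `|dpsi x| <= C * (1 + x ^+ 2)) ->
  \int[normal_prob 0 1]_x (x * psi x - dpsi x) = 0.
Proof.
move=> dp cdp bp bdp.
have cp : continuous psi by move=> x; exact: (is_derive_continuous (dp x)).
pose p : R -> R := normal_pdf 0 1.
have cpdf : continuous p by exact: continuous_normal_pdf.
pose h x := x * psi x - dpsi x.
have ch : continuous h by move=> x; apply: cvgB; [apply: cvgM|]; [exact: cvg_id|exact: cp|exact: cdp].
have mh : measurable_fun [set: R] h by exact: continuous_measurable_fun.
pose f x := h x * p x.
have cf : continuous f by move=> x; apply: cvgM; [exact: ch|exact: cpdf].
pose F x := - (psi x * p x).
have dF (x : R) : is_derive x 1 F (f x).
  have dpx := dp x; have := @is_derive_normal_pdf 1 x ltac:(by []) => dpdf.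
  apply: is_derive_eq; rewrite /f /h /GRing.scale/= /p expr1n divr1; ring.
have C0 : 0 <= C by have := le_trans (normr_ge0 _) (bp 0); rewrite normr0 addr0 mulr1.
have hbound x : `|h x| <= 3 * C * (1 + x ^+ 2).
  rewrite (le_trans (ler_normB _ _))// normrM.
  have := ler_wpM2l (normr_ge0 x) (bp x); have := bdp x.
  have x2 : `|x| ^+ 2 = x ^+ 2 by rewrite real_normK// num_real.
  have : 0 <= (`|x| - 1) ^+ 2 by rewrite sqr_ge0.
  rewrite -x2; move: (normr_ge0 x); move: `|x| => y; nra.
have ih : (normal_prob 0 1).-integrable setT (EFin \o h).
  exact: normal_integrable_quadratic hbound.
rewrite Rintegral_normal_prob//.
have iff : mu.-integrable setT (EFin \o f).
  set D := 8 / 3 * normal_peak (1 : R) / normal_peak 2.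
  apply: (@le_integrable _ (measurableTypeR R) _ _ _ _ _
    (fun x => (3 * C)%:E * ((normal_pdf 0 1 x)%:E + D%:E * (normal_pdf 0 2 x)%:E))%E) => //.
  - by apply/measurable_EFinP; exact: continuous_measurable_fun.
  - move=> x _ /=; rewrite lee_fin normrM (ger0_norm (normal_pdf_ge0 _ _ _)).
    rewrite (le_trans _ (ler_norm _))//.
    have /le_trans := ler_wpM2r (normal_pdf_ge0 0 1 x) (hbound x); apply.
    rewrite -!mulrA ler_pM2l// ler_wpM2l// mulrDl mul1r lerD2l.
    by rewrite /D -!mulrA; have := sqr_normal_pdf_le x; rewrite -!mulrA.
  - apply: integrableZl => //; apply: integrableD => //; first exact: integrable_normal_pdf.
    by apply: integrableZl => //; exact: integrable_normal_pdf.
pose A n : set R := `[- n%:R, n%:R]%classic.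
pose f_ n x := ((EFin \o f) \_ (A n)) x.
have mA n : measurable (A n) by exact: measurable_itv.
have mf_ n : measurable_fun [set: R] (f_ n).
  apply/(measurable_restrictT _ _).1 => //.
  by apply: measurable_funTS; exact: measurable_int iff.
have f_cvg : {ae mu, forall x, setT x -> f_ ^~ x @ \oo --> (EFin \o f) x}.
  apply: aeW => x _; apply: cvg_near_cst; near=> n; rewrite /f_ patchE mem_set//.
  by rewrite /A/= in_itv/= -ler_norml; near: n; exact: nbhs_infty_ger.
have f_dom : {ae mu, forall x n, setT x -> (`|f_ n x| <= (abse \o (EFin \o f)) x)%E}.
  by apply: aeW => x n _; rewrite /f_ patchE; case: ifP => // _; rewrite abse0; exact: abse_ge0.
have [_ _ lim] := @dominated_convergence _ (measurableTypeR R) R mu _ measurableT _ _ _ mf_ (measurable_int _ iff) f_cvg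
  (integrable_abse iff) f_dom.
suff lim0 : (fun n => \int[mu]_x f_ n x)%E @ \oo --> 0%E.
  by rewrite /Rintegral (cvg_unique _ lim lim0).
have FE n : (0 < n)%N -> (\int[mu]_x f_ n x)%E = (F n%:R - F (- n%:R))%:E.
  move=> n0; rewrite -integral_mkcond EFinB.
  apply: (@continuous_FTC2 _ f F) => //.
  - by rewrite -subr_gt0 opprK addr_gt0// ltr0n.
  - exact: continuous_subspaceT.
  - split.
    + by move=> x _; have [] := dF x.
    + by apply: cvg_at_right_filter; exact: (is_derive_continuous (dF _)).
    + by apply: cvg_at_left_filter; exact: (is_derive_continuous (dF _)).
  - by move=> x _; rewrite derive1E; have [_] := dF x.
(* The crude bound [exp (- u) <= 1 / u] gives [p = O(x^-2)], which beats the linear growth of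
   [psi]. *)
have Fb (x : R) : 1 <= `|x| -> `|F x| <= 4 * C * normal_peak 1 / `|x|.
  move=> x1; rewrite /F normrN normrM (ger0_norm (normal_pdf_ge0 _ _ _)).
  have x0 : 0 < `|x| by rewrite (lt_le_trans ltr01).
  have x2 : `|x| ^+ 2 = x ^+ 2 by rewrite real_normK// num_real.
  have psib : `|psi x| <= 2 * C * `|x| by move: (bp x) x1 C0; move: `|x| `|psi x| => y z; nra.
  have pb : p x <= normal_peak 1 * (2 / `|x| ^+ 2).
    rewrite /p normal_pdf0E// ler_wpM2l ?normal_peak_ge0// expr1n -x2 mulNr.
    by rewrite (le_trans (expRN_le_inv _)) ?divr_gt0 ?exprn_gt0// invf_div.
  have := ler_pM (normr_ge0 _) (normal_pdf_ge0 _ _ _) psib pb.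
  move=> /le_trans; apply; rewrite le_eqVlt; apply/orP; left; apply/eqP; field.
  by rewrite gt_eqF.
have : (fun n => F n%:R - F (- n%:R)) @ \oo --> (0 : R).
  have inv0 : (fun n : nat => 4 * C * normal_peak 1 / n%:R : R) @ \oo --> (0 : R).
    rewrite -(mulr0 (4 * C * normal_peak 1)); apply: cvgM; first exact: cvg_cst.
    exact: cvg_invn.
  rewrite -(subr0 0); apply: cvgB.
  - apply/cvgr0Pnorm_le => e e0; near=> n.
    have n1 : 1 <= `|n%:R : R| by rewrite normr_nat ler1n; near: n; exists 1%N.
    rewrite (le_trans (Fb _ n1))// normr_nat; near: n.
    by apply: (cvgr_le _ inv0).
  - apply/cvgr0Pnorm_le => e e0; near=> n.
    have n1 : 1 <= `|- n%:R : R| by rewrite normrN normr_nat ler1n; near: n; exists 1%N.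
    rewrite (le_trans (Fb _ n1))// normrN normr_nat; near: n.
    by apply: (cvgr_le _ inv0).
move=> F0; apply/fine_cvgP; split.
  by near=> n; rewrite FE//; near: n; exists 1%N.
apply: cvg_trans F0; apply: near_eq_cvg; near=> n.
by rewrite /= FE//; near: n; exists 1%N.
Unshelve. all: by end_near. Qed.

End gaussian_ibp.

Lemma Rintegral_cst_probability d (T : measurableType d) (R : realType)
  (P : probability T R) (c : R) : \int[P]_w c = c.
Proof.
by rewrite Rintegral_cst// [fine _](congr1 fine (probability_setT P)) mulr1.
Qed.

(** * Stein's equation *)

Section stein_equation.
Context (R : realType) (s : R) (s0 : s != 0).
Notation mu := (@lebesgue_measure R).
Notation p := (normal_pdf 0 s).

Let s20 : 0 < s ^+ 2. Proof. by rewrite exprn_even_gt0. Qed.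

Let p_gt0 x : 0 < p x.
Proof. by rewrite normal_pdf0E// mulr_gt0 ?normal_peak_gt0 ?expR_gt0. Qed.

Lemma integrable_bounded_normal_pdf (h : R -> R) (K : R) (A : set (measurableTypeR R)) :
  continuous h -> (forall x, `|h x| <= K) -> measurable A ->
  mu.-integrable A (EFin \o (fun x => h x * p x)).
Proof.
move=> ch hK mA; apply: (@integrableS _ (measurableTypeR R) _ mu setT) => //.
apply: (@le_integrable _ (measurableTypeR R) _ _ _ _ _
  (fun x => K%:E * (p x)%:E)%E) => //.
- apply/measurable_EFinP; apply: measurable_funM; last exact: measurable_normal_pdf.
  exact: continuous_measurable_fun.
- move=> x _ /=; rewrite lee_fin (le_trans _ (ler_norm _))// normrM.
  by rewrite (ger0_norm (ltW (p_gt0 _))) ler_wpM2r// ltW.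
- by apply: integrableZl => //; exact: integrable_normal_pdf.
Qed.

Lemma is_derive_primitive_normal (h : R -> R) (K : R) (x : R) :
  continuous h -> (forall x, `|h x| <= K) ->
  is_derive x 1 (fun z => \int[mu]_(y in `]-oo, z]) (h y * p y)) (h x * p x).
Proof.
move=> ch hK.
pose F (z : R) := \int[mu]_(y in [set` Interval -oo%O (BRight z)]) (h y * p y).
have [D E] : derivable F x 1 /\ (F^`())%classic x = h x * p x.
  apply: (@continuous_FTC1 R (fun y => h y * p y) -oo%O x (x + 1)).
  - by rewrite ltrDl.
  - exact: integrable_bounded_normal_pdf ch hK _.
  - by rewrite ltNyr.
  - by apply: cvgM; [exact: ch|exact: continuous_normal_pdf].
by apply: DeriveDef => //; rewrite -derive1E.
Qed.

Lemma le_Rintegral_bounded_normal (h : R -> R) (K : R) (A : set (measurableTypeR R)) :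
  continuous h -> (forall x, `|h x| <= K) -> measurable A ->
  `|\int[mu]_(y in A) (h y * p y)| <= K * \int[mu]_(y in A) p y.
Proof.
move=> ch hK mA.
have i1 := integrable_bounded_normal_pdf ch hK mA.
have i2 : mu.-integrable A (EFin \o p).
  by apply: (@integrableS _ (measurableTypeR R) _ mu setT) => //; exact: integrable_normal_pdf.
apply: (le_trans (le_normr_Rintegral _ _)) => //.
rewrite -RintegralZl//; apply: le_Rintegral => //.
- exact: (@integrable_norm _ _ _ mu _ _ i1).
- exact: (@integrableZl _ _ _ mu A mA K (EFin \o p) i2).
- by move=> x _; rewrite normrM (ger0_norm (ltW (p_gt0 _))) ler_wpM2r// ltW.
Qed.

(* If [x] and [y - x] have the same sign then [y^2 >= x^2 + (y - x)^2]. *)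
Lemma tail_normal_le (x : R) (A : set (measurableTypeR R)) : measurable A ->
  (forall y, A y -> 0 <= x * (y - x)) ->
  \int[mu]_(y in A) p y <= p x / normal_peak s.
Proof.
move=> mA xA.
have pk : 0 < normal_peak s by rewrite normal_peak_gt0.
have iN m : mu.-integrable setT (EFin \o normal_pdf m s) by exact: integrable_normal_pdf.
have iA m : mu.-integrable A (EFin \o normal_pdf m s).
  by apply: (@integrableS _ (measurableTypeR R) _ mu setT).
have c0 : 0 <= p x / normal_peak s by rewrite divr_ge0// ltW.
apply: (@le_trans _ _ (\int[mu]_(y in A) (p x / normal_peak s * normal_pdf x s y))).
  apply: le_Rintegral => //.
    exact: (@integrableZl _ _ _ mu A mA _ (EFin \o normal_pdf x s)).
  move=> y Ay; rewrite normal_pdf0E// normal_pdf0E// normal_pdfE// /normal_fun.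
  rewrite [leRHS](_ : _ = normal_peak s * (expR (- x ^+ 2 / (s ^+ 2 *+ 2)) *
    expR (- (y - x) ^+ 2 / (s ^+ 2 *+ 2)))); last by field; rewrite gt_eqF.
  rewrite ler_wpM2l ?normal_peak_ge0// -expRD ler_expR -mulrDl ler_wpM2r//.
    by rewrite invr_ge0 mulrn_wge0// sqr_ge0.
  by have := xA y Ay; nra.
rewrite RintegralZl// ler_piMr// (_ : 1 = fine (\int[mu]_y (normal_pdf x s y)%:E)%E).
  rewrite /Rintegral; apply: fine_le.
  - exact: (@integrable_fin_num _ _ _ mu A mA (EFin \o normal_pdf x s) (iA x)).
  - exact: (@integrable_fin_num _ _ _ mu setT measurableT (EFin \o normal_pdf x s) (iN x)).
  - apply: ge0_subset_integral => //; first by apply: measurable_int (iN x).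
    by move=> y _; rewrite lee_fin normal_pdf_ge0.
by rewrite integral_normal_pdf.
Qed.

Let cst1_cont : continuous (fun _ : R => 1 : R). Proof. by move=> x; exact: cvg_cst. Qed.
Let cst1_le (x : R) : `|1 : R| <= 1. Proof. by rewrite normr1. Qed.

Let T (x : R) := \int[mu]_(y in `]-oo, x]) p y.

Let dT (x : R) : is_derive x 1 T (p x).
Proof.
have := is_derive_primitive_normal x cst1_cont cst1_le; rewrite mul1r.
by congr is_derive; apply/funext => z; apply: eq_Rintegral => y _; rewrite mul1r.
Qed.

Let T_ge0 x : 0 <= T x.
Proof. by apply: Rintegral_ge0 => y _; rewrite normal_pdf_ge0. Qed.

Let T_le x : x <= 0 -> T x <= p x / normal_peak s.
Proof.
move=> x0; apply: tail_normal_le => // y /=; rewrite in_itv/= => yx.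
by rewrite mulr_le0// subr_le0.
Qed.

Let U (x : R) := \int[mu]_(y in `]x, +oo[) p y.

Let U_ge0 x : 0 <= U x.
Proof. by apply: Rintegral_ge0 => y _; rewrite normal_pdf_ge0. Qed.

Let U_le x : 0 <= x -> U x <= p x / normal_peak s.
Proof.
move=> x0; apply: tail_normal_le => // y /=; rewrite in_itv/= andbT => /ltW yx.
by rewrite mulr_ge0// subr_ge0.
Qed.

Let split_line (h : R -> R) (K : R) (x : R) : continuous h -> (forall x, `|h x| <= K) ->
  \int[mu]_(y in `]-oo, x]) (h y * p y) + \int[mu]_(y in `]x, +oo[) (h y * p y) =
  \int[normal_prob 0 s]_y h y.
Proof.
move=> ch hK.
have mh : measurable_fun [set: R] h by exact: continuous_measurable_fun.
have iT := integrable_bounded_normal_pdf ch hK (@measurableT _ (measurableTypeR R)).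
have ih := @integrable_normal_prob R 0 s h mh iT.
rewrite Rintegral_normal_prob// -Rintegral_setU//.
- by rewrite -itv_bndbnd_setU// set_itvE.
- by rewrite -itv_bndbnd_setU// set_itvE.
- by apply/disj_setPS => y [/=]; rewrite !in_itv/= andbT => /le_lt_trans/[apply]; rewrite ltxx.
Qed.

Let U_T x : U x = 1 - T x.
Proof.
have := split_line x cst1_cont cst1_le.
rewrite (_ : \int[mu]_(y in `]-oo, x]) (1 * p y) = T x); last first.
  by apply: eq_Rintegral => y _; rewrite mul1r.
rewrite (_ : \int[mu]_(y in `]x, +oo[) (1 * p y) = U x); last first.
  by apply: eq_Rintegral => y _; rewrite mul1r.
rewrite Rintegral_cst_probability => <-; ring.
Qed.

Let dU (x : R) : is_derive x 1 U (- p x).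
Proof.
have -> : U = (fun y => 1 - T y) by apply/funext => y; rewrite U_T.
by have := @is_deriveB R R R (cst (1 : R)) T x 1 0 (p x) (is_derive_cst (1 : R) x 1) (dT x); rewrite sub0r.
Qed.

Let mul_p_le x : 0 < x -> x * (p x / normal_peak s) <= 2 * s ^+ 2 / x.
Proof.
move=> x0; rewrite normal_pdf0E//.
have pk : 0 < normal_peak s by rewrite normal_peak_gt0.
rewrite [X in x * X](_ : _ = expR (- x ^+ 2 / (s ^+ 2 *+ 2))); last by field; rewrite gt_eqF.
rewrite mulNr (le_trans (ler_wpM2l (ltW x0) (expRN_le_inv _)))//.
  by rewrite divr_gt0 ?exprn_gt0// pmulrn_lgt0.
rewrite le_eqVlt; apply/orP; left; apply/eqP; field.
by rewrite s0 gt_eqF.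
Qed.

(** Carries the limits at infinity in [mills_left] and [mills_right]: monotonicity compares with the
    value at an integer point, which is at least [- c / (n + 1)]. *)
Let ge0_of_ge_inv (c r x : R) : (forall n : nat, x <= n.+1%:R -> - (c / n.+1%:R) <= r) -> 0 <= r.
Proof.
move=> h; have cv : (fun n : nat => - (c / n.+1%:R)) @ \oo --> (0 : R).
  rewrite -oppr0; apply: cvgN; rewrite -(mulr0 c); apply: cvgM; first exact: cvg_cst.
  exact: cvg_harmonic.
rewrite leNgt; apply/negP => r0; near \oo => n.
have : r < - (c / n.+1%:R) by near: n; exact: (cvgr_gt _ cv).
rewrite ltNge h// (@le_trans _ _ n%:R) ?ler_nat//.
by near: n; exact: nbhs_infty_ger.
Unshelve. all: by end_near. Qed.

(* [s^2 p(x) + x T(x)] is nondecreasing and vanishes at [-oo]. *)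
Let mills_left x : x <= 0 -> - x * T x <= s ^+ 2 * p x.
Proof.
move=> x0; pose f y := s ^+ 2 * p y + y * T y.
have df (y : R) : is_derive y 1 f (T y).
  have dTy := dT y; have dpy := is_derive_normal_pdf y s0.
  by apply: is_derive_eq; rewrite /GRing.scale/=; field.
rewrite -subr_ge0 mulNr opprK -/(f x).
apply: (@ge0_of_ge_inv (2 * s ^+ 2) _ (- x)) => n xn.
have n0 : 0 < n.+1%:R :> R by [].
apply: (@le_trans _ _ (f (- n.+1%:R))).
  rewrite /f mulNr (@le_trans _ _ (- (n.+1%:R * T (- n.+1%:R))))//; last first.
    by rewrite lerDr mulr_ge0// ?ltW.
  rewrite lerN2 (le_trans (ler_wpM2l (ltW n0) (T_le _)))// ?oppr_le0//.
  have <- : p n.+1%:R = p (- n.+1%:R) by rewrite !normal_pdf0E// sqrrN.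
  exact: mul_p_le.
apply: (@ger0_derive1_ndecrNy _ f x) => //.
- by move=> y _; rewrite derive1E; have [_ ->] := df y.
- by apply: continuous_subspaceT => y; exact: (is_derive_continuous (df y)).
- by rewrite lerNl.
Qed.

Let mills_right x : 0 <= x -> x * U x <= s ^+ 2 * p x.
Proof.
move=> x0; pose f y := s ^+ 2 * p y - y * U y.
have df (y : R) : is_derive y 1 f (- U y).
  have dUy := dU y; have dpy := is_derive_normal_pdf y s0.
  by apply: is_derive_eq; rewrite /GRing.scale/=; field.
rewrite -subr_ge0 -/(f x).
apply: (@ge0_of_ge_inv (2 * s ^+ 2) _ x) => n xn.
have n0 : 0 < n.+1%:R :> R by [].
apply: (@le_trans _ _ (f n.+1%:R)).
  rewrite /f (@le_trans _ _ (- (n.+1%:R * U n.+1%:R)))//; last first.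
    by rewrite lerDr mulr_ge0// ?ltW.
  rewrite lerN2 (le_trans (ler_wpM2l (ltW n0) (U_le _)))//.
  exact: mul_p_le.
apply: (@ler0_derive1_nincry _ f x) => //.
- by move=> y _; rewrite derive1E; have [_ ->] := df y; rewrite oppr_le0.
- by apply: continuous_subspaceT => y; exact: (is_derive_continuous (df y)).
Qed.

(** The solution is [phi = I / (s^2 p)], where [I] integrates [(g - N(g)) p] from [-oo]. As the full
    integral vanishes, [I] is also minus the upper tail, so at each point the smaller tail can be
    used. The tail bound controls [phi], the Mills ratio controls [x phi], and the equation then
    bounds [dphi]; only sup |g| enters. *)
Lemma stein_solution : exists2 C : R, 0 <= C & forall (K : R) (g : R -> R),
  continuous g -> (forall x, `|g x| <= K) ->
  exists phi dphi : R -> R,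
  [/\ forall x : R, is_derive x 1 phi (dphi x), continuous dphi,
      forall x, `|phi x| <= C * K, forall x, `|dphi x| <= C * K &
      forall x, s ^+ 2 * dphi x - x * phi x = g x - \int[normal_prob 0 s]_y g y].
Proof.
have pk : 0 < normal_peak s by rewrite normal_peak_gt0.
(* The first summand bounds [phi], the second [dphi]; the factors 2 and 4 come from
   [|g - N(g)| <= 2 K]. *)
exists (2 / (s ^+ 2 * normal_peak s) + 4 / s ^+ 2) => [|K g cg gK].
  by apply: addr_ge0; apply: divr_ge0 => //; [apply: mulr_ge0|]; exact: ltW.
have K0 : 0 <= K by exact: le_trans (normr_ge0 _) (gK 0).
set c := \int[normal_prob 0 s]_y g y.
have mg : measurable_fun [set: R] g by exact: continuous_measurable_fun.
have ig := @integrable_normal_prob R 0 s g mg (integrable_bounded_normal_pdf cg gK (@measurableT _ (measurableTypeR R))).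
have cK : `|c| <= K.
  apply: (le_trans (le_normr_Rintegral _ _)) => //.
  apply: (@le_trans _ _ (\int[normal_prob 0 s]_y (cst K y))).
    apply: le_Rintegral => //.
    - exact: (@integrable_norm _ _ _ (normal_prob 0 s) _ _ ig).
    - exact: finite_measure_integrable_cst.
  by rewrite Rintegral_cst_probability.
pose h y := g y - c.
have ch : continuous h by move=> x; apply: cvgB; [exact: cg|exact: cvg_cst].
have hK x : `|h x| <= 2 * K by rewrite (le_trans (ler_normB _ _))// mulr_natl mulr2n lerD.
pose I x := \int[mu]_(y in `]-oo, x]) (h y * p y).
have dI (x : R) : is_derive x 1 I (h x * p x) by exact: is_derive_primitive_normal ch hK.
have ITU x : I x = - \int[mu]_(y in `]x, +oo[) (h y * p y).
  apply/eqP; rewrite -addr_eq0 /I (split_line x ch hK) RintegralB//; last exact: finite_measure_integrable_cst.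
  by rewrite Rintegral_cst_probability subrr.
have I1 x : `|I x| <= 2 * K * (p x / normal_peak s).
  have [x0|/ltW x0] := leP x 0.
    by rewrite (le_trans (le_Rintegral_bounded_normal ch hK _))// ler_wpM2l ?mulr_ge0//; exact: T_le.
  rewrite ITU normrN (le_trans (le_Rintegral_bounded_normal ch hK _))//.
  by rewrite ler_wpM2l ?mulr_ge0//; exact: U_le.
have I2 x : `|x * I x| <= 2 * K * (s ^+ 2 * p x).
  rewrite normrM; have [x0|/ltW x0] := leP x 0.
    rewrite (le_trans (ler_wpM2l (normr_ge0 _) (le_Rintegral_bounded_normal ch hK _)))//.
    by rewrite mulrCA ler_wpM2l ?mulr_ge0// ler0_norm//; exact: mills_left.
  rewrite ITU normrN (le_trans (ler_wpM2l (normr_ge0 _) (le_Rintegral_bounded_normal ch hK _)))//.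
  by rewrite mulrCA ler_wpM2l ?mulr_ge0// ger0_norm//; exact: mills_right.
pose phi x := I x * (s ^+ 2 * p x)^-1.
pose dphi x := (h x + x * phi x) / s ^+ 2.
have q0 x : s ^+ 2 * p x != 0 by rewrite gt_eqF// mulr_gt0.
have dphiP (x : R) : is_derive x 1 phi (dphi x).
  have dIx := dI x; have dpx := is_derive_normal_pdf x s0.
  have dq : is_derive x 1 (fun y => s ^+ 2 * p y) (- x * p x).
    by apply: is_derive_eq; rewrite /GRing.scale/=; field.
  have dqV := @is_deriveV R (fun y => s ^+ 2 * p y) x _ 1 (q0 x) dq.
  apply: is_derive_eq; rewrite /dphi /phi /GRing.scale/= -exprVn; field.
  by rewrite s0 gt_eqF.
exists phi, dphi; split => //.
- move=> x; apply: cvgM; last exact: cvg_cst.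
  apply: cvgD; first exact: ch.
  by apply: cvgM; [exact: cvg_id|exact: (is_derive_continuous (dphiP x))].
- move=> x; rewrite /phi normrM normfV (gtr0_norm (mulr_gt0 s20 (p_gt0 x))).
  rewrite ler_pdivrMr ?(mulr_gt0 s20 (p_gt0 _))// (le_trans (I1 x))//.
  rewrite -subr_ge0 [leRHS](_ : _ = 4 * K * p x); last by field; rewrite gt_eqF.
  by rewrite !mulr_ge0// ltW.
- move=> x; rewrite /dphi normrM normfV (gtr0_norm s20) ler_pdivrMr//.
  have xphi : `|x * phi x| <= 2 * K.
    rewrite /phi mulrA normrM normfV (gtr0_norm (mulr_gt0 s20 (p_gt0 x))).
    by rewrite ler_pdivrMr ?(mulr_gt0 s20 (p_gt0 _))// I2.
  rewrite (le_trans (ler_normD _ _))// (le_trans (lerD (hK x) xphi))//.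
  rewrite -subr_ge0 [leRHS](_ : _ = 2 * K / normal_peak s); last by field; rewrite s0 gt_eqF.
  by rewrite divr_ge0 ?mulr_ge0// ltW.
- by move=> x; rewrite /dphi /h; field.
Qed.

End stein_equation.

(** * Independence of one mode from all the others *)

Section independence.
Context (R : realType) (d : measure_display) (T : measurableType d)
  (P : probability T R) (xi : nat -> {RV P >-> R}).

(** A pi-system for the modes other than [k], restricted to the positive indices that the
    independence hypothesis covers. *)
Definition cylinders (k : nat) : set (set T) :=
  [set B | exists (s : seq nat) (A : nat -> set R),
    [/\ uniq s, [set` s] `<=` [set l | (0 < l)%N /\ l != k],
        forall l, measurable (A l) & B = \bigcap_(l in [set` s]) (xi l @^-1` A l)]].

(* The sample space with the sigma-algebra generated by the [xi l], [l <> k]. *)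
Definition others (k : nat) : measurableType (cylinders k).-sigma :=
  g_sigma_algebraType (cylinders k).

Lemma cylinders_setI (k : nat) : setI_closed (cylinders k).
Proof.
move=> _ _ [s1 [A1 [u1 s1k mA1 ->]]] [s2 [A2 [u2 s2k mA2 ->]]].
exists (undup (s1 ++ s2)), (fun l => (if l \in s1 then A1 l else setT) `&`
  (if l \in s2 then A2 l else setT)); split.
- exact: undup_uniq.
- by move=> l /=; rewrite mem_undup mem_cat => /orP[/s1k|/s2k].
- by move=> l; apply: measurableI; case: ifP.
- apply/seteqP; split => w /=.
    move=> [w1 w2] l /=; rewrite mem_undup mem_cat => ls; split.
      by case: ifP => // /w1.
    by case: ifP => // /w2.
  move=> h; split=> l /= ls; have /= := h l; rewrite mem_undup mem_cat ls ?orbT => /(_ isT)[] //.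
Qed.

Lemma cylinders_setT (k : nat) : cylinders k setT.
Proof.
exists [::], (fun=> setT); split => //.
by apply/seteqP; split => // w _ l /=; rewrite in_nil.
Qed.

Lemma cylinders_measurable (k : nat) : cylinders k `<=` measurable.
Proof.
move=> _ [s [A [_ _ mA ->]]]; apply: fin_bigcap_measurable; first exact: finite_seq.
by move=> l _; exact: measurable_funPTI.
Qed.

Lemma others_measurable (k : nat) (B : set T) :
  measurable (B : set (others k)) -> measurable B.
Proof.
apply: smallest_sub; last exact: cylinders_measurable.
exact: sigma_algebra_measurable.
Qed.

Lemma measurable_fun_others (k l : nat) : (0 < l)%N -> l != k ->
  measurable_fun setT (xi l : others k -> R).
Proof.
move=> l0 lk _ /= A mA; rewrite setTI; apply: sub_sigma_algebra.
exists [:: l], (fun=> A); split => //.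
  by move=> j /=; rewrite inE => /eqP ->.
by apply/seteqP; split => w /=; [move=> h j /=; rewrite inE => /eqP ->|apply => /=; rewrite inE].
Qed.

Hypothesis hxi : iid_standard_normal [set k | (0 < k)%N] xi.

(** For fixed [A] both sides are finite measures in [B]. They agree on the cylinders, where [k] can
    be added to the index list, and hence on the generated sigma-algebra. *)
Lemma indep_others (k : nat) (A : set R) (B : set T) : (0 < k)%N ->
  measurable A -> measurable (B : set (others k)) ->
  P (xi k @^-1` A `&` B) = (P (xi k @^-1` A) * P B)%E.
Proof.
move=> k0 mA mB; have [ind _] := hxi.
have mkA : measurable (xi k @^-1` A) by exact: measurable_funPTI.
have cfin : P (xi k @^-1` A) \is a fin_num by rewrite fin_num_measure.
have c0 : 0 <= fine (P (xi k @^-1` A)) by rewrite fine_ge0.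
pose m1 : {measure set T -> \bar R} := mrestr P mkA.
pose m2 : {measure set T -> \bar R} := mscale (NngNum c0) P.
have -> : P (xi k @^-1` A `&` B) = m1 B by rewrite /m1/= /mrestr setIC.
have -> : (P (xi k @^-1` A) * P B)%E = m2 B by rewrite /m2/= /mscale/= fineK.
apply: (@g_sigma_algebra_measure_unique _ R T (cylinders k)
  (@cylinders_measurable k) (fun=> setT)) => //.
- by move=> _; exact: cylinders_setT.
- by rewrite bigcup_const.
- exact: cylinders_setI.
- move=> _ [s [F [us sk mF ->]]].
  rewrite /m1 /m2/= /mrestr /mscale/= fineK//.
  have ks : k \notin s by apply/negP => /sk[_]; rewrite eqxx.
  (* One family for the index list [k :: s], so that independence applies to the joint event at
     once. *)
  pose F' l := if l == k then A else F l.
  have mF' l : measurable (F' l) by rewrite /F'; case: ifP.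
  have -> : P (\bigcap_(l in [set` s]) xi l @^-1` F l) = (\prod_(l <- s) P (xi l @^-1` F' l))%E.
    rewrite (ind s F)//; last by move=> l /sk[].
    apply: eq_big_seq => l ls; rewrite /F'; case: eqP => // lk.
    by move: ks; rewrite -lk ls.
  have -> : P (xi k @^-1` A) = P (xi k @^-1` F' k) by rewrite /F' eqxx.
  rewrite -(big_cons _ _ k s xpredT (fun l => P (xi l @^-1` F' l))) -(ind (k :: s) F')//=.
  - congr (P _); apply/seteqP; split => w /=.
      move=> [h hk] l /=; rewrite inE => /predU1P[->|ls]; first by rewrite /F' eqxx.
      rewrite /F'; case: eqP => [lk|_]; first by move: ks; rewrite -lk ls.
      exact: h.
    move=> h; split; last by have /= := h k; rewrite inE eqxx /F' eqxx; exact.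
    move=> l /= ls; have /= := h l; rewrite inE ls orbT /F' => /(_ isT).
    by case: eqP => // lk; move: ks; rewrite -lk ls.
  - by rewrite ks.
  - by move=> l /=; rewrite inE => /predU1P[->//|/sk[]].
- move=> _; rewrite /m1/= /mrestr setTI.
  by rewrite (le_lt_trans (probability_le1 _ _)) ?ltry.
Qed.

(** Conditioning on the other modes without conditional expectations: the identity is a random
    variable with values in [others k], the pair [(xi k w, w)] has a product law, and Fubini
    integrates the first coordinate out. *)
Lemma Rintegral_indep_eq0 (k : nat) (h : (measurableTypeR R * others k)%type -> R) :
  (0 < k)%N -> measurable_fun setT h ->
  P.-integrable setT (EFin \o (fun w => h (xi k w, w))) ->
  (forall w, \int[normal_prob 0 1]_x h (x, w) = 0) ->
  (forall w, (normal_prob 0 1).-integrable setT (EFin \o (fun x => h (x, w)))) ->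
  \int[P]_w h (xi k w, w) = 0.
Proof.
move=> k0 mh ih h0 hi.
have mxi0 : measurable_fun setT (xi k : T -> R) by exact: measurable_funPT.
have mxi : measurable_fun setT (xi k : T -> measurableTypeR R) by exact: mxi0.
have mid : measurable_fun setT (id : T -> others k).
  by move=> _ A mA; rewrite setTI preimage_id; exact: (others_measurable mA).
have mpair : measurable_fun setT (fun w : T => (xi k w, w) : (measurableTypeR R * others k)%type).
  exact: measurable_fun_pair.
pose X : {mfun T >-> others k} := HB.pack (id : T -> others k)
  (isMeasurableFun.Build _ _ _ _ (id : T -> others k) mid).
pose Z : {mfun T >-> (measurableTypeR R * others k)%type} :=
  HB.pack (fun w : T => (xi k w, w) : (measurableTypeR R * others k)%type)
  (isMeasurableFun.Build _ _ _ _ _ mpair).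
pose m1 : {sigma_finite_measure set (measurableTypeR R) -> \bar R} := normal_prob 0 1.
pose m2 : {sigma_finite_measure set (others k) -> \bar R} := distribution P X.
have m12 A : measurable A -> (m1 \x m2)%E A = distribution P Z A.
  apply: product_measure_unique => A1 A2 mA1 mA2.
  rewrite /= /distribution /pushforward /=.
  have -> : (fun w : T => (xi k w, w)) @^-1` (A1 `*` A2) = xi k @^-1` A1 `&` A2.
    by apply/seteqP; split.
  rewrite indep_others//; congr (_ * _)%E.
  by have [_ /(_ k k0 A1 mA1)] := hxi.
have mhE : measurable_fun setT (EFin \o h) by exact/measurable_EFinP.
have iZ : (distribution P Z).-integrable setT (EFin \o h).
  exact: (@integrable_pushforward _ _ _ _ _ _ mpair P setT (EFin \o h) mhE ih measurableT).
have i12 : (m1 \x m2)%E.-integrable setT (EFin \o h).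
  apply/integrableP; split => //; have /integrableP[_] := iZ.
  apply: le_lt_trans; rewrite le_eqVlt; apply/orP; left; apply/eqP.
  by apply: eq_measure_integral => A mA _; exact: m12.
rewrite /Rintegral.
have -> : (\int[P]_w (h (xi k w, w))%:E)%E = (\int[distribution P Z]_z (EFin \o h) z)%E.
  by rewrite (@integral_pushforward _ _ _ _ _ _ mpair P setT (EFin \o h) mhE ih measurableT).
have -> : (\int[distribution P Z]_z (EFin \o h) z)%E = (\int[m1 \x m2]_z (EFin \o h) z)%E.
  by apply: eq_measure_integral => A mA _; apply/esym; exact: m12.
rewrite -(integral21_prod_meas1 i12) (_ : fubini_G _ _ = cst 0%E) ?integral0//.
(* [h0] only says that [fine] of the inner integral is 0, and [fine] also sends infinities to 0;
   integrability excludes them. *)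
apply/funext => w; rewrite /fubini_G/= -[LHS]fineK.
  by have := h0 w; rewrite /Rintegral => ->.
exact: (@integrable_fin_num _ _ _ m1 setT measurableT _ (hi w)).
Qed.

End independence.

(** * Bounded integrands, finite sums and Fatou's lemma *)

Section probability_integrals.
Context (R : realType) (d : measure_display) (T : measurableType d)
  (P : probability T R).

Lemma bounded_integrable (f : T -> R) (C : R) : measurable_fun setT f ->
  (forall w, `|f w| <= C) -> P.-integrable setT (EFin \o f).
Proof.
move=> mf fC; apply: (@le_integrable _ _ _ _ _ _ _ (EFin \o cst C)) => //.
- exact/measurable_EFinP.
- by move=> w _ /=; rewrite lee_fin (le_trans (fC w))// ler_norm.
- exact: finite_measure_integrable_cst.
Qed.

Lemma integrable_mul_bounded (f g : T -> R) (C : R) :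
  P.-integrable setT (EFin \o f) -> measurable_fun setT g ->
  (forall w, `|g w| <= C) -> P.-integrable setT (EFin \o (fun w => f w * g w)).
Proof.
move=> fi mg gC; have mf : measurable_fun setT f by apply/measurable_EFinP; exact: measurable_int fi.
apply: (@le_integrable _ _ _ _ _ _ _ (fun w => C%:E * (f w)%:E)%E) => //.
- by apply/measurable_EFinP; exact: measurable_funM.
- move=> w _ /=; rewrite lee_fin !normrM mulrC ler_wpM2r//.
  by rewrite (le_trans (gC w))// ler_norm.
- exact: integrableZl.
Qed.

Lemma Rintegral_sum (I : Type) (s : seq I) (f : I -> T -> R) :
  (forall i, P.-integrable setT (EFin \o f i)) ->
  \int[P]_w (\sum_(i <- s) f i w) = \sum_(i <- s) \int[P]_w f i w.
Proof.
move=> fi; rewrite /Rintegral.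
under eq_integral do rewrite -sumEFin.
rewrite integral_sum// -sum_fine// => i _; exact: (integrable_fin_num _ (fi i)).
Qed.

Lemma integrable_sumR (I : Type) (s : seq I) (f : I -> T -> R) :
  (forall i, P.-integrable setT (EFin \o f i)) ->
  P.-integrable setT (EFin \o (fun w => \sum_(i <- s) f i w)).
Proof.
move=> fi; have := @integrable_sum _ _ _ P setT measurableT I s xpredT _ (fun i _ => fi i).
by apply: eq_integrable => // w _; rewrite /= sumEFin.
Qed.

(** Lets a moment bound survive an almost sure limit, both when a truncation is removed and when the
    number of modes tends to infinity. *)
Lemma fatou_bound (X : nat -> T -> R) (Y : T -> R) (C : R) :
  (forall n, measurable_fun setT (X n)) -> measurable_fun setT Y ->
  (forall n w, 0 <= X n w) -> (forall w, 0 <= Y w) ->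
  {ae P, forall w, X n w @[n --> \oo] --> Y w} ->
  (\forall n \near \oo, (\int[P]_w (X n w)%:E <= C%:E)%E) ->
  (\int[P]_w (Y w)%:E <= C%:E)%E.
Proof.
move=> mX mY X0 Y0 XY XC.
have mXE n : measurable_fun setT (EFin \o X n) by exact/measurable_EFinP.
have X0E n w : setT w -> (0 <= (EFin \o X n) w)%E by move=> _; rewrite lee_fin.
have := fatou P measurableT mXE X0E.
have -> : (\int[P]_w limn_einf ((fun n => EFin \o X n) ^~ w) = \int[P]_w (Y w)%:E)%E.
  apply: ae_eq_integral => //; last first.
    apply: filterS XY => w XYw _.
    have h : (X n w)%:E @[n --> \oo] --> (Y w)%:E by apply/fine_cvgP; split; [exact: nearW|exact: XYw].
    by have [-> _] := cvg_limn_einf_sup h.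
  - exact/measurable_EFinP.
  - by apply: measurableT_comp => //; apply: measurable_fun_limn_esup => k; exact: measurableT_comp.
move=> /le_trans; apply; rewrite limn_einf_lim.
have nd := @nondecreasing_einfs R (fun n => \int[P]_w (EFin \o X n) w)%E.
apply: lime_le; first exact: ereal_nondecreasing_is_cvgn.
(* The infimum over indices from [n] on is compared with index [maxn n N], where the bound already
   holds. *)
case: XC => N _ XC; near=> n.
apply: (@le_trans _ _ (\int[P]_w (X (maxn n N) w)%:E)%E).
  by apply: ge_ereal_inf; eexists; [exists (maxn n N) => //=; exact: leq_maxl|].
by apply: XC => /=; exact: leq_maxr.
Unshelve. all: by end_near. Qed.

End probability_integrals.

(** * Quadratic forms in Gaussian variables *)

Section quadratic_form.
Context (R : realType) (M n : nat).
Implicit Types (B : 'I_M -> 'I_n -> R) (x : 'I_n -> R).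

Definition qform B x : R := \sum_j (\sum_k B j k * x k) ^+ 2.

(* Half the partial derivative of [qform B] in the direction [k]. *)
Definition qgrad B x (k : 'I_n) : R := \sum_j B j k * (\sum_l B j l * x l).

(** The trace of [B B^T], which is the mean of [qform B] at a standard Gaussian vector. *)
Definition qtrace B : R := \sum_k \sum_j B j k ^+ 2.

Lemma qform_euler B x : \sum_k x k * qgrad B x k = qform B x.
Proof.
rewrite /qgrad; under eq_bigr do rewrite mulr_sumr.
rewrite exchange_big; apply: eq_bigr => j _; rewrite expr2 mulr_suml.
by apply: eq_bigr => k _; ring.
Qed.

Lemma qform_ge0 B x : 0 <= qform B x.
Proof. by apply: sumr_ge0 => j _; exact: sqr_ge0. Qed.

(** Isolates coordinate [k]: [qform] becomes a quadratic polynomial in [x k] whose coefficients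
    depend on the other coordinates only, ready for one-variable integration by parts. *)
Definition off B x (k : 'I_n) (j : 'I_M) : R := \sum_(l | l != k) B j l * x l.

Lemma offE B x k j : \sum_l B j l * x l = B j k * x k + off B x k j.
Proof. by rewrite (bigD1 k). Qed.

Lemma qgrad_off B x k : qgrad B x k =
  (\sum_j B j k ^+ 2) * x k + \sum_j B j k * off B x k j.
Proof.
rewrite /qgrad mulr_suml -big_split; apply: eq_bigr => j _ /=.
by rewrite (offE B x k); ring.
Qed.

Lemma qform_off B x k : qform B x = (\sum_j B j k ^+ 2) * x k ^+ 2 +
  2 * (\sum_j B j k * off B x k j) * x k + \sum_j off B x k j ^+ 2.
Proof.
rewrite /qform mulr_sumr !mulr_suml -!big_split; apply: eq_bigr => j _ /=.
by rewrite (offE B x k); ring.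
Qed.

End quadratic_form.

(** * Integration by parts in a single coordinate *)

Section quadratic_ibp.
Context (R : realType) (phi dphi : R -> R) (C : R).
Hypotheses (dphiP : forall x : R, is_derive x 1 phi (dphi x))
  (cdphi : continuous dphi)
  (phiC : forall x, `|phi x| <= C) (dphiC : forall x, `|dphi x| <= C).
Variables (r q p c m : R).

(** [r], [q], [p] play the coefficients of [qform_off], so [H] is the normalised form as a function
    of one coordinate and [r * z + q] the matching component of [qgrad]. *)
Let H z := c * (r * z ^+ 2 + 2 * q * z + p - m).
Let psi z := (r * z + q) * phi (H z).
Let dpsi z := r * phi (H z) + 2 * c * (r * z + q) ^+ 2 * dphi (H z).

Let dH (z : R) : is_derive z 1 H (2 * c * (r * z + q)).
Proof. by apply: is_derive_eq; rewrite /GRing.scale/=; ring. Qed.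

Let cH : continuous H. Proof. by move=> z; exact: (is_derive_continuous (dH z)). Qed.

Let cphi : continuous phi. Proof. by move=> z; exact: (is_derive_continuous (dphiP z)). Qed.

Let dpsiP (z : R) : is_derive z 1 psi (dpsi z).
Proof.
have dHz := dH z; have dphiz := dphiP (H z).
have dcomp : is_derive z 1 (phi \o H) (dphi (H z) * (2 * c * (r * z + q))).
  exact: is_derive1_comp.
have -> : psi = (fun z => (r * z + q) * (phi \o H) z) by [].
by apply: is_derive_eq; rewrite /dpsi /GRing.scale/=; ring.
Qed.

Let cdpsi : continuous dpsi.
Proof.
move=> z; apply: cvgD; apply: cvgM; try exact: cvg_cst.
- by apply: continuous_comp; [exact: cH|exact: cphi].
- apply: cvgM; first exact: cvg_cst.
  apply: (@continuous_comp _ _ _ (fun z => r * z + q) (fun z => z ^+ 2)); last exact: exprn_continuous.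
  by apply: cvgD; [apply: cvgM; [exact: cvg_cst|exact: cvg_id]|exact: cvg_cst].
- by apply: continuous_comp; [exact: cH|exact: cdphi].
Qed.

Let C0 : 0 <= C. Proof. exact: le_trans (normr_ge0 _) (phiC 0). Qed.

Let D : R := `|r| + `|q|.
Let D0 : 0 <= D. Proof. by rewrite addr_ge0. Qed.

Let lin_le z : `|r * z + q| <= D * (1 + `|z|).
Proof.
rewrite (le_trans (ler_normD _ _))// normrM /D.
by have := normr_ge0 z; have := normr_ge0 r; have := normr_ge0 q; nra.
Qed.

(** One constant for both growth bounds: the first summand serves [psi], the other two [dpsi]. *)
Let K : R := D * C + `|r| * C + 4 * `|c| * D ^+ 2 * C.

Let psi_le z : `|psi z| <= K * (1 + `|z|).
Proof.
rewrite /psi normrM (le_trans (ler_pM _ _ (lin_le z) (phiC _)))//.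
by rewrite mulrAC ler_wpM2r ?addr_ge0// /K -addrA lerDl addr_ge0 ?mulr_ge0.
Qed.

Let dpsi_le z : `|dpsi z| <= K * (1 + z ^+ 2).
Proof.
have h1 : `|r * phi (H z)| <= `|r| * C by rewrite normrM ler_wpM2l.
have h2 : (r * z + q) ^+ 2 <= 2 * D ^+ 2 * (1 + z ^+ 2).
  have := lin_le z; have x2 : `|z| ^+ 2 = z ^+ 2 by rewrite real_normK// num_real.
  rewrite -x2 -(@real_normK _ (r * z + q)) ?num_real// => h.
  apply: (@le_trans _ _ ((D * (1 + `|z|)) ^+ 2)).
    by rewrite ler_sqr ?nnegrE// mulr_ge0// addr_ge0.
  rewrite -subr_ge0 (_ : _ - _ = D ^+ 2 * (1 - `|z|) ^+ 2); last by ring.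
  by rewrite mulr_ge0 ?sqr_ge0.
rewrite (le_trans (ler_normD _ _))// /K.
have h3 : `|2 * c * (r * z + q) ^+ 2 * dphi (H z)| <= 2 * `|c| * (2 * D ^+ 2 * (1 + z ^+ 2)) * C.
  rewrite normrM (normrM (2 * c)) (normrM 2 c) (ger0_norm (sqr_ge0 _)) (ger0_norm (ler0n _ 2)).
  apply: ler_pM => //; first by rewrite mulr_ge0 ?sqr_ge0// mulr_ge0.
  by apply: ler_wpM2l => //; rewrite mulr_ge0.
have h4 : `|r| * C <= `|r| * C * (1 + z ^+ 2) by rewrite ler_peMr ?mulr_ge0// lerDl sqr_ge0.
have h5 : 0 <= D * C * (1 + z ^+ 2) by rewrite !mulr_ge0// addr_ge0// sqr_ge0.
rewrite (le_trans (lerD (le_trans h1 h4) h3))// -subr_ge0.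
by rewrite (_ : _ - _ = D * C * (1 + z ^+ 2)); last by ring.
Qed.

Let mterm : measurable_fun [set: R] (fun z => z * psi z - dpsi z).
Proof.
apply: continuous_measurable_fun => z; apply: cvgB; last exact: cdpsi.
by apply: cvgM; [exact: cvg_id|exact: (is_derive_continuous (dpsiP z))].
Qed.

Lemma quadratic_ibp_integrable : (normal_prob 0 1).-integrable setT (EFin \o (fun z =>
  z * ((r * z + q) * phi (c * (r * z ^+ 2 + 2 * q * z + p - m))) -
  (r * phi (c * (r * z ^+ 2 + 2 * q * z + p - m)) +
   2 * c * (r * z + q) ^+ 2 * dphi (c * (r * z ^+ 2 + 2 * q * z + p - m))))).
Proof.
apply: (normal_integrable_quadratic mterm (C := 3 * K)) => z.
rewrite (le_trans (ler_normB _ _))// normrM.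
have := ler_wpM2l (normr_ge0 z) (psi_le z); have := dpsi_le z.
have K0 : 0 <= K by rewrite /K !addr_ge0 ?mulr_ge0 ?sqr_ge0.
have x2 : `|z| ^+ 2 = z ^+ 2 by rewrite real_normK// num_real.
have : 0 <= (`|z| - 1) ^+ 2 by rewrite sqr_ge0.
by rewrite -x2; move: (normr_ge0 z) K0; move: `|z| K => y k; nra.
Qed.

Lemma quadratic_ibp : \int[normal_prob 0 1]_z (
  z * ((r * z + q) * phi (c * (r * z ^+ 2 + 2 * q * z + p - m))) -
  (r * phi (c * (r * z ^+ 2 + 2 * q * z + p - m)) +
   2 * c * (r * z + q) ^+ 2 * dphi (c * (r * z ^+ 2 + 2 * q * z + p - m)))) = 0.
Proof. exact: (@gaussian_ibp R psi dpsi K dpsiP cdpsi psi_le dpsi_le). Qed.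

End quadratic_ibp.

Section square_integrable.
Context (R : realType) (d : measure_display) (T : measurableType d)
  (P : probability T R).

Definition sqint (f : T -> R) :=
  measurable_fun setT f /\ P.-integrable setT (EFin \o (fun w => f w ^+ 2)).

Lemma sqint_mul (f g : T -> R) : sqint f -> sqint g ->
  P.-integrable setT (EFin \o (fun w => f w * g w)).
Proof.
move=> [mf f2] [mg g2].
apply: (@le_integrable _ _ _ _ _ _ _ (fun w => (f w ^+ 2)%:E + (g w ^+ 2)%:E)%E) => //.
- by apply/measurable_EFinP; exact: measurable_funM.
- move=> w _ /=; rewrite lee_fin (ger0_norm (addr_ge0 (sqr_ge0 _) (sqr_ge0 _))) ler_norml.
  have h1 : 0 <= (f w + g w) ^+ 2 by exact: sqr_ge0.
  have h2 : 0 <= (f w - g w) ^+ 2 by exact: sqr_ge0.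
  by apply/andP; split; nra.
- exact: integrableD.
Qed.

Lemma sqint_lin (a : R) (f g : T -> R) : sqint f -> sqint g ->
  sqint (fun w => a * f w + g w).
Proof.
move=> sf sg; have fg := sqint_mul sf sg; case: sf sg => mf f2 [mg g2]; split.
  by apply: measurable_funD => //; exact: measurable_funM.
have := integrableD measurableT (integrableD measurableT (integrableZl measurableT (a ^+ 2) f2)
  (integrableZl measurableT (2 * a) fg)) g2.
apply: eq_integrable => // w _ /=; congr EFin; ring.
Qed.

Lemma sqint0 : sqint (fun=> 0).
Proof.
split; first exact: measurable_cst.
by apply: (@bounded_integrable _ _ _ P _ 0) => // w; rewrite expr0n normr0.
Qed.

Lemma sqint_sum (I : Type) (s : seq I) (a : I -> R) (f : I -> T -> R) :
  (forall i, sqint (f i)) -> sqint (fun w => \sum_(i <- s) a i * f i w).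
Proof.
move=> sf; elim: s => [|i s ih].
  by under eq_fun do rewrite big_nil; exact: sqint0.
by under eq_fun do rewrite big_cons; exact: sqint_lin.
Qed.

End square_integrable.

(** * The Stein identity for a Gaussian quadratic form *)

Section gaussian_quadratic_form.
Context (R : realType) (d : measure_display) (T : measurableType d)
  (P : probability T R) (xi : nat -> {RV P >-> R}).
Hypothesis hxi : iid_standard_normal [set k | (0 < k)%N] xi.
Variables (M n : nat).
Implicit Types (B : 'I_M -> 'I_n -> R).

Definition modes (w : T) (k : 'I_n) : R := xi k.+1 w.

Lemma sqint_xi (k : nat) : (0 < k)%N -> sqint P (xi k).
Proof.
move=> k0; have mx : measurable_fun setT (xi k : T -> R) by exact: measurable_funPT.
split => //; have mx2 : measurable_fun setT (fun w => xi k w ^+ 2) by exact: measurable_funX.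
have mq : measurable_fun [set: R] (fun x : R => (x ^+ 2)%:E).
  by apply/measurable_EFinP; exact: measurable_funX.
apply/integrableP; split; first exact/measurable_EFinP.
under eq_integral do rewrite /= ger0_norm ?sqr_ge0//.
have mx' : measurable_fun setT (xi k : T -> measurableTypeR R) by exact: mx.
pose X : {mfun T >-> measurableTypeR R} := HB.pack (xi k : T -> measurableTypeR R)
  (isMeasurableFun.Build _ _ _ _ (xi k : T -> measurableTypeR R) mx').
rewrite -(@ge0_integral_distribution _ _ _ _ _ P X (fun x => (x ^+ 2)%:E))//; last first.
  by move=> y; rewrite lee_fin sqr_ge0.
have -> : (\int[distribution P X]_x (x ^+ 2)%:E = \int[normal_prob 0 1]_x (x ^+ 2)%:E)%E.
  by apply: eq_measure_integral => A mA _; have [_ /(_ k k0 A mA)] := hxi.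
have /integrableP[_] := @normal_integrable_quadratic R (fun x => x ^+ 2) 1
  ltac:(exact: measurable_funX) ltac:(by move=> x; rewrite mul1r ger0_norm ?sqr_ge0// lerDr).
apply: le_lt_trans; rewrite le_eqVlt; apply/orP; left; apply/eqP.
by apply: eq_integral => x _ /=; rewrite ger0_norm// sqr_ge0.
Qed.

Lemma sqint_lincomb B j : sqint P (fun w => \sum_k B j k * modes w k).
Proof. by apply: sqint_sum => k; exact: sqint_xi. Qed.

Lemma sqint_qgrad B k : sqint P (fun w => qgrad B (modes w) k).
Proof. by apply: sqint_sum => j; exact: sqint_lincomb. Qed.

Lemma integrable_qform B : P.-integrable setT (EFin \o (fun w => qform B (modes w))).
Proof. by apply: integrable_sumR => j; case: (sqint_lincomb B j). Qed.

Lemma measurable_qform B : measurable_fun setT (fun w => qform B (modes w)).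
Proof. by apply/measurable_EFinP; exact: measurable_int (integrable_qform B). Qed.

Lemma integrable_qgrad2 B : P.-integrable setT (EFin \o (fun w => \sum_k qgrad B (modes w) k ^+ 2)).
Proof. by apply: integrable_sumR => k; case: (sqint_qgrad B k). Qed.

Section identity.
Variables (phi dphi : R -> R) (C : R).
Hypotheses (dphiP : forall x : R, is_derive x 1 phi (dphi x))
  (cdphi : continuous dphi)
  (phiC : forall x, `|phi x| <= C) (dphiC : forall x, `|dphi x| <= C).
Variables (B : 'I_M -> 'I_n -> R) (c m : R).

Let H w := c * (qform B (modes w) - m).

Let cphi : continuous phi. Proof. by move=> z; exact: (is_derive_continuous (dphiP z)). Qed.

Let mH : measurable_fun setT H.
Proof. by apply: measurable_funM => //; apply: measurable_funB => //; exact: measurable_qform. Qed.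

Let mphiH : measurable_fun setT (fun w => phi (H w)).
Proof. by apply: measurableT_comp mH; exact: continuous_measurable_fun. Qed.

Let mdphiH : measurable_fun setT (fun w => dphi (H w)).
Proof. by apply: measurableT_comp mH; exact: continuous_measurable_fun. Qed.

Let r k : R := \sum_j B j k ^+ 2.

(** Component [k] of [x . F - div F] for the vector field [F = qgrad * phi(H)]: the derivative of
    [qgrad] in direction [k] is [r k], that of [H] is [2 c qgrad]. *)
Let term (k : 'I_n) w := modes w k * (qgrad B (modes w) k * phi (H w)) -
  (r k * phi (H w) + 2 * c * qgrad B (modes w) k ^+ 2 * dphi (H w)).

Let integrable_term k : P.-integrable setT (EFin \o term k).
Proof.
have i1 : P.-integrable setT (EFin \o (fun w => modes w k * (qgrad B (modes w) k * phi (H w)))).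
  have := integrable_mul_bounded (sqint_mul (@sqint_xi k.+1 isT) (sqint_qgrad B k)) mphiH (fun w => phiC (H w)).
  by apply: eq_integrable => // w _ /=; rewrite mulrA.
have i2 := integrableZl measurableT (r k) (bounded_integrable P mphiH (fun w => phiC (H w))).
have [_ s2] := sqint_qgrad B k.
have i3 := integrableZl measurableT (2 * c) (integrable_mul_bounded s2 mdphiH (fun w => dphiC (H w))).
have := integrableB measurableT i1 (integrableD measurableT i2 i3).
by apply: eq_integrable => // w _ /=; rewrite /term; congr EFin; ring.
Qed.

Let q (k : 'I_n) (w : T) : R := \sum_j B j k * off B (modes w) k j.
Let p (k : 'I_n) (w : T) : R := \sum_j off B (modes w) k j ^+ 2.

Let moff (k : 'I_n) j : measurable_fun setT (fun w : others xi k.+1 => off B (modes w) k j).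
Proof.
rewrite /off; under eq_fun do rewrite big_mkcond; apply: measurable_sum => l.
have [lk|_] := boolP (l != k); last exact: measurable_cst.
apply: measurable_funM; first exact: measurable_cst.
by apply: measurable_fun_others => //; rewrite eqSS.
Qed.

Let mq (k : 'I_n) : measurable_fun setT (q k : others xi k.+1 -> R).
Proof.
by apply: measurable_sum => j; apply: measurable_funM; [exact: measurable_cst|exact: moff].
Qed.

Let mp (k : 'I_n) : measurable_fun setT (p k : others xi k.+1 -> R).
Proof. by apply: measurable_sum => j; apply: measurable_funX; exact: moff. Qed.

(** With the other modes frozen, [term k] is the integrand of [quadratic_ibp]; its coefficients
    [q k] and [p k] omit mode [k] and are therefore measurable for [others]. *)
Let Rintegral_term k : \int[P]_w term k w = 0.
Proof.
pose h (u : (measurableTypeR R * others xi k.+1)%type) : R :=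
  u.1 * ((r k * u.1 + q k u.2) * phi (c * (r k * u.1 ^+ 2 + 2 * q k u.2 * u.1 + p k u.2 - m))) -
  (r k * phi (c * (r k * u.1 ^+ 2 + 2 * q k u.2 * u.1 + p k u.2 - m)) +
   2 * c * (r k * u.1 + q k u.2) ^+ 2 * dphi (c * (r k * u.1 ^+ 2 + 2 * q k u.2 * u.1 + p k u.2 - m))).
have termE w : term k w = h (xi k.+1 w, w).
  by rewrite /term /h /= /H (qgrad_off B _ k) (qform_off B _ k).
have m1 : measurable_fun setT (fun u : (measurableTypeR R * others xi k.+1)%type => u.1 : R).
  exact: measurable_fst.
have m2 : measurable_fun setT (fun u : (measurableTypeR R * others xi k.+1)%type => q k u.2).
  exact: (measurableT_comp (@mq k) (@measurable_snd _ _ (measurableTypeR R) (others xi k.+1))).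
have m3 : measurable_fun setT (fun u : (measurableTypeR R * others xi k.+1)%type => p k u.2).
  exact: (measurableT_comp (@mp k) (@measurable_snd _ _ (measurableTypeR R) (others xi k.+1))).
have mL : measurable_fun setT (fun u : (measurableTypeR R * others xi k.+1)%type => r k * u.1 + q k u.2).
  by apply: measurable_funD => //; apply: measurable_funM.
have mHu : measurable_fun setT (fun u : (measurableTypeR R * others xi k.+1)%type =>
    c * (r k * u.1 ^+ 2 + 2 * q k u.2 * u.1 + p k u.2 - m)).
  apply: measurable_funM => //; apply: measurable_funB => //; apply: measurable_funD => //.
  apply: measurable_funD; first by apply: measurable_funM => //; exact: measurable_funX.
  by apply: measurable_funM => //; exact: measurable_funM.
have mf (f : R -> R) : continuous f -> measurable_fun setT (fun u : (measurableTypeR R * others xi k.+1)%type =>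
    f (c * (r k * u.1 ^+ 2 + 2 * q k u.2 * u.1 + p k u.2 - m))).
  by move=> cf; apply: measurableT_comp mHu; exact: continuous_measurable_fun.
have mh : measurable_fun setT h.
  apply: measurable_funB.
    by apply: measurable_funM => //; apply: measurable_funM => //; exact: mf.
  apply: measurable_funD; apply: measurable_funM => //; try exact: mf.
  by apply: measurable_funM => //; exact: measurable_funX.
under eq_Rintegral do rewrite termE.
apply: (Rintegral_indep_eq0 hxi) => //.
- by apply: eq_integrable (integrable_term k) => // w _ /=; rewrite termE.
- by move=> w; exact: (@quadratic_ibp R phi dphi C dphiP cdphi phiC dphiC (r k) (q k w) (p k w) c m).
- by move=> w; exact: (@quadratic_ibp_integrable R phi dphi C dphiP cdphi phiC dphiC (r k) (q k w) (p k w) c m).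
Qed.

(** Sum of the coordinate identities: Euler's identity collapses the first terms to [qform B], and
    the [r k] add up to [qtrace B]. *)
Lemma gaussian_quadratic_identity :
  \int[P]_w (qform B (modes w) * phi (H w) - (qtrace B * phi (H w) +
    2 * c * (\sum_k qgrad B (modes w) k ^+ 2) * dphi (H w))) = 0.
Proof.
transitivity (\int[P]_w (\sum_k term k w)); last first.
  rewrite Rintegral_sum; last exact: integrable_term.
  by apply: big1 => k _; exact: Rintegral_term.
apply: eq_Rintegral => w _.
rewrite /term big_split/= sumrN big_split/= -!mulr_suml -mulr_sumr -qform_euler mulr_suml.
by congr (_ - _); apply: eq_bigr => k _; rewrite mulrA.
Qed.

End identity.

(** The identity for constant [phi], where the derivative term drops out. *)
Lemma Rintegral_qform B : \int[P]_w qform B (modes w) = qtrace B.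
Proof.
have := @gaussian_quadratic_identity (fun=> 1) (fun=> 0) 1 ltac:(by move=> x; exact: is_derive_cst)
  ltac:(by move=> x; exact: cvg_cst) ltac:(by move=> x; rewrite normr1) ltac:(by move=> x; rewrite normr0) B 0 0.
under eq_Rintegral do rewrite !mulr1 mulr0 addr0.
rewrite RintegralB//; [|exact: integrable_qform|exact: finite_measure_integrable_cst].
by rewrite Rintegral_cst_probability => /eqP; rewrite subr_eq0 => /eqP.
Qed.

End gaussian_quadratic_form.

(** * Gram matrices and trace inequalities *)

Section algebra.
Context (R : realType) (M n : nat).
Implicit Types (B : 'I_M -> 'I_n -> R) (x : 'I_n -> R).

Definition gram B (k l : 'I_n) : R := \sum_j B j k * B j l.

(** Makes the squared half gradient a quadratic form too, so that [Rintegral_qform] computes its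
    mean. *)
Lemma qgrad_gram B x : \sum_k qgrad B x k ^+ 2 = qform (gram B) x.
Proof.
apply: eq_bigr => k _; congr (_ ^+ 2); rewrite /qgrad /gram.
under eq_bigr do rewrite mulr_sumr.
rewrite exchange_big; apply: eq_bigr => l _; rewrite mulr_suml.
by apply: eq_bigr => j _; rewrite mulrA.
Qed.

(** This is [tr ((B^T B)^2) = tr ((B B^T)^2)]. It passes to the [M] by [M] matrix, the one that is
    close to the identity. *)
Lemma sum_gram_sqr B : \sum_k \sum_l (\sum_j B j k * B j l) ^+ 2 =
  \sum_i \sum_j (\sum_k B i k * B j k) ^+ 2.
Proof.
under eq_bigr do under eq_bigr do rewrite expr2 big_distrlr/= pair_big/=.
under [RHS]eq_bigr do under eq_bigr do rewrite expr2 big_distrlr/= pair_big/=.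
rewrite [LHS]pair_big [RHS]pair_big exchange_big; apply: eq_bigr => -[i j] _ /=.
by apply: eq_bigr => -[k l] _ /=; ring.
Qed.

Lemma qtraceE B : qtrace B = \sum_j \sum_k B j k ^+ 2.
Proof. by rewrite /qtrace exchange_big. Qed.

(* With [G = B B^T] this reads [tr (G^2) >= 2 tr G - M], i.e. [tr ((1 - G)^2) >= 0]. *)
Lemma qtrace_gram_ge B : 2 * qtrace B - M%:R <= qtrace (gram B).
Proof.
rewrite /(qtrace (gram B)) /gram exchange_big sum_gram_sqr.
have -> : 2 * qtrace B - M%:R = \sum_(j < M) (2 * (\sum_k B j k ^+ 2) - 1).
  by rewrite big_split/= -mulr_sumr qtraceE sumrN sumr_const card_ord.
(* Row by row: the diagonal entry satisfies [u^2 >= 2 u - 1], and the off-diagonal squares are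
   dropped. *)
apply: ler_sum => i _; rewrite (bigD1 i)//=.
have -> : \sum_k B i k * B i k = \sum_k B i k ^+ 2 by apply: eq_bigr => k _; rewrite expr2.
set u := \sum_k B i k ^+ 2.
have h1 : 0 <= (u - 1) ^+ 2 by exact: sqr_ge0.
have h2 : 0 <= \sum_(j < M | j != i) (\sum_k B i k * B j k) ^+ 2.
  by apply: sumr_ge0 => j _; exact: sqr_ge0.
by nra.
Qed.

End algebra.

(** * A bounded substitute for the cube *)

Section truncated_cube.
Context (R : realType) (e : R) (e0 : 0 < e) (e1 : e <= 1).

(** Bounded with bounded derivative, hence admissible in the Stein identity, while
    [x * tcube x = x^4 / (1 + e x^4)] tends to [x^4] as [e] tends to 0. *)
Definition tcube (x : R) := x ^+ 3 * (1 + e * x ^+ 4)^-1.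
Definition dtcube (x : R) := (3 * x ^+ 2 - e * x ^+ 6) / (1 + e * x ^+ 4) ^+ 2.

Let ex4 (x : R) : 0 <= e * x ^+ 4.
Proof. by apply: mulr_ge0; [exact: ltW|exact: exprn_even_ge0]. Qed.

Lemma tcube_den (x : R) : 1 <= 1 + e * x ^+ 4.
Proof. by rewrite lerDl. Qed.

Lemma tcube_den_gt0 (x : R) : 0 < 1 + e * x ^+ 4.
Proof. exact: lt_le_trans ltr01 (tcube_den x). Qed.

Lemma is_derive_tcube (x : R) : is_derive x 1 tcube (dtcube x).
Proof.
have q0 : 1 + e * x ^+ 4 != 0 by rewrite gt_eqF// tcube_den_gt0.
have dq : is_derive x 1 (fun y => 1 + e * y ^+ 4) (4 * e * x ^+ 3).
  by apply: is_derive_eq; rewrite /GRing.scale/=; ring.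
have dqV := @is_deriveV R (fun y => 1 + e * y ^+ 4) x _ 1 q0 dq.
rewrite /tcube; apply: is_derive_eq; rewrite /dtcube /GRing.scale/=; field.
by rewrite gt_eqF// tcube_den_gt0.
Qed.

Lemma continuous_dtcube : continuous dtcube.
Proof.
have cX (n : nat) : continuous (fun x : R => x ^+ n) by move=> x; exact: exprn_continuous.
have cD : continuous (fun x : R => (1 + e * x ^+ 4) ^+ 2).
  move=> x; apply: (@continuous_comp _ _ _ (fun y : R => 1 + e * y ^+ 4) (fun y : R => y ^+ 2)); last exact: cX.
  by apply: cvgD; [exact: cvg_cst|apply: cvgM; [exact: cvg_cst|exact: cX]].
move=> x; apply: cvgM.
  by apply: cvgB; apply: cvgM; [exact: cvg_cst|exact: cX|exact: cvg_cst|exact: cX].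
by apply: cvgV; [rewrite gt_eqF// exprn_gt0// tcube_den_gt0|exact: cD].
Qed.

Lemma tcube_norm (x : R) : `|tcube x| = `|x| ^+ 3 / (1 + e * x ^+ 4).
Proof.
by rewrite /tcube normrM normfV (gtr0_norm (tcube_den_gt0 x)) normrX.
Qed.

Let pow4_bound (x : R) : 1 + x ^+ 4 <= 2 / e * (1 + e * x ^+ 4).
Proof.
have y0 : 0 <= x ^+ 4 by rewrite exprn_even_ge0.
rewrite -subr_ge0 (_ : _ - _ = 2 / e - 1 + x ^+ 4); last by field; rewrite gt_eqF.
by rewrite addr_ge0// subr_ge0 ler_pdivlMr// mul1r (le_trans e1)// ler1n.
Qed.

(** From [|x|^3 <= 1 + x^4]. The constant is the one of [dtcube_norm_le], since the Stein identity
    takes a common bound for a function and its derivative. *)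
Lemma tcube_le (x : R) : `|tcube x| <= 8 / e.
Proof.
have d0 := tcube_den_gt0 x.
rewrite /tcube normrM normfV (gtr0_norm d0) ler_pdivrMr//.
apply: (@le_trans _ _ (1 + x ^+ 4)).
  rewrite normrX (_ : x ^+ 4 = `|x| ^+ 4); last by rewrite -normrX ger0_norm// exprn_even_ge0.
  have := normr_ge0 x; move: `|x| => y y0.
  have [y1|y1] := lerP y 1.
    by rewrite (@le_trans _ _ 1)// ?exprn_ile1// lerDl exprn_ge0.
  by rewrite (@le_trans _ _ (y ^+ 4))// ?lerDr// ler_weXn2l// ltW.
rewrite (le_trans (pow4_bound x))// ler_wpM2r ?ltW//.
by rewrite ltr_pM2r ?invr_gt0// ltr_nat.
Qed.

(** Only an upper bound is wanted, and with the denominator of [tcube]: the moment estimate then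
    reduces to comparing polynomials. *)
Lemma dtcube_le (x : R) : dtcube x <= 3 * x ^+ 2 / (1 + e * x ^+ 4).
Proof.
have d0 := tcube_den_gt0 x; have d1 := tcube_den x.
rewrite /dtcube ler_pdivrMr ?exprn_gt0//.
have -> : 3 * x ^+ 2 / (1 + e * x ^+ 4) * (1 + e * x ^+ 4) ^+ 2 =
  3 * x ^+ 2 + 3 * (e * x ^+ 6) by field; rewrite gt_eqF.
have x6 : 0 <= e * x ^+ 6 by apply: mulr_ge0; [exact: ltW|exact: exprn_even_ge0].
by lra.
Qed.

Lemma dtcube_norm_le (x : R) : `|dtcube x| <= 8 / e.
Proof.
have d0 := tcube_den_gt0 x; have d1 := tcube_den x.
have x2 : 0 <= x ^+ 2 by exact: sqr_ge0.
have x4 : 0 <= x ^+ 4 by rewrite exprn_even_ge0.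
have x24 : x ^+ 2 <= 1 + x ^+ 4.
  have : 0 <= (x ^+ 2 - 1) ^+ 2 by exact: sqr_ge0.
  by rewrite (_ : (x ^+ 2 - 1) ^+ 2 = x ^+ 4 - 2 * x ^+ 2 + 1); [lra|ring].
rewrite /dtcube normrM normfV (gtr0_norm (exprn_gt0 _ d0)) ler_pdivrMr ?exprn_gt0//.
apply: (@le_trans _ _ (4 * (1 + x ^+ 4) * (1 + e * x ^+ 4))).
  apply: (@le_trans _ _ (4 * x ^+ 2 * (1 + e * x ^+ 4))).
    rewrite (_ : 3 * x ^+ 2 - e * x ^+ 6 = x ^+ 2 * (3 - e * x ^+ 4)); last by ring.
    rewrite normrM (ger0_norm x2) (_ : 4 * x ^+ 2 * _ = x ^+ 2 * (4 * (1 + e * x ^+ 4))); last by ring.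
    apply: ler_wpM2l => //; have := ex4 x.
    by rewrite ler_norml => ?; apply/andP; split; lra.
  by apply: ler_wpM2r; [exact: ltW|rewrite ler_pM2l].
rewrite (_ : 8 / e * (1 + e * x ^+ 4) ^+ 2 = 4 * (2 / e * (1 + e * x ^+ 4)) * (1 + e * x ^+ 4)); last by field; rewrite gt_eqF.
by apply: ler_wpM2r; [exact: ltW|rewrite ler_pM2l].
Qed.

End truncated_cube.

(** * Fourth moment and Stein bound with finitely many modes *)

Section finite_clt.
Context (R : realType) (d : measure_display) (T : measurableType d)
  (P : probability T R) (xi : nat -> {RV P >-> R}).
Hypothesis hxi : iid_standard_normal [set k | (0 < k)%N] xi.
Variables (M n : nat) (B : 'I_M -> 'I_n -> R) (tau : R).
Hypotheses (M0 : (0 < M)%N)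
  (Bcontr : forall x, \sum_k qgrad B x k ^+ 2 <= qform B x)
  (Btrace : `|M%:R - qtrace B| <= tau).

Let c : R := (Num.sqrt (2 * M%:R))^-1.
Let Q w := qform B (modes xi w : 'I_n -> R).
Let L2 w := \sum_k qgrad B (modes xi w) k ^+ 2.

Definition qnorm w : R := c * (Q w - M%:R).

Let MR : 1 <= M%:R :> R. Proof. by rewrite ler1n. Qed.
Let MRn0 : M%:R != 0 :> R. Proof. by rewrite pnatr_eq0 -lt0n. Qed.
Let sq_gt0 : 0 < Num.sqrt (2 * M%:R) :> R.
Proof. by rewrite sqrtr_gt0 mulr_gt0// ltr0n. Qed.
Let c_gt0 : 0 < c. Proof. by rewrite invr_gt0. Qed.
Let c2M : 2 * c ^+ 2 * M%:R = 1.
Proof.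
rewrite /c exprVn sqr_sqrtr ?mulr_ge0//.
by field; rewrite gt_eqF// ltr0n.
Qed.
Let c_le1 : c <= 1.
Proof.
have h : 0 <= c ^+ 2 * (M%:R - 1) by rewrite mulr_ge0 ?sqr_ge0 ?subr_ge0.
rewrite leNgt; apply/negP => c1.
have : 1 < c ^+ 2 by rewrite exprn_egt1.
by have := c2M; lra.
Qed.
Let tau_ge0 : 0 <= tau. Proof. exact: le_trans (normr_ge0 _) Btrace. Qed.

Let Q_ge0 w : 0 <= Q w. Proof. exact: qform_ge0. Qed.
Let L2_ge0 w : 0 <= L2 w. Proof. by apply: sumr_ge0 => k _; exact: sqr_ge0. Qed.

Lemma measurable_qnorm : measurable_fun setT qnorm.
Proof.
by apply: measurable_funM => //; apply: measurable_funB => //; exact: measurable_qform.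
Qed.

Let iQ : P.-integrable setT (EFin \o Q). Proof. exact: integrable_qform. Qed.
Let iL2 : P.-integrable setT (EFin \o L2). Proof. exact: integrable_qgrad2. Qed.

Let iH : P.-integrable setT (EFin \o qnorm).
Proof.
have := integrableZl measurableT c (integrableB measurableT iQ (finite_measure_integrable_cst P M%:R measurableT)).
by apply: eq_integrable.
Qed.

Let mcomp (f : R -> R) : continuous f -> measurable_fun setT (fun w => f (qnorm w)).
Proof.
by move=> cf; apply: measurableT_comp measurable_qnorm; exact: continuous_measurable_fun.
Qed.

Section stein.
Variables (phi dphi : R -> R) (C : R).
Hypotheses (dphiP : forall x : R, is_derive x 1 phi (dphi x))
  (cdphi : continuous dphi)
  (phiC : forall x, `|phi x| <= C) (dphiC : forall x, `|dphi x| <= C).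

Let cphi : continuous phi. Proof. by move=> z; exact: (is_derive_continuous (dphiP z)). Qed.

(** [c] times the integrand of [gaussian_quadratic_identity], rewritten with [2 c^2 = 1 / M]. It
    differs from [H phi(H) - phi'(H)] by the trace defect and by the deviation of [L2 / M] from
    1. *)
Definition stein_op w := qnorm w * phi (qnorm w) + c * (M%:R - qtrace B) * phi (qnorm w) -
  L2 w / M%:R * dphi (qnorm w).

Lemma integrable_stein_op : P.-integrable setT (EFin \o stein_op).
Proof.
have i1 := integrable_mul_bounded iH (mcomp cphi) (fun w => phiC (qnorm w)).
have i2 := integrableZl measurableT (c * (M%:R - qtrace B)) (bounded_integrable P (mcomp cphi) (fun w => phiC (qnorm w))).
have i3 := integrableZl measurableT (M%:R^-1) (integrable_mul_bounded iL2 (mcomp cdphi) (fun w => dphiC (qnorm w))).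
have := integrableB measurableT (integrableD measurableT i1 i2) i3.
by apply: eq_integrable => // w _ /=; rewrite /stein_op; congr EFin; ring.
Qed.

Lemma Rintegral_stein_op : \int[P]_w stein_op w = 0.
Proof.
have h := gaussian_quadratic_identity hxi dphiP cdphi phiC dphiC B c M%:R.
have i1 := integrable_mul_bounded iQ (mcomp cphi) (fun w => phiC (qnorm w)).
have i2 := integrableZl measurableT (qtrace B) (bounded_integrable P (mcomp cphi) (fun w => phiC (qnorm w))).
have i3 := integrableZl measurableT (2 * c) (integrable_mul_bounded iL2 (mcomp cdphi) (fun w => dphiC (qnorm w))).
have i4 := integrableB measurableT i1 (integrableD measurableT i2 i3).
transitivity (\int[P]_w (c * (Q w * phi (qnorm w) - (qtrace B * phi (qnorm w) +
    2 * c * L2 w * dphi (qnorm w))))).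
  apply: eq_Rintegral => w _; rewrite /stein_op.
  have -> : M%:R^-1 = 2 * c ^+ 2 by rewrite -[RHS](mulfK MRn0) c2M mul1r.
  by rewrite /qnorm; ring.
rewrite RintegralZl//; last first.
  by apply: eq_integrable i4 => // w _ /=; congr EFin; ring.
by rewrite [X in c * X]h mulr0.
Qed.

End stein.



Let Qabs w : Q w / M%:R = 1 + 2 * c * qnorm w.
Proof.
rewrite /qnorm; have -> : M%:R^-1 = 2 * c ^+ 2 by rewrite -[RHS](mulfK MRn0) c2M mul1r.
rewrite (_ : 1 + _ = 1 - 2 * c ^+ 2 * M%:R + 2 * c ^+ 2 * Q w); last by ring.
by rewrite c2M; ring.
Qed.

Let L2_le w : L2 w / M%:R <= 1 + 2 * c * qnorm w.
Proof. by rewrite -Qabs ler_wpM2r ?invr_ge0//; exact: Bcontr. Qed.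

(** Chosen for [quartic_dominates]: with [a = tau + 6], [a h^3 <= h^4 / 4 + 64 a^4] and
    [3 h^2 <= h^4 / 4 + 9]. In [a], [tau] is the trace defect and 6 comes from the product of [2 h]
    and [3 h^2]. *)
Let K0 : R := 64 * (tau + 6) ^+ 4 + 9.

Let quartic_dominates (h : R) : 0 <= h ->
  (tau + 6) * h ^+ 3 + 3 * h ^+ 2 <= 2^-1 * h ^+ 4 + K0.
Proof.
move=> h0; set a := tau + 6; have a0 : 0 <= a by rewrite addr_ge0.
have h1 : a * h ^+ 3 <= 4^-1 * h ^+ 4 + 64 * a ^+ 4.
  have [ha|/ltW ha] := lerP (4 * a) h.
    have : 0 <= (h - 4 * a) * h ^+ 3 by rewrite mulr_ge0 ?subr_ge0 ?exprn_ge0.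
    have : 0 <= 64 * a ^+ 4 by rewrite mulr_ge0 ?exprn_ge0.
    by rewrite (_ : (h - 4 * a) * h ^+ 3 = h ^+ 4 - 4 * (a * h ^+ 3)); [lra|ring].
  have h3 : h ^+ 3 <= (4 * a) ^+ 3 by rewrite lerXn2r ?nnegrE// mulr_ge0.
  have := ler_wpM2l a0 h3; rewrite (_ : a * (4 * a) ^+ 3 = 64 * a ^+ 4); last by ring.
  by have : 0 <= h ^+ 4 by [rewrite exprn_ge0]; lra.
have h2 : 3 * h ^+ 2 <= 4^-1 * h ^+ 4 + 9.
  have : 0 <= (2^-1 * h ^+ 2 - 3) ^+ 2 by exact: sqr_ge0.
  by rewrite (_ : (2^-1 * h ^+ 2 - 3) ^+ 2 = 4^-1 * h ^+ 4 - 3 * h ^+ 2 + 9); [lra|field].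
by rewrite /K0 -/a; lra.
Qed.

(** The identity for [tcube e] bounds the truncated fourth moment by half of itself plus [K0]. The
    half is absorbed on the left, which is legitimate because the truncated moment is finite. *)
Let fourth_moment_truncated (e : R) : 0 < e -> e <= 1 ->
  \int[P]_w (qnorm w ^+ 4 / (1 + e * qnorm w ^+ 4)) <= 2 * K0.
Proof.
move=> e0 e1.
have dP := is_derive_tcube e0; have cd := continuous_dtcube e0.
have b1 := tcube_le e0 e1; have b2 := dtcube_norm_le e0 e1.
have i0 := integrable_stein_op dP cd b1 b2.
have I0 := Rintegral_stein_op dP cd b1 b2.
have cF : continuous (fun x : R => x ^+ 4 / (1 + e * x ^+ 4)).
  move=> x; have ct : {for x, continuous (tcube e)} by exact: (is_derive_continuous (dP x)).
  have -> : (fun x : R => x ^+ 4 / (1 + e * x ^+ 4)) = (fun x => x * tcube e x).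
    by apply/funext => y; rewrite /tcube; ring.
  by apply: cvgM; [exact: cvg_id|exact: ct].
have bF x : `|x ^+ 4 / (1 + e * x ^+ 4)| <= e^-1.
  have d0 := tcube_den_gt0 e0 x; have x4 : 0 <= x ^+ 4 by exact: exprn_even_ge0.
  rewrite normrM normfV (gtr0_norm d0) (ger0_norm x4) ler_pdivrMr//.
  by rewrite mulrDr mulr1 mulKf ?gt_eqF// lerDr invr_ge0 ltW.
have iF := bounded_integrable P (mcomp cF) (fun w => bF (qnorm w)).
have iF2 := integrableZl measurableT (2^-1) iF.
have iK := finite_measure_integrable_cst P K0 measurableT.
(* A pointwise lower bound for [stein_op], whose integral is 0. *)
have : \int[P]_w (2^-1 * (qnorm w ^+ 4 / (1 + e * qnorm w ^+ 4)) - K0) <= \int[P]_w stein_op (tcube e) (dtcube e) w.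
  apply: le_Rintegral => //.
    by apply: eq_integrable (integrableB measurableT iF2 iK).
  move=> w _; rewrite /stein_op; set x := qnorm w.
  have d0 := tcube_den_gt0 e0 x; have d1 := tcube_den e0 x.
  have h1 : `|c * (M%:R - qtrace B) * tcube e x| <= tau * `|x| ^+ 3 / (1 + e * x ^+ 4).
    rewrite normrM (tcube_norm e0) (normrM c) (gtr0_norm c_gt0) mulrA.
    apply: ler_wpM2r; first by rewrite invr_ge0 ltW.
    apply: ler_wpM2r; first by rewrite exprn_ge0.
    by rewrite -[leRHS]mul1r; apply: ler_pM => //; exact: ltW.
  have h2 : L2 w / M%:R * dtcube e x <= (3 * x ^+ 2 + 6 * `|x| ^+ 3) / (1 + e * x ^+ 4).
    apply: (@le_trans _ _ (L2 w / M%:R * (3 * x ^+ 2 / (1 + e * x ^+ 4)))).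
      by apply: ler_wpM2l; [rewrite divr_ge0|exact: dtcube_le].
    rewrite mulrA; apply: ler_wpM2r; first by rewrite invr_ge0 ltW.
    apply: (@le_trans _ _ ((1 + 2 * `|x|) * (3 * x ^+ 2))).
      apply: ler_wpM2r; first by rewrite mulr_ge0 ?sqr_ge0.
      apply: (le_trans (L2_le w)); rewrite lerD2l -/x.
      have := ler_norm (c * x); rewrite normrM (gtr0_norm c_gt0).
      have : c * `|x| <= 1 * `|x| by apply: ler_wpM2r.
      lra.
    have x2 : `|x| ^+ 2 = x ^+ 2 by rewrite real_normK// num_real.
    by rewrite -x2 le_eqVlt; apply/orP; left; apply/eqP; ring.
  have := quartic_dominates (normr_ge0 x).
  have x2 : `|x| ^+ 2 = x ^+ 2 by rewrite real_normK// num_real.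
  have x4 : `|x| ^+ 4 = x ^+ 4 by rewrite -normrX ger0_norm// exprn_even_ge0.
  rewrite x2 x4 => h3.
  have Dinv : (1 + e * x ^+ 4)^-1 <= 1 by rewrite invf_le1.
  have Dinv0 : 0 < (1 + e * x ^+ 4)^-1 by rewrite invr_gt0.
  have xt : x * tcube e x = x ^+ 4 * (1 + e * x ^+ 4)^-1 by rewrite /tcube; ring.
  rewrite xt; move: h1; rewrite ler_norml => /andP[h1 _].
  have K00 : 0 <= K0 by rewrite /K0 addr_ge0// mulr_ge0// exprn_ge0// addr_ge0.
  have := ler_wpM2r (ltW Dinv0) h3.
  have : K0 * (1 + e * x ^+ 4)^-1 <= K0 by rewrite ler_piMr.
  move: h1 h2; move: (L2 w / M%:R * dtcube e x) (c * (M%:R - qtrace B) * tcube e x) => u v.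
  move: (1 + e * x ^+ 4)^-1 => D h1 h2 h4 h5; nra.
rewrite I0 RintegralB// RintegralZl// Rintegral_cst_probability; lra.
Qed.

(** The truncated bound is free of [e], so Fatou's lemma along [e = 1 / (m + 1)] removes the
    truncation. *)
Lemma fourth_moment_le : (\int[P]_w (qnorm w ^+ 4)%:E <= (2 * K0)%:E)%E.
Proof.
pose e (m : nat) : R := m.+1%:R^-1.
have e0 m : 0 < e m by rewrite invr_gt0.
have e1 m : e m <= 1 by rewrite invf_le1// ler1n.
have cX (n' : nat) : continuous (fun x : R => x ^+ n') by move=> x; exact: exprn_continuous.
have mden m : measurable_fun setT (fun w => 1 + e m * qnorm w ^+ 4).
  by apply: measurable_funD => //; apply: measurable_funM => //; exact: (mcomp (@cX 4)).
have mX m : measurable_fun setT (fun w => qnorm w ^+ 4 / (1 + e m * qnorm w ^+ 4)).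
  have -> : (fun w => qnorm w ^+ 4 / (1 + e m * qnorm w ^+ 4)) = (fun w => qnorm w * tcube (e m) (qnorm w)).
    by apply/funext => w; rewrite /tcube; ring.
  apply: measurable_funM; first exact: measurable_qnorm.
  by apply: mcomp => x; exact: (is_derive_continuous (is_derive_tcube (e0 m) x)).
apply: (@fatou_bound _ _ _ P (fun m w => qnorm w ^+ 4 / (1 + e m * qnorm w ^+ 4))) => //.
- exact: (mcomp (@cX 4)).
- move=> m w; rewrite divr_ge0 ?exprn_even_ge0//.
  by rewrite ltW// tcube_den_gt0.
- by move=> w; exact: exprn_even_ge0.
- apply: aeW => w; have : (fun m => qnorm w ^+ 4 / (1 + e m * qnorm w ^+ 4)) @ \oo -->
      qnorm w ^+ 4 / (1 + 0 * qnorm w ^+ 4).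
    apply: cvgM; first exact: cvg_cst.
    apply: cvgV; first by rewrite mul0r addr0 oner_eq0.
    apply: cvgD; first exact: cvg_cst.
    by apply: cvgM; [exact: cvg_harmonic|exact: cvg_cst].
  by rewrite mul0r addr0 divr1.
- apply: nearW => m.
  have bF x : `|x ^+ 4 / (1 + e m * x ^+ 4)| <= (e m)^-1.
    have d0 := tcube_den_gt0 (e0 m) x; have x4 : 0 <= x ^+ 4 by exact: exprn_even_ge0.
    rewrite normrM normfV (gtr0_norm d0) (ger0_norm x4) ler_pdivrMr//.
    by rewrite mulrDr mulr1 mulKf ?gt_eqF// lerDr invr_ge0 ltW.
  have iF := bounded_integrable P (mX m) (fun w => bF (qnorm w)).
  have := fourth_moment_truncated (e0 m) (e1 m); rewrite -lee_fin /Rintegral fineK//.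
  exact: (integrable_fin_num _ iF).
Qed.

Let iH4 : P.-integrable setT (EFin \o (fun w => qnorm w ^+ 4)).
Proof.
have m4 : measurable_fun setT (fun w => qnorm w ^+ 4).
  by apply: (mcomp (f := fun x => x ^+ 4)) => x; exact: exprn_continuous.
apply/integrableP; split; first exact/measurable_EFinP.
under eq_integral do rewrite /= ger0_norm ?exprn_even_ge0//.
exact: le_lt_trans fourth_moment_le (ltry _).
Qed.

Let inH : P.-integrable setT (EFin \o (fun w => `|qnorm w|)).
Proof. exact: (integrable_norm iH). Qed.

Let first_moment_le : \int[P]_w `|qnorm w| <= 1 + 2 * K0.
Proof.
have i1 := finite_measure_integrable_cst P (1 : R) measurableT.
have : \int[P]_w `|qnorm w| <= \int[P]_w (1 + qnorm w ^+ 4).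
  apply: le_Rintegral => //; first by apply: eq_integrable (integrableD measurableT i1 iH4).
  move=> w _; set x := qnorm w.
  have x4 : `|x| ^+ 4 = x ^+ 4 by rewrite -normrX ger0_norm// exprn_even_ge0.
  rewrite -x4; have := normr_ge0 x; move: `|x| => y y0.
  have h1 : 0 <= (y - 1) ^+ 2 by exact: sqr_ge0.
  have h2 : 0 <= (y ^+ 2 - 1) ^+ 2 by exact: sqr_ge0.
  have h3 : 0 <= y ^+ 4 by exact: exprn_ge0.
  move: h2; rewrite (_ : (y ^+ 2 - 1) ^+ 2 = y ^+ 4 - 2 * y ^+ 2 + 1); last by ring.
  by move: h1; rewrite (_ : (y - 1) ^+ 2 = y ^+ 2 - 2 * y + 1); [lra|ring].
rewrite RintegralD// Rintegral_cst_probability => /le_trans; apply; rewrite lerD2l.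
have := fourth_moment_le; rewrite -[X in (X <= _)%E]fineK ?lee_fin//.
exact: (integrable_fin_num _ iH4).
Qed.

(** The mean is [tr G - tr (G^2)] with [G = B B^T], at most [M - tr G] by [qtrace_gram_ge]. *)
Let integral_gap_le : \int[P]_w (Q w - L2 w) <= tau.
Proof.
rewrite RintegralB// Rintegral_qform//.
have -> : \int[P]_w L2 w = qtrace (gram B).
  by rewrite -(Rintegral_qform hxi); apply: eq_Rintegral => w _; rewrite /L2 qgrad_gram.
have := qtrace_gram_ge B; move: Btrace; rewrite ler_norml => /andP[_]; lra.
Qed.

(** Applying the identity to [x |-> phi (kappa x)] and subtracting it from Stein's equation leaves
    [kappa^2 (1 - L2 / M) dphi] and the trace defect term, both estimated in L1. *)
Lemma qnorm_stein_bound (kappa K D N : R) (g phi dphi : R -> R) :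
  (forall x : R, is_derive x 1 phi (dphi x)) -> continuous dphi ->
  (forall x, `|phi x| <= D) -> (forall x, `|dphi x| <= D) ->
  (forall x, kappa ^+ 2 * dphi x - x * phi x = g x - N) ->
  continuous g -> (forall x, `|g x| <= K) ->
  `|\int[P]_w g (kappa * qnorm w) - N| <=
  c * D * (kappa ^+ 2 * (2 * (1 + 2 * K0) + 2 * tau) + `|kappa| * tau).
Proof.
move=> dP cd b1 b2 gN cg gK.
have D0 : 0 <= D by exact: le_trans (normr_ge0 _) (b1 0).
have cphi : continuous phi by move=> x; exact: (is_derive_continuous (dP x)).
pose phi1 x := phi (kappa * x); pose dphi1 x := kappa * dphi (kappa * x).
have dlin (x : R) : is_derive x 1 (fun y => kappa * y) kappa.
  by apply: is_derive_eq; rewrite /GRing.scale/= mulr1.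
have clin : continuous (fun y => kappa * y) by move=> x; exact: (is_derive_continuous (dlin x)).
have dP1 (x : R) : is_derive x 1 phi1 (dphi1 x).
  rewrite /dphi1 mulrC; have := dP (kappa * x) => h.
  exact: (@is_derive1_comp _ phi (fun y => kappa * y) x _ _ h (dlin x)).
have cd1 : continuous dphi1.
  move=> x; apply: cvgM; first exact: cvg_cst.
  by apply: (@continuous_comp _ _ _ (fun y => kappa * y) dphi); [exact: clin|exact: cd].
have b11 x : `|phi1 x| <= (1 + `|kappa|) * D.
  by rewrite (le_trans (b1 _))// ler_peMl// lerDl.
have b21 x : `|dphi1 x| <= (1 + `|kappa|) * D.
  by rewrite /dphi1 normrM; apply: ler_pM => //; rewrite lerDr.
have i0 := integrable_stein_op dP1 cd1 b11 b21.
have I0 := Rintegral_stein_op dP1 cd1 b11 b21.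
have cgk : continuous (fun x => g (kappa * x)).
  by move=> x; apply: (@continuous_comp _ _ _ (fun y => kappa * y) g); [exact: clin|exact: cg].
have ig := bounded_integrable P (mcomp cgk) (fun w => gK (kappa * qnorm w)).
have iN := finite_measure_integrable_cst P N measurableT.
have igN := integrableB measurableT ig iN.
have iks := integrableZl measurableT kappa i0.
pose F w := g (kappa * qnorm w) - N + kappa * stein_op phi1 dphi1 w.
have iF : P.-integrable setT (EFin \o F) by apply: eq_integrable (integrableD measurableT igN iks).
have -> : \int[P]_w g (kappa * qnorm w) - N = \int[P]_w F w.
  rewrite /F RintegralD// RintegralB// RintegralZl// I0 Rintegral_cst_probability; ring.
pose Bd w := kappa ^+ 2 * D * (2 * c * `|qnorm w| + 2 * c * (Q w - L2 w)) + `|kappa| * c * tau * D.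
have iQL := integrableB measurableT iQ iL2.
have i1 := integrableZl measurableT (2 * c) inH.
have i2 := integrableZl measurableT (2 * c) iQL.
have iD := integrableD measurableT i1 i2.
have i12 := integrableZl measurableT (kappa ^+ 2 * D) iD.
have i3 := finite_measure_integrable_cst P (`|kappa| * c * tau * D) measurableT.
have iB : P.-integrable setT (EFin \o Bd) by apply: eq_integrable (integrableD measurableT i12 i3).
have FB w : `|F w| <= Bd w.
  have -> : F w = kappa ^+ 2 * dphi (kappa * qnorm w) * (1 - L2 w / M%:R) +
      kappa * c * (M%:R - qtrace B) * phi (kappa * qnorm w).
    by rewrite /F -gN /stein_op /phi1 /dphi1; ring.
  rewrite (le_trans (ler_normD _ _))// /Bd; apply: lerD.
    rewrite normrM (normrM (kappa ^+ 2)) (ger0_norm (sqr_ge0 _)).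
    apply: ler_pM => //; first by rewrite mulr_ge0 ?sqr_ge0.
      by apply: ler_wpM2l => //; exact: sqr_ge0.
    (* The fluctuation of [Q / M] is [H] itself on the scale [2 c]; the rest is the nonnegative
       gap. *)
    have -> : 1 - L2 w / M%:R = - (2 * c * qnorm w) + (Q w - L2 w) / M%:R.
      by rewrite mulrBl Qabs; ring.
    rewrite (le_trans (ler_normD _ _))// normrN; apply: lerD.
      by rewrite normrM ger0_norm// mulr_ge0// ltW.
    have gap : 0 <= Q w - L2 w by rewrite subr_ge0; exact: Bcontr.
    rewrite ger0_norm; last by rewrite divr_ge0.
    rewrite mulrC; apply: ler_wpM2r => //.
    (* [1 / M = 2 c^2] is weakened to [2 c], using [c <= 1], so that all terms share the rate
       [c]. *)
    have -> : M%:R^-1 = 2 * c ^+ 2 by rewrite -[RHS](mulfK MRn0) c2M mul1r.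
    by rewrite ler_pM2l// expr2 ler_piMr// ltW.
  rewrite normrM (normrM (kappa * c)) (normrM kappa) (gtr0_norm c_gt0).
  have kc0 : 0 <= `|kappa| * c by rewrite mulr_ge0// ltW.
  by apply: ler_pM => //; [rewrite mulr_ge0|apply: ler_wpM2l].
apply: (le_trans (le_normr_Rintegral measurableT iF)).
apply: (@le_trans _ _ (\int[P]_w Bd w)).
  by apply: le_Rintegral => //; exact: (integrable_norm iF).
rewrite /Bd RintegralD// Rintegral_cst_probability RintegralZl// RintegralD// !RintegralZl//.
have h1 := first_moment_le; have h2 := integral_gap_le.
have a0 : 0 <= kappa ^+ 2 * D * (2 * c).
  by apply: mulr_ge0; [apply: mulr_ge0 => //; exact: sqr_ge0|apply: mulr_ge0 => //; exact: ltW].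
have := ler_wpM2l a0 h1; have := ler_wpM2l a0 h2.
move: (\int[P]_w `|qnorm w|) (\int[P]_w (Q w - L2 w)) => u v g1 g2.
rewrite -subr_ge0.
rewrite (_ : _ - _ = (kappa ^+ 2 * D * (2 * c) * (1 + 2 * K0) - kappa ^+ 2 * D * (2 * c) * u) +
  (kappa ^+ 2 * D * (2 * c) * tau - kappa ^+ 2 * D * (2 * c) * v)); last by ring.
by rewrite addr_ge0// subr_ge0.
Qed.

End finite_clt.

(** * The cosine series and the increment matrix *)

Section mean_value.
Context (R : realType).

Lemma lipschitz_of_derive (f df : R -> R) (a b A : R) : a <= b ->
  (forall x : R, x \in `[a, b] -> is_derive x 1 f (df x)) ->
  (forall x, x \in `[a, b] -> `|df x| <= A) -> `|f b - f a| <= A * (b - a).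
Proof.
move=> ab fd dfA.
have fd' x : x \in `]a, b[ -> is_derive x 1 f (df x).
  by move=> xab; apply: fd; exact: subset_itv_oo_cc.
have cf : {within `[a, b], continuous f}.
  by apply: derivable_within_continuous => x xab; have [] := fd x xab.
have [c cab ->] := MVT_segment ab fd' cf.
by rewrite normrM (ger0_norm (x := b - a)) ?subr_ge0// ler_wpM2r ?subr_ge0// dfA.
Qed.

Lemma norm_sin_le (x : R) : `|sin x| <= `|x|.
Proof.
wlog x0 : x / 0 <= x.
  move=> h; have [/h//|/ltW x0] := leP 0 x.
  by rewrite -normrN -sinN -(normrN x) h// oppr_ge0.
have := @lipschitz_of_derive sin cos 0 x 1 x0 (fun y _ => is_derive_sin y) (fun y _ => cos_max y).
by rewrite sin0 !subr0 mul1r => h; rewrite (ger0_norm (x := x)).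
Qed.

Lemma norm_cosB_le (x y : R) : `|cos x - cos y| <= `|x - y|.
Proof.
wlog xy : x y / y <= x.
  move=> h; have [/h//|/ltW xy] := leP y x.
  by rewrite distrC (distrC x) h.
rewrite (ger0_norm (x := x - y)) ?subr_ge0// -[leRHS]mul1r.
apply: (@lipschitz_of_derive cos (fun z => - sin z) y x 1 xy (fun z _ => is_derive_cos z)).
by move=> z _; rewrite normrN; exact: sin_max.
Qed.

Lemma cos_ge (x : R) : 1 - cos x <= x ^+ 2 / 2.
Proof.
have -> : 1 - cos x = 2 * sin (x / 2) ^+ 2.
  have {1}-> : x = (x / 2) *+ 2 by rewrite -mulr_natr; field.
  by rewrite cos_mulr2n sin2cos2 -mulr_natr; ring.
have := norm_sin_le (x / 2); rewrite -ler_sqr ?nnegrE//.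
by rewrite !real_normK ?num_real// exprMn => h; lra.
Qed.

End mean_value.

(** * Closed form of the cosine series *)

Section fourier_series.
Context (R : realType).
Implicit Types z : R.

Definition cos_series (n : nat) z : R := \sum_(k < n) (1 - cos (k.+1%:R * z)) / k.+1%:R ^+ 2.

(** Successive derivatives of [cos_series]: [saw] is a partial sum of the sawtooth [(pi - z) / 2],
    [dir] the Dirichlet kernel without its constant term [1 / 2]. *)
Let saw (n : nat) z : R := \sum_(k < n) sin (k.+1%:R * z) / k.+1%:R.
Let dir (n : nat) z : R := \sum_(k < n) cos (k.+1%:R * z).

Let is_derive_scale (a z : R) : is_derive z 1 (fun y => a * y) a.
Proof. by apply: is_derive_eq; rewrite /GRing.scale/= mulr1. Qed.

Let is_derive_sum_fun (n : nat) (h dh : 'I_n -> R -> R) (z : R) :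
  (forall k, is_derive z 1 (h k) (dh k z)) ->
  is_derive z 1 (fun y => \sum_k h k y) (\sum_k dh k z).
Proof.
move=> hd; have -> : (fun y => \sum_k h k y) = \sum_k h k by apply/funext => y; rewrite fct_sumE.
exact: is_derive_sum.
Qed.

Let d_cos_series (n : nat) (z : R) : is_derive z 1 (cos_series n) (saw n z).
Proof.
apply: (@is_derive_sum_fun n _ (fun k z => sin (k.+1%:R * z) / k.+1%:R)) => k.
have k0 : k.+1%:R != 0 :> R by rewrite pnatr_eq0.
have ds := is_derive_scale k.+1%:R z.
have dc : is_derive z 1 (fun y => cos (k.+1%:R * y)) (- sin (k.+1%:R * z) * k.+1%:R).
  exact: (@is_derive1_comp _ cos (fun y => k.+1%:R * y)).
by apply: is_derive_eq; rewrite /GRing.scale/=; field.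
Qed.

Let d_saw (n : nat) (z : R) : is_derive z 1 (saw n) (dir n z).
Proof.
apply: (@is_derive_sum_fun n _ (fun k z => cos (k.+1%:R * z))) => k.
have k0 : k.+1%:R != 0 :> R by rewrite pnatr_eq0.
have ds := is_derive_scale k.+1%:R z.
have dc : is_derive z 1 (fun y => sin (k.+1%:R * y)) (cos (k.+1%:R * z) * k.+1%:R).
  exact: (@is_derive1_comp _ sin (fun y => k.+1%:R * y)).
by apply: is_derive_eq; rewrite /GRing.scale/=; field.
Qed.

Let dirichlet (n : nat) z : 2 * sin (z / 2) * dir n z = sin ((n%:R + 2^-1) * z) - sin (z / 2).
Proof.
elim: n => [|n ih].
  by rewrite /dir big_ord0 mulr0 add0r (mulrC _ z) subrr.
rewrite /dir big_ord_recr/= mulrDr -/(dir n z) ih.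
have -> : sin ((n.+1%:R + 2^-1) * z) = sin (n.+1%:R * z) * cos (z / 2) + cos (n.+1%:R * z) * sin (z / 2).
  by rewrite -sinD; congr sin; field.
have -> : sin ((n%:R + 2^-1) * z) = sin (n.+1%:R * z) * cos (z / 2) - cos (n.+1%:R * z) * sin (z / 2).
  by rewrite -sinB; congr sin; rewrite -(natr1 n); field.
by ring.
Qed.

Let sin_half_ge (e z : R) : 0 < e -> e <= z -> z <= 2 * pi - e -> sin (e / 2) <= sin (z / 2).
Proof.
move=> e0 ez ze.
have h (u : R) : e / 2 <= u -> u <= pi / 2 -> sin (e / 2) <= sin u.
  move=> eu up; have pi0 := pi_gt0 R.
  rewrite le_eqVlt; have [->|ne] := eqVneq (e / 2) u; first by rewrite eqxx.
  apply/orP; right; rewrite ltr_sin ?in_itv/=; first by rewrite lt_neqAle ne.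
    by apply/andP; split; lra.
  by apply/andP; split; lra.
have [zp|zp] := lerP (z / 2) (pi / 2); first by apply: h => //; lra.
have -> : sin (z / 2) = sin (pi - z / 2) by rewrite sinB sinpi cospi; ring.
by apply: h; lra.
Qed.

(* The correction term makes the derivative [O(1/n)]: by the Dirichlet kernel
   formula the oscillating part of [saw' + 1/2] is cancelled exactly. *)
Let corr (n : nat) z : R := saw n z - (pi - z) / 2 +
  cos ((n%:R + 2^-1) * z) / ((2 * n%:R + 1) * sin (z / 2)).

Let dcorr (n : nat) z : R :=
  - (cos ((n%:R + 2^-1) * z) * cos (z / 2)) / (2 * (2 * n%:R + 1) * sin (z / 2) ^+ 2).

Let n_gt0 (n : nat) : 0 < 2 * n%:R + 1 :> R.
Proof. by rewrite ltr_wpDl// mulr_ge0. Qed.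

Let d_corr (n : nat) (z : R) : 0 < sin (z / 2) -> is_derive z 1 (corr n) (dcorr n z).
Proof.
move=> s0; have s1 : sin (z / 2) != 0 by rewrite gt_eqF.
have n0 := n_gt0 n; have n1 : 2 * n%:R + 1 != 0 :> R by rewrite gt_eqF.
have dh := is_derive_scale (n%:R + 2^-1) z.
have dc : is_derive z 1 (fun y => cos ((n%:R + 2^-1) * y)) (- sin ((n%:R + 2^-1) * z) * (n%:R + 2^-1)).
  exact: (@is_derive1_comp _ cos (fun y => (n%:R + 2^-1) * y)).
have dh2 : is_derive z 1 (fun y : R => y / 2) 2^-1.
  by apply: is_derive_eq; rewrite /GRing.scale/=; field.
have dss : is_derive z 1 (fun y => sin (y / 2)) (cos (z / 2) * 2^-1).
  exact: (@is_derive1_comp _ sin (fun y : R => y / 2)).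
have dden : is_derive z 1 (fun y => (2 * n%:R + 1) * sin (y / 2)) ((2 * n%:R + 1) * (cos (z / 2) / 2)).
  by apply: is_derive_eq; rewrite /GRing.scale/=; ring.
have den0 : (2 * n%:R + 1) * sin (z / 2) != 0 by rewrite mulf_neq0.
have dV := @is_deriveV R (fun y => (2 * n%:R + 1) * sin (y / 2)) z _ 1 den0 dden.
have dsaw := d_saw n z.
have -> : dcorr n z = dir n z + 2^-1 + (- sin ((n%:R + 2^-1) * z) * (n%:R + 2^-1) / ((2 * n%:R + 1) * sin (z / 2))
   - cos ((n%:R + 2^-1) * z) * ((2 * n%:R + 1) * (cos (z / 2) / 2)) / ((2 * n%:R + 1) * sin (z / 2)) ^+ 2).
  have -> : dir n z = (sin ((n%:R + 2^-1) * z) - sin (z / 2)) / (2 * sin (z / 2)).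
    by rewrite -dirichlet mulrC mulKf// mulf_neq0.
  by rewrite /dcorr; field; rewrite s1.
by rewrite /corr; apply: is_derive_eq; rewrite /GRing.scale/=; field; rewrite s1.
Qed.

Let saw_pi (n : nat) : saw n pi = 0.
Proof.
apply: big1 => k _; suff -> : sin (k.+1%:R * pi) = 0 :> R by rewrite mul0r.
elim: {k}(k.+1) => [|k ih]; first by rewrite mul0r sin0.
by rewrite -natr1 mulrDl mul1r sinD sinpi cospi ih; ring.
Qed.

(** The mean value inequality for [corr], started at [pi], where [saw] and the sawtooth both vanish
    and only the [O(1/n)] correction is left. *)
Let saw_cvg_rate (e : R) : 0 < e -> e <= pi -> exists2 A : R, 0 <= A &
  forall n z, e <= z -> z <= 2 * pi - e -> `|saw n z - (pi - z) / 2| <= A / (2 * n%:R + 1).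
Proof.
move=> e0 epi; set m := sin (e / 2).
have pi0 := pi_gt0 R.
have m0 : 0 < m by apply: sin_gt0_pi; apply/andP; split; lra.
have mn0 : m != 0 by rewrite gt_eqF.
(* In order: the value of [corr] at [pi], its derivative times the length of the interval, and the
   correction term at [z]. *)
exists (1 + pi / (2 * m ^+ 2) + 1 / m) => [|n z ez ze].
  by rewrite !addr_ge0// divr_ge0// ?mulr_ge0 ?sqr_ge0// ltW.
have n0 := n_gt0 n.
have sz y : e <= y -> y <= 2 * pi - e -> m <= sin (y / 2) by exact: sin_half_ge.
have dle y : e <= y -> y <= 2 * pi - e -> `|dcorr n y| <= 1 / (2 * m ^+ 2) / (2 * n%:R + 1).
  move=> ey ye; have sy := sz y ey ye; have sy0 := lt_le_trans m0 sy.
  rewrite /dcorr normrM normrN normfV.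
  rewrite (_ : 1 / (2 * m ^+ 2) / (2 * n%:R + 1) = 1 / (2 * (2 * n%:R + 1) * m ^+ 2)); last first.
    by field; rewrite mn0 gt_eqF.
  apply: ler_pM => //.
    by rewrite normrM -[leRHS]mulr1; apply: ler_pM => //; exact: cos_max.
  have p1 : 0 < 2 * (2 * n%:R + 1) * m ^+ 2 by rewrite mulr_gt0 ?exprn_gt0// mulr_gt0.
  have p2 : 0 < 2 * (2 * n%:R + 1) * sin (y / 2) ^+ 2 by rewrite mulr_gt0 ?exprn_gt0// mulr_gt0.
  rewrite (gtr0_norm p2) lef_pV2 ?posrE//; apply: ler_wpM2l; first by rewrite mulr_ge0// ltW.
  by rewrite ler_sqr ?nnegrE// ltW.
have dW y : e <= y -> y <= 2 * pi - e -> is_derive y 1 (corr n) (dcorr n y).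
  by move=> ey ye; apply: d_corr; exact: lt_le_trans m0 (sz y ey ye).
have cpi : `|corr n pi| <= 1 / (2 * n%:R + 1).
  rewrite /corr saw_pi subrr mul0r subr0 add0r sin_pihalf mulr1 normrM normfV (gtr0_norm n0).
  by apply: ler_wpM2r; [rewrite invr_ge0 ltW|exact: cos_max].
have cz : `|corr n z - corr n pi| <= pi / (2 * m ^+ 2) / (2 * n%:R + 1).
  have A0 : 0 <= 1 / (2 * m ^+ 2) / (2 * n%:R + 1).
    by rewrite divr_ge0 ?divr_ge0 ?mulr_ge0 ?sqr_ge0// ltW.
  have [zp|/ltW zp] := lerP z pi.
    rewrite distrC; apply: (le_trans (@lipschitz_of_derive R (corr n) (dcorr n) z pi _ zp _ _)).
    - by move=> y; rewrite in_itv/= => /andP[h1 h2]; apply: dW; lra.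
    - by move=> y; rewrite in_itv/= => /andP[h1 h2]; apply: dle; lra.
    - rewrite [leRHS](_ : _ = 1 / (2 * m ^+ 2) / (2 * n%:R + 1) * pi); last by field; rewrite mn0 gt_eqF.
      by apply: ler_wpM2l => //; lra.
  apply: (le_trans (@lipschitz_of_derive R (corr n) (dcorr n) pi z _ zp _ _)).
  - by move=> y; rewrite in_itv/= => /andP[h1 h2]; apply: dW; lra.
  - by move=> y; rewrite in_itv/= => /andP[h1 h2]; apply: dle; lra.
  - rewrite [leRHS](_ : _ = 1 / (2 * m ^+ 2) / (2 * n%:R + 1) * pi); last by field; rewrite mn0 gt_eqF.
    by apply: ler_wpM2l => //; lra.
have osc : `|cos ((n%:R + 2^-1) * z) / ((2 * n%:R + 1) * sin (z / 2))| <= 1 / m / (2 * n%:R + 1).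
  have s0 := lt_le_trans m0 (sz z ez ze).
  rewrite normrM normfV (gtr0_norm (mulr_gt0 n0 s0)) invfM mulrA.
  rewrite [leRHS]mulrAC; apply: ler_pM => //.
  - by rewrite invr_ge0 ltW.
  - by apply: ler_wpM2r; [rewrite invr_ge0 ltW|exact: cos_max].
  - by rewrite lef_pV2// sz.
have -> : saw n z - (pi - z) / 2 = corr n pi + (corr n z - corr n pi) -
   cos ((n%:R + 2^-1) * z) / ((2 * n%:R + 1) * sin (z / 2)) by rewrite /corr; ring.
rewrite (le_trans (ler_normB _ _))// [leRHS]mulrDl [X in _ <= X + _]mulrDl; apply: lerD => //.
by rewrite (le_trans (ler_normD _ _))// lerD.
Qed.

Let para z : R := pi * z / 2 - z ^+ 2 / 4.

(** Integrates the sawtooth estimate from [e], since the rate degenerates at 0; the value at [e] is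
    left to [cos_series_small]. *)
Let cos_series_cvg_rate (e : R) : 0 < e -> e <= pi -> exists2 A : R, 0 <= A &
  forall n z, e <= z -> z <= 2 * pi - e ->
    `|(cos_series n z - para z) - (cos_series n e - para e)| <= A / (2 * n%:R + 1).
Proof.
move=> e0 epi; have [A A0 Ah] := saw_cvg_rate e0 epi; have pi0 := pi_gt0 R.
exists (A * (2 * pi)) => [|n z ez ze]; first by rewrite mulr_ge0// mulr_ge0// ltW.
have n0 := n_gt0 n.
have dK (y : R) : is_derive y 1 (fun y => cos_series n y - para y) (saw n y - (pi - y) / 2).
  have h := d_cos_series n y; rewrite /para.
  by apply: is_derive_eq; rewrite /GRing.scale/=; field.
apply: (le_trans (@lipschitz_of_derive R (fun y => cos_series n y - para y) _ e z _ ez (fun y _ => dK y) _)).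
  by move=> y; rewrite in_itv/= => /andP[h1 h2]; apply: Ah; lra.
rewrite mulrAC; apply: ler_wpM2r; first by rewrite invr_ge0 ltW.
by apply: ler_wpM2l => //; lra.
Qed.

Lemma cos_series_ge0 n z : 0 <= cos_series n z.
Proof.
by apply: sumr_ge0 => k _; rewrite divr_ge0 ?sqr_ge0// subr_ge0 cos_le1.
Qed.

(** Terms up to [N + 1] are at most [z^2 / 2] each, later ones at most [2 / k^2]. At
    [z = 1 / (N + 1)] the bound is [O(1/N)] uniformly in [n]. *)
Let cos_series_small (N n : nat) z : cos_series n z <= N.+1%:R * z ^+ 2 / 2 + 2 / N.+1%:R.
Proof.
have z2 : 0 <= z ^+ 2 by exact: sqr_ge0.
have h1 m : cos_series m z <= m%:R * z ^+ 2 / 2.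
  elim: m => [|m ih]; first by rewrite /cos_series big_ord0 mul0r mul0r.
  rewrite /cos_series big_ord_recr/= -/(cos_series m z).
  have -> : m.+1%:R * z ^+ 2 / 2 = m%:R * z ^+ 2 / 2 + z ^+ 2 / 2 by rewrite -natr1; ring.
  apply: lerD => //; rewrite ler_pdivrMr ?exprn_gt0// (le_trans (cos_ge _))// exprMn.
  by rewrite le_eqVlt; apply/orP; left; apply/eqP; ring.
have [nN|/ltnW nN] := leqP n N.+1.
  rewrite (le_trans (h1 _))// -[leLHS]addr0 lerD ?divr_ge0//.
  by rewrite ler_pM2r ?invr_gt0// ler_wpM2r// ler_nat.
(* The extra [- 2 / n] makes the induction over the tail telescope. *)
suff : cos_series n z <= N.+1%:R * z ^+ 2 / 2 + 2 / N.+1%:R - 2 / n%:R.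
  by move=> /le_trans; apply; rewrite lerBlDr lerDl divr_ge0.
rewrite -(subnKC nN); elim: (n - N.+1)%N => [|m ih].
  by rewrite addn0 addrK h1.
rewrite addnS /cos_series big_ord_recr/= -/(cos_series (N.+1 + m) z).
set q := (N.+1 + m)%N in ih *.
have q0 : 0 < q%:R :> R by rewrite ltr0n.
have : (1 - cos (q.+1%:R * z)) / q.+1%:R ^+ 2 <= 2 / q%:R - 2 / q.+1%:R.
  have -> : 2 / q%:R - 2 / q.+1%:R = 2 / (q%:R * q.+1%:R) :> R.
    by rewrite -(natr1 q); field; rewrite gt_eqF//= gt_eqF// ltr_wpDl// ltW.
  apply: ler_pM.
  - by rewrite subr_ge0 cos_le1.
  - by rewrite invr_ge0 sqr_ge0.
  - by have := cos_geN1 (q.+1%:R * z); lra.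
  - by rewrite lef_pV2 ?posrE ?mulr_gt0 ?exprn_gt0// expr2 ler_pM2r// ler_nat.
move=> h; apply: (le_trans (lerD ih h)).
by rewrite le_eqVlt; apply/orP; left; apply/eqP; ring.
Qed.

Let cvg_inv_odd (A : R) : (fun n : nat => A / (2 * n%:R + 1)) @ \oo --> (0 : R).
Proof.
rewrite -(mulr0 A); apply: cvgM; first exact: cvg_cst.
apply/gtr0_cvgV0; first by apply: nearW => n.
apply: (@ger_cvgy _ _ _ _ (fun n : nat => n%:R : R)) cvgr_idn.
by apply: nearW => n; rewrite -[leLHS]mul1r -[leLHS]addr0 lerD// ler_wpM2r// ler1n.
Qed.

Lemma cos_series_cvg (z : R) : 0 <= z -> z <= 2 * pi ->
  (fun n => cos_series n z) @ \oo --> pi * z / 2 - z ^+ 2 / 4.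
Proof.
move=> z0 z2p; have pi0 := pi_gt0 R; have pi4 : pi <= 4 :> R by have := @pihalf_lt2 R; lra.
have [->|zn0] := eqVneq z 0.
  rewrite mulr0 mul0r expr0n/= mul0r subr0; apply: cvg_near_cst; apply: nearW => n.
  by apply: big1 => k _; rewrite mulr0 cos0 subrr mul0r.
have [->|zn2] := eqVneq z (2 * pi).
  rewrite (_ : _ - _ = 0); last by field.
  apply: cvg_near_cst; apply: nearW => n.
  apply: big1 => k _; rewrite (_ : cos _ = 1) ?subrr ?mul0r//.
  have -> : k.+1%:R * (2 * pi) = 0 + (pi *+ 2) *+ k.+1 :> R.
    by rewrite add0r -(mulr_natr _ k.+1) -(mulr_natr pi 2); ring.
  by rewrite (periodicn (@cosD2pi R)) cos0.
have z_gt0 : 0 < z by rewrite lt_neqAle eq_sym zn0.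
have z_lt2 : z < 2 * pi by rewrite lt_neqAle zn2.
apply/cvgrPdist_le => eps eps0.
have hle (r : R) : 0 < r -> \forall n \near \oo, n.+1%:R^-1 <= r.
  by move=> r0; exact: (cvgr_le _ (@cvg_harmonic R)).
near \oo => N.
have N1 : N.+1%:R^-1 <= z by near: N; exact: hle.
have N2 : N.+1%:R^-1 <= 2 * pi - z by near: N; apply: hle; rewrite subr_gt0.
have N3 : N.+1%:R^-1 <= pi :> R by near: N; exact: hle.
(* At [e = 1 / (N + 1)] the series and the parabola together cost at most
   [(1/2 + 2 + pi/2) e <= 5 e]. *)
have N4 : 5 / N.+1%:R <= eps / 2.
  have : N.+1%:R^-1 <= eps / 10 by near: N; apply: hle; rewrite divr_gt0.
  by move: (N.+1%:R^-1) => u; lra.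
set e : R := N.+1%:R^-1 in N1 N2 N3.
have e0 : 0 < e by rewrite invr_gt0.
have [A A0 Ah] := cos_series_cvg_rate e0 N3.
near=> n; rewrite distrC -/(para z).
have h1 := Ah n z N1 ltac:(lra).
have h2 : A / (2 * n%:R + 1) <= eps / 2.
  by near: n; apply: (cvgr_le _ (cvg_inv_odd A)); rewrite divr_gt0.
have h3 := cos_series_small N n e; have h4 := cos_series_ge0 n e.
have h5 : N.+1%:R * e ^+ 2 / 2 + 2 / N.+1%:R + pi * e / 2 <= 5 / N.+1%:R.
  rewrite (_ : N.+1%:R * e ^+ 2 = e); last by rewrite /e; field.
  by rewrite -/e; have := ler_wpM2r (ltW e0) pi4; lra.
have h6 : 0 <= para e.
  have h7 := ler_wpM2r (ltW e0) N3; rewrite -expr2 in h7.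
  have h8 : 0 <= pi * e by rewrite mulr_ge0// ltW.
  by rewrite /para; lra.
have h7 : para e <= pi * e / 2 by rewrite /para lerBlDr lerDl divr_ge0// sqr_ge0.
rewrite -[leLHS]/(`|cos_series n z - para z|).
have -> : cos_series n z - para z = (cos_series n z - para z - (cos_series n e - para e)) + (cos_series n e - para e) by ring.
rewrite (le_trans (ler_normD _ _))//.
have : `|cos_series n e - para e| <= eps / 2.
  have h8 : cos_series n e + pi * e / 2 <= eps / 2.
    by rewrite (le_trans _ N4)// (le_trans _ h5)// lerD2r.
  have h9 : 0 <= pi * e / 2 by exact: le_trans h6 h7.
  rewrite ler_norml; move: h4 h6 h7 h8 h9; move: (para e) (cos_series n e) (pi * e / 2) => u v w.
  by move=> *; apply/andP; split; lra.
by move: (le_trans h1 h2); move: `|_ - _| => u; lra.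
Unshelve. all: by end_near. Qed.

End fourier_series.

(** * Inner products of cosine increments *)

Section cosine_increments.
Context (R : realType).
Implicit Types x y : R.

Lemma cvg_sum_fin (I : Type) (s : seq I) (f : I -> nat -> R) (l : I -> R) :
  (forall i, f i @ \oo --> l i) -> (fun n => \sum_(i <- s) f i n) @ \oo --> \sum_(i <- s) l i.
Proof.
move=> fl; elim: s => [|i s ih].
  by rewrite big_nil; under eq_fun do rewrite big_nil; exact: cvg_cst.
by rewrite big_cons; under eq_fun do rewrite big_cons; exact: cvgD.
Qed.

(** As [max x y = x + y - min x y], the limit is a multiple of the Brownian covariance with reversed
    sign, up to terms in one variable. Those cancel in the mixed differences of [cos_incr_sumE]. *)
Let half_sum_cvg x y : 0 <= x -> x <= pi -> 0 <= y -> y <= pi ->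
  (fun n => (cos_series n `|x - y| + cos_series n (x + y)) / 2) @ \oo -->
  pi / 2 * Num.max x y - (x ^+ 2 + y ^+ 2) / 4.
Proof.
move=> x0 xp y0 yp.
have -> : pi / 2 * Num.max x y - (x ^+ 2 + y ^+ 2) / 4 =
    ((pi * `|x - y| / 2 - `|x - y| ^+ 2 / 4) + (pi * (x + y) / 2 - (x + y) ^+ 2 / 4)) / 2.
  rewrite real_normK ?num_real//; have [xy|/ltW xy] := leP x y.
    by rewrite ler0_norm ?subr_le0//; field.
  by rewrite ger0_norm ?subr_ge0//; field.
apply: cvgM; last exact: cvg_cst.
apply: cvgD; apply: cos_series_cvg.
- exact: normr_ge0.
- by rewrite ler_norml; apply/andP; split; lra.
- by rewrite addr_ge0.
- lra.
Qed.

Definition cos_incr_sum (n : nat) x1 x2 y1 y2 : R :=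
  \sum_(k < n) (cos (k.+1%:R * x2) - cos (k.+1%:R * x1)) *
    (cos (k.+1%:R * y2) - cos (k.+1%:R * y1)) / k.+1%:R ^+ 2.

Let prod_cos (k x y : R) : cos (k * x) * cos (k * y) =
  1 - ((1 - cos (k * `|x - y|)) + (1 - cos (k * (x + y)))) / 2.
Proof.
have -> : cos (k * `|x - y|) = cos (k * x) * cos (k * y) + sin (k * x) * sin (k * y).
  rewrite -cosB; have [xy|/ltW xy] := leP 0 (x - y).
    by rewrite ger0_norm//; congr cos; ring.
  by rewrite ler0_norm// -[LHS]cosN; congr cos; ring.
by rewrite mulrDr cosD; field.
Qed.

Let cos_incr_sumE n x1 x2 y1 y2 : cos_incr_sum n x1 x2 y1 y2 =
  (cos_series n `|x2 - y1| + cos_series n (x2 + y1)) / 2 +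
  (cos_series n `|x1 - y2| + cos_series n (x1 + y2)) / 2 -
  (cos_series n `|x2 - y2| + cos_series n (x2 + y2)) / 2 -
  (cos_series n `|x1 - y1| + cos_series n (x1 + y1)) / 2.
Proof.
rewrite /cos_series -!big_split/= !mulr_suml -!big_split/= -!sumrB.
apply: eq_bigr => k _.
set c := k.+1%:R : R.
rewrite (_ : (cos (c * x2) - cos (c * x1)) * (cos (c * y2) - cos (c * y1)) =
  cos (c * x2) * cos (c * y2) - cos (c * x2) * cos (c * y1) -
  cos (c * x1) * cos (c * y2) + cos (c * x1) * cos (c * y1)); last by ring.
by rewrite !prod_cos; field.
Qed.

Lemma cos_incr_sum_cvg x1 x2 y1 y2 : 0 <= x1 -> x1 <= x2 -> x2 <= pi ->
  0 <= y1 -> y1 <= y2 -> y2 <= pi ->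
  (fun n => cos_incr_sum n x1 x2 y1 y2) @ \oo -->
  pi / 2 * (Num.max x2 y1 + Num.max x1 y2 - Num.max x2 y2 - Num.max x1 y1).
Proof.
move=> x10 x12 x2p y10 y12 y2p; under eq_fun do rewrite cos_incr_sumE.
have -> : pi / 2 * (Num.max x2 y1 + Num.max x1 y2 - Num.max x2 y2 - Num.max x1 y1) =
  (pi / 2 * Num.max x2 y1 - (x2 ^+ 2 + y1 ^+ 2) / 4) +
  (pi / 2 * Num.max x1 y2 - (x1 ^+ 2 + y2 ^+ 2) / 4) -
  (pi / 2 * Num.max x2 y2 - (x2 ^+ 2 + y2 ^+ 2) / 4) -
  (pi / 2 * Num.max x1 y1 - (x1 ^+ 2 + y1 ^+ 2) / 4) by ring.
have x20 := le_trans x10 x12; have y20 := le_trans y10 y12.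
have x1p := le_trans x12 x2p; have y1p := le_trans y12 y2p.
by apply: cvgB; [apply: cvgB; [apply: cvgD|]|]; exact: half_sum_cvg.
Qed.

Lemma cos_incr_sum_diag x1 x2 : 0 <= x1 -> x1 <= x2 -> x2 <= pi ->
  (fun n => cos_incr_sum n x1 x2 x1 x2) @ \oo --> pi / 2 * (x2 - x1).
Proof.
move=> h1 h2 h3; have := cos_incr_sum_cvg h1 h2 h3 h1 h2 h3.
rewrite (max_idPl h2) (max_idPr h2) !maxxx.
by rewrite (_ : x2 + x2 - x2 - x1 = x2 - x1); last by ring.
Qed.

Lemma cos_incr_sum_disjoint x1 x2 y1 y2 : 0 <= x1 -> x1 <= x2 -> x2 <= y1 ->
  y1 <= y2 -> y2 <= pi ->
  (fun n => cos_incr_sum n x1 x2 y1 y2) @ \oo --> (0 : R).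
Proof.
move=> h1 h2 h3 h4 h5.
have := @cos_incr_sum_cvg x1 x2 y1 y2 h1 h2 ltac:(lra) ltac:(lra) h4 h5.
rewrite (max_idPr h3) (max_idPr (le_trans h2 (le_trans h3 h4))).
rewrite (max_idPr (le_trans h3 h4)) (max_idPr (le_trans h2 h3)).
by rewrite (_ : _ * (_ - _) = 0); last by ring.
Qed.

Lemma cos_incr_sumC n x1 x2 y1 y2 : cos_incr_sum n x1 x2 y1 y2 = cos_incr_sum n y1 y2 x1 x2.
Proof. by apply: eq_bigr => k _; rewrite (mulrC (_ - _)). Qed.

Lemma sum_inv_sqr_le (n : nat) : \sum_(k < n) (k.+1%:R ^+ 2)^-1 <= 2 :> R.
Proof.
suff : \sum_(k < n.+1) (k.+1%:R ^+ 2)^-1 <= 2 - n.+1%:R^-1 :> R.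
  rewrite big_ord_recr/= => h; apply: (@le_trans _ _ (\sum_(k < n) (k.+1%:R ^+ 2)^-1 + (n.+1%:R ^+ 2)^-1)).
    by rewrite lerDl invr_ge0 sqr_ge0.
  by apply: (le_trans h); rewrite lerBlDr lerDl invr_ge0.
elim: n => [|n ih]; first by rewrite big_ord1 expr1n invr1; lra.
rewrite big_ord_recr/=; apply: (@le_trans _ _ (2 - n.+1%:R^-1 + (n.+2%:R ^+ 2)^-1)).
  by rewrite lerD2r.
rewrite -subr_ge0 (_ : _ - _ = (n.+1%:R * n.+2%:R ^+ 2)^-1).
  by rewrite invr_ge0 mulr_ge0// sqr_ge0.
have : (0 : R) < n.+1%:R by [].
by rewrite -(natr1 n.+1); move: (n.+1%:R) => x x0; field; rewrite !gt_eqF// addr_gt0.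
Qed.

End cosine_increments.

(** * The increment matrix: contraction and trace *)

Section increment_matrix.
Context (R : realType) (a b : R).
Hypotheses (ha : 0 <= a) (hab : a < b) (hb : b <= pi).
Variables (theta t : R).
Hypotheses (htheta : 0 < theta) (ht : 0 < t).
Variable (M : nat).
Hypothesis M0 : (0 < M)%N.

Let MR0 : 0 < M%:R :> R. Proof. by rewrite ltr0n. Qed.
Let h : R := (b - a) / M%:R.
Let h_gt0 : 0 < h. Proof. by rewrite divr_gt0// subr_gt0. Qed.

Let gridE j : grid a b M j = a + j%:R * h.
Proof. by rewrite /grid /h; ring. Qed.

Let grid_incr j : grid a b M j.+1 - grid a b M j = h.
Proof. by rewrite !gridE -natr1; ring. Qed.

Let grid_le i j : (i <= j)%N -> grid a b M i <= grid a b M j.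
Proof. by move=> ij; rewrite !gridE lerD2l ler_wpM2r ?ler_nat// ltW. Qed.

Let grid_ge0 j : 0 <= grid a b M j.
Proof. by rewrite gridE addr_ge0// mulr_ge0// ltW. Qed.

Let gridM : grid a b M M = b.
Proof. by rewrite /grid; field; rewrite gt_eqF. Qed.

Let grid_lepi j : (j <= M)%N -> grid a b M j <= pi.
Proof. by move=> jM; rewrite (le_trans (grid_le jM))// gridM. Qed.

Lemma grid_in (j : nat) : (j <= M)%N -> grid a b M j \in `[0, pi].
Proof. by move=> jM; rewrite in_itv/= grid_ge0 grid_lepi. Qed.

Let damp (k : nat) : R := 1 - expR (- (k.+1%:R ^+ 2 * theta * t)).

Let dcos (j k : nat) : R := cos (k.+1%:R * grid a b M j.+1) - cos (k.+1%:R * grid a b M j).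

(** After scaling, [sigma] has disappeared and [theta] survives only in the damping factor. *)
Definition incr_matrix (n : nat) (j : 'I_M) (k : 'I_n) : R :=
  Num.sqrt (2 / pi) / Num.sqrt ((b - a) / M%:R) *
  (1 - expR (- (k.+1%:R ^+ 2 * theta * t))) *
  ((cos (k.+1%:R * grid a b M j.+1) - cos (k.+1%:R * grid a b M j)) / k.+1%:R).

Let c : R := 2 / pi / h.
Let c_gt0 : 0 < c. Proof. by rewrite divr_gt0// divr_gt0// pi_gt0. Qed.

Let incr_matrix_sqr n (j : 'I_M) (k : 'I_n) (v : R) :
  (incr_matrix j k * v) = Num.sqrt c * damp k * (v * dcos j k / k.+1%:R).
Proof.
have -> : Num.sqrt c = Num.sqrt (2 / pi) / Num.sqrt ((b - a) / M%:R).
  rewrite -(@sqrtrV _ ((b - a) / M%:R)); last exact: ltW.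
  by rewrite -sqrtrM// divr_ge0// ltW// pi_gt0.
by rewrite /incr_matrix /damp /dcos; ring.
Qed.

Let damp_ge0 k : 0 <= damp k.
Proof. by rewrite subr_ge0 -expR0 ler_expR oppr_le0 !mulr_ge0 ?sqr_ge0// ltW. Qed.

Let damp_le1 k : damp k <= 1.
Proof. by rewrite lerBlDr lerDl expR_ge0. Qed.

Let incr_sum (i j n : nat) : R :=
  cos_incr_sum n (grid a b M i) (grid a b M i.+1) (grid a b M j) (grid a b M j.+1).

Let incr_sum_cvg (i j : 'I_M) :
  (fun n => incr_sum i j n) @ \oo --> (pi / 2 * h) * (i == j)%:R.
Proof.
have [->|ne] := eqVneq i j.
  rewrite mulr1 -(grid_incr j); apply: cos_incr_sum_diag; first exact: grid_ge0.
    exact: grid_le.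
  exact: grid_lepi.
rewrite mulr0; have : val i != val j by [].
rewrite neq_ltn => /orP[ij|ij]; last under eq_fun do rewrite /incr_sum cos_incr_sumC.
  by apply: cos_incr_sum_disjoint; [exact: grid_ge0|exact: grid_le|exact: grid_le|exact: grid_le|exact: grid_lepi].
by apply: cos_incr_sum_disjoint; [exact: grid_ge0|exact: grid_le|exact: grid_le|exact: grid_le|exact: grid_lepi].
Qed.

Let lincomb_sum (v : 'I_M -> R) (n : nat) : R :=
  \sum_(k < n) (\sum_j v j * dcos j k / k.+1%:R) ^+ 2.

Let lincomb_sumE v n : lincomb_sum v n = \sum_i \sum_j v i * v j * incr_sum i j n.
Proof.
rewrite /lincomb_sum; under eq_bigr do rewrite expr2 big_distrlr/=.
rewrite exchange_big; apply: eq_bigr => i _.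
rewrite exchange_big; apply: eq_bigr => j _.
rewrite /incr_sum /cos_incr_sum mulr_sumr; apply: eq_bigr => k _.
by rewrite /dcos; field.
Qed.

Let lincomb_sum_cvg v : (fun n => lincomb_sum v n) @ \oo --> pi / 2 * h * \sum_j v j ^+ 2.
Proof.
under eq_fun do rewrite lincomb_sumE.
have -> : pi / 2 * h * \sum_j v j ^+ 2 = \sum_i \sum_j v i * v j * ((pi / 2 * h) * (i == j)%:R).
  rewrite mulr_sumr; apply: eq_bigr => i _.
  rewrite (bigD1 i)//= eqxx big1 ?addr0; first by rewrite mulr1; ring.
  by move=> j ji; rewrite eq_sym (negbTE ji) !mulr0.
apply: cvg_sum_fin => i; apply: cvg_sum_fin => j.
by apply: cvgM; [exact: cvg_cst|exact: incr_sum_cvg].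
Qed.

(* Bessel's inequality for step functions in the sine basis. *)
Let lincomb_sum_le v n : lincomb_sum v n <= pi / 2 * h * \sum_j v j ^+ 2.
Proof.
have nd : nondecreasing_seq (lincomb_sum v).
  apply/nondecreasing_seqP => m; rewrite /lincomb_sum big_ord_recr/= lerDl.
  exact: sqr_ge0.
have cv := @lincomb_sum_cvg v.
rewrite -(cvg_lim _ cv)//; apply: nondecreasing_cvgn_le => //.
by apply/cvg_ex; eexists; exact: cv.
Qed.

Let c_inv : c * (pi / 2 * h) = 1.
Proof. 
have h0 := gt_eqF h_gt0; have p0 := gt_eqF (pi_gt0 R).
by rewrite /c; move: h pi h0 p0 => h1 p1 h0 p0; field; rewrite h0 p0.
Qed.

(** The damping depends on the mode only, so it leaves the inner sum as a factor in [[0, 1]] and can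
    only decrease the undamped Bessel sum. *)
Lemma incr_matrix_bessel n (v : 'I_M -> R) :
  \sum_(k < n) (\sum_j incr_matrix j k * v j) ^+ 2 <= \sum_j v j ^+ 2.
Proof.
have := ler_wpM2l (ltW c_gt0) (lincomb_sum_le v n).
rewrite mulrA c_inv mul1r; apply: le_trans; rewrite /lincomb_sum mulr_sumr.
apply: ler_sum => k _; under eq_bigr do rewrite incr_matrix_sqr.
rewrite -mulr_sumr !exprMn sqr_sqrtr; last exact: ltW.
rewrite -mulrA ler_pM2l// -[leRHS]mul1r; apply: ler_wpM2r; first exact: sqr_ge0.
by rewrite exprn_ile1.
Qed.

(** Bessel's inequality at [v = B x]. *)
Lemma incr_matrix_contraction n (x : 'I_n -> R) :
  \sum_k qgrad (@incr_matrix n) x k ^+ 2 <= qform (@incr_matrix n) x.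
Proof. exact: (incr_matrix_bessel n (fun j => \sum_l incr_matrix j l * x l)). Qed.

Let row_sum n (j : 'I_M) : \sum_k (@incr_matrix n) j k ^+ 2 = c * \sum_(k < n) damp k ^+ 2 * (dcos j k / k.+1%:R) ^+ 2.
Proof.
rewrite mulr_sumr; apply: eq_bigr => k _.
have := @incr_matrix_sqr n j k 1; rewrite mulr1 mul1r => ->.
by rewrite !exprMn sqr_sqrtr; [ring|exact: ltW].
Qed.

Let incr_sum_diag n (j : nat) : incr_sum j j n = \sum_(k < n) (dcos j k / k.+1%:R) ^+ 2.
Proof. by apply: eq_bigr => k _; rewrite /dcos; field. Qed.

(** Bessel's inequality at the unit vectors bounds every row norm by 1. *)
Lemma qtrace_incr_matrix_le n : qtrace (@incr_matrix n) <= M%:R.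
Proof.
rewrite qtraceE; apply: (@le_trans _ _ (\sum_(j < M) 1)); last by rewrite sumr_const card_ord.
apply: ler_sum => j _.
have := incr_matrix_bessel n (fun i => (i == j)%:R).
have -> : \sum_i ((i == j)%:R : R) ^+ 2 = 1.
  rewrite (bigD1 j)//= eqxx expr1n big1 ?addr0//.
  by move=> i ij; rewrite (negbTE ij) expr0n.
apply: le_trans; rewrite le_eqVlt; apply/orP; left; apply/eqP.
apply: eq_bigr => k _; rewrite (bigD1 j)//= eqxx mulr1 big1 ?addr0//.
by move=> i ij; rewrite (negbTE ij) mulr0.
Qed.

(** The first part is the loss from cutting at [n] modes, the second the loss from damping:
    [|dcos j k / k| <= h] by the Lipschitz bound, [1 - damp^2 <= 2 / (k^2 theta t)], and the inverse
    squares sum to at most 2. *)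
Let damp_loss n (j : 'I_M) : 1 - \sum_k (@incr_matrix n) j k ^+ 2 <=
  (1 - c * incr_sum j j n) + c * h ^+ 2 * (4 / (theta * t)).
Proof.
rewrite row_sum -subr_ge0 (_ : _ - _ = c * (h ^+ 2 * (4 / (theta * t)) - (incr_sum j j n -
   \sum_(k < n) damp k ^+ 2 * (dcos j k / k.+1%:R) ^+ 2))); last by ring.
rewrite mulr_ge0 ?subr_ge0//; first exact: ltW.
rewrite incr_sum_diag -sumrB.
apply: (@le_trans _ _ (\sum_(k < n) h ^+ 2 * (2 / (theta * t)) * (k.+1%:R ^+ 2)^-1)); last first.
  rewrite -mulr_sumr (_ : h ^+ 2 * (4 / (theta * t)) = h ^+ 2 * (2 / (theta * t)) * 2); last by field; rewrite !gt_eqF.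
  apply: ler_wpM2l; last exact: sum_inv_sqr_le.
  by rewrite mulr_ge0 ?sqr_ge0// divr_ge0// mulr_ge0// ltW.
apply: ler_sum => k _.
have k0 : 0 < k.+1%:R :> R by rewrite ltr0n.
have d1 : (dcos j k / k.+1%:R) ^+ 2 <= h ^+ 2.
  rewrite -[leLHS]real_normK ?num_real// ler_sqr ?nnegrE//; last exact: ltW.
  rewrite normrM normfV (gtr0_norm k0) ler_pdivrMr// (le_trans (norm_cosB_le _ _))//.
  by rewrite -mulrBr grid_incr normrM !gtr0_norm// mulrC.
have d2 : 1 - damp k ^+ 2 <= 2 / (theta * t) * (k.+1%:R ^+ 2)^-1.
  have e1 : expR (- (k.+1%:R ^+ 2 * theta * t)) <= (k.+1%:R ^+ 2 * theta * t)^-1.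
    by apply: expRN_le_inv; rewrite !mulr_gt0 ?exprn_gt0.
  have -> : 2 / (theta * t) * (k.+1%:R ^+ 2)^-1 = 2 * (k.+1%:R ^+ 2 * theta * t)^-1.
    by field; rewrite !gt_eqF.
  have e0 := expR_ge0 (- (k.+1%:R ^+ 2 * theta * t)).
  move: e1 e0; rewrite /damp; move: (expR _) (_^-1) => u w; nra.
have d3 : 0 <= 1 - damp k ^+ 2 by rewrite subr_ge0 exprn_ile1.
have := ler_pM d3 (sqr_ge0 _) d2 d1.
rewrite (_ : (1 - damp k ^+ 2) * _ = (dcos j k / k.+1%:R) ^+ 2 - damp k ^+ 2 * (dcos j k / k.+1%:R) ^+ 2); last by ring.
by move=> /le_trans; apply; rewrite le_eqVlt; apply/orP; left; apply/eqP; ring.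
Qed.

(** The 1 absorbs the cut at [n] modes for large [n]. Since [c h^2 = 2 h / pi], the damping losses
    of the [M] rows add up to the second term, in which [M] cancels. *)
Definition trace_defect : R := 1 + 8 * (b - a) / (pi * (theta * t)).

Lemma trace_defect_incr_matrix :
  \forall n \near \oo, `|M%:R - qtrace (@incr_matrix n)| <= trace_defect.
Proof.
have c0 : (fun n => \sum_(j < M) (1 - c * incr_sum j j n)) @ \oo -->
    \sum_(j < M) (1 - c * ((pi / 2 * h) * (j == j)%:R)).
  apply: cvg_sum_fin => j; apply: cvgB; first exact: cvg_cst.
  by apply: cvgM; [exact: cvg_cst|exact: incr_sum_cvg].
rewrite big1 in c0; last by move=> j _; rewrite eqxx mulr1 c_inv subrr.
near=> n.
rewrite ger0_norm; last by rewrite subr_ge0 qtrace_incr_matrix_le.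
have -> : M%:R - qtrace (@incr_matrix n) = \sum_(j < M) (1 - \sum_k (@incr_matrix n) j k ^+ 2).
  by rewrite sumrB sumr_const card_ord -qtraceE.
apply: (le_trans (ler_sum _ (fun j _ => damp_loss n j))).
rewrite big_split/= /trace_defect; apply: lerD.
  by near: n; exact: (cvgr_le _ c0).
rewrite sumr_const card_ord -mulr_natr le_eqVlt; apply/orP; left; apply/eqP.
have p0 := gt_eqF (pi_gt0 R); have d0 : b - a != 0 by rewrite subr_eq0 gt_eqF.
rewrite /c /h; move: pi p0 => p p0; field.
by rewrite p0 d0 !gt_eqF.
Unshelve. all: by end_near. Qed.

End increment_matrix.

(** * From moment and Stein bounds to limit theorems *)

Section convergence_of_expectations.
Context (R : realType) (d : measure_display) (T : measurableType d)
  (P : probability T R).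

Lemma measurable_inv : measurable_fun setT (fun x : R => x^-1).
Proof.
rewrite -(setvU [set 0 : R]); apply/measurable_funU => //.
  exact: measurableC.
split; last exact: measurable_fun_set1.
apply: open_continuous_measurable_fun; first exact/closed_openC/closed_eq.
by move=> x; rewrite inE /= => x0; apply: inv_continuous; exact/eqP.
Qed.

Lemma Rintegral_bounded_cvg (X : nat -> T -> R) (Y : T -> R) (C : R) :
  (forall n, measurable_fun setT (X n)) -> measurable_fun setT Y ->
  (forall n w, `|X n w| <= C) -> {ae P, forall w, X n w @[n --> \oo] --> Y w} ->
  \int[P]_w X n w @[n --> \oo] --> \int[P]_w Y w.
Proof.
move=> mX mY XC XY.
have mXE n : measurable_fun setT (EFin \o X n) by exact/measurable_EFinP.
have mYE : measurable_fun setT (EFin \o Y) by exact/measurable_EFinP.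
have [iY _ cv] : [/\ P.-integrable setT (EFin \o Y), _ & _] :=
  @dominated_convergence _ _ _ P setT measurableT (fun n => EFin \o X n) (EFin \o Y)
    (EFin \o cst C) mXE mYE
    ltac:(by apply: filterS XY => w XYw _; apply/fine_cvgP; split; [exact: nearW|exact: XYw])
    ltac:(exact: finite_measure_integrable_cst)
    ltac:(by apply: nearW => w n _ /=; rewrite lee_fin).
apply: fine_cvg; rewrite /Rintegral fineK//.
exact: (integrable_fin_num measurableT iY).
Qed.

Lemma cvg_in_distribution_Rintegral (X : nat -> T -> R)
    (mu : probability (measurableTypeR R) R) :
  (forall n, measurable_fun setT (X n)) ->
  (forall f C, continuous f -> (forall x, `|f x| <= C) ->
    \int[P]_w f (X n w) @[n --> \oo] --> \int[mu]_x f x) ->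
  cvg_in_distribution P X mu.
Proof.
move=> mX Xmu; split => // f cf [C fC].
have mf := continuous_measurable_fun cf.
have iX n : P.-integrable setT (EFin \o (fun w => f (X n w))).
  by apply: (@bounded_integrable _ _ _ P _ C) => //; exact: measurableT_comp.
have imu : mu.-integrable setT (EFin \o f) by exact: (@bounded_integrable _ _ _ mu _ C).
rewrite -[X in _ --> X]fineK; last exact: (integrable_fin_num measurableT imu).
apply/fine_cvgP; split; last exact: Xmu fC.
by apply: nearW => n; exact: (integrable_fin_num measurableT (iX n)).
Qed.

End convergence_of_expectations.

Lemma cvg_inv_sqrt_double (R : realType) :
  ((Num.sqrt (2 * M%:R : R))^-1) @[M --> \oo] --> (0 : R).
Proof.
have -> : (fun M => (Num.sqrt (2 * M%:R : R))^-1) = (fun M => Num.sqrt (2^-1 * M%:R^-1)).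
  by apply/funext => M; rewrite -invfM sqrtrV// mulr_ge0.
rewrite -[X in _ --> X](@sqrtr0 R); apply: continuous_cvg; first exact: sqrt_continuous.
by rewrite -(mulr0 (2^-1 : R)); apply: cvgM; [exact: cvg_cst|exact: @cvg_invn].
Qed.

Section normalised_statistic.
Context (R : realType) (d : measure_display) (T : measurableType d)
  (P : probability T R).
Variables (H : nat -> T -> R) (C4 : R).
Hypothesis mH : forall M, measurable_fun setT (H M).
Hypothesis H4 : forall M, (0 < M)%N -> (\int[P]_w (H M w ^+ 4)%:E <= C4%:E)%E.
(** [C] depends on [kappa] alone, so [g] may vary with [M]. The standard deviation is [|kappa|],
    because one of the estimators needs a negative [kappa]. *)
Hypothesis Hstein : forall kappa : R, kappa != 0 -> exists2 C, 0 <= C &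
  forall M K (g : R -> R), (0 < M)%N -> continuous g -> (forall x, `|g x| <= K) ->
  `|\int[P]_w g (kappa * H M w) - \int[normal_prob 0 (Num.sqrt (kappa ^+ 2))]_x g x| <=
    C * K * (Num.sqrt (2 * M%:R))^-1.

Let c (M : nat) : R := (Num.sqrt (2 * M%:R))^-1.
Let ratio M w := 1 + 2 * c M * H M w.

Let c_ge0 M : 0 <= c M. Proof. by rewrite invr_ge0. Qed.

Let c_sqr M : c M ^+ 2 = 2^-1 * M%:R^-1.
Proof. by rewrite exprVn sqr_sqrtr ?mulr_ge0// invfM. Qed.

Let mH4 M : measurable_fun setT (fun w => H M w ^+ 4).
Proof. exact: measurable_funX. Qed.

Let H4_ge0 M w : 0 <= H M w ^+ 4.
Proof. by rewrite exprn_even_ge0. Qed.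

Let integrable_H4 M : (0 < M)%N -> P.-integrable setT (EFin \o (fun w => H M w ^+ 4)).
Proof.
move=> M0; apply/integrableP; split; first exact/measurable_EFinP.
rewrite (eq_integral (fun w => (H M w ^+ 4)%:E)); last first.
  by move=> w _ /=; rewrite ger0_norm.
by apply: (le_lt_trans (H4 M0)); rewrite ltry.
Qed.

Let Rintegral_H4 M : (0 < M)%N -> \int[P]_w (H M w ^+ 4) <= C4.
Proof.
move=> M0; rewrite -lee_fin /Rintegral fineK ?H4//.
exact: (integrable_fin_num measurableT (integrable_H4 M0)).
Qed.

(** The series of [H^4 / M^2] has finite mean, so it converges almost surely and its terms vanish;
    up to the factor 4 they are the fourth powers of [2 c H]. *)
Lemma ratio_cvg1 : {ae P, forall w, 1 + 2 * (Num.sqrt (2 * M%:R))^-1 * H M w @[M --> \oo] --> (1 : R)}.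
Proof.
pose u w (n : nat) : R := H n.+1 w ^+ 4 * (n.+1%:R ^+ 2)^-1.
have u0 w n : 0 <= u w n by rewrite mulr_ge0// invr_ge0 sqr_ge0.
have mu n : measurable_fun setT (fun w => (u w n)%:E).
  by apply/measurable_EFinP; apply: measurable_funM.
have iu : P.-integrable setT (fun w => \sum_(0 <= n <oo) (u w n)%:E)%E.
  apply/integrableP; split.
    by apply: ge0_emeasurable_sum => // n w _ _; rewrite lee_fin.
  rewrite (eq_integral (fun w => \sum_(0 <= n <oo) (u w n)%:E)%E); last first.
    by move=> w _; rewrite gee0_abs// nneseries_ge0// => n _ _; rewrite lee_fin.
  rewrite integral_nneseries//; last by move=> n w _; rewrite lee_fin.
  apply: (@le_lt_trans _ _ (C4 * 2)%:E); last by rewrite ltry.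
  have iu n : (0 <= \int[P]_w (u w n)%:E)%E by apply: integral_ge0 => w _; rewrite lee_fin.
  apply: lime_le; first by apply: is_cvg_nneseries => n _ _.
  apply: nearW => n; apply: (@le_trans _ _ (\sum_(0 <= k < n) (C4 * (k.+1%:R ^+ 2)^-1)%:E)%E).
    apply: lee_sum => k _.
    under eq_integral do rewrite /u mulrC EFinM.
    rewrite ge0_integralZl_EFin//=.
    - by rewrite mulrC EFinM lee_wpmul2l ?lee_fin ?invr_ge0 ?sqr_ge0// H4.
    - by move=> w _; rewrite lee_fin.
    - exact/measurable_EFinP.
  rewrite sumEFin lee_fin -mulr_sumr big_mkord ler_wpM2l ?sum_inv_sqr_le//.
  by apply: le_trans (Rintegral_H4 (ltn0Sn 0)); apply: Rintegral_ge0 => w _.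
have := integrable_ae measurableT iu; apply: filterS => w /(_ Logic.I) fw.
have u_0 : u w n @[n --> \oo] --> (0 : R).
  apply: cvg_series_cvg_0; apply: nondecreasing_is_cvgn.
    by apply/nondecreasing_seqP => n; rewrite seriesSr lerDl.
  exists (fine (\sum_(0 <= n <oo) (u w n)%:E)%E) => _ [n _ <-].
  rewrite -lee_fin fineK// /series/= -sumEFin.
  by apply: nneseries_lim_ge => k _ _; rewrite lee_fin.
have r4 : (2 * c M.+1 * H M.+1 w) ^+ 4 @[M --> \oo] --> (0 : R).
  have -> : (fun M => (2 * c M.+1 * H M.+1 w) ^+ 4) = (fun M => 4 * u w M).
    apply/funext => M; rewrite /u !exprMn (_ : c M.+1 ^+ 4 = (c M.+1 ^+ 2) ^+ 2); last by ring.
    by rewrite c_sqr; field.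
  by rewrite -(mulr0 (4 : R)); apply: cvgM => //; exact: cvg_cst.
suff h0 : 2 * c M.+1 * H M.+1 w @[M --> \oo] --> (0 : R).
  have h1 : 1 + 2 * c M.+1 * H M.+1 w @[M --> \oo] --> (1 + 0 : R).
    by apply: cvgD => //; exact: cvg_cst.
  by rewrite addr0 in h1; rewrite -cvg_shiftS; exact: h1.
apply: norm_cvg0.
have -> : (fun M => `|2 * c M.+1 * H M.+1 w|) =
    (fun M => Num.sqrt (Num.sqrt ((2 * c M.+1 * H M.+1 w) ^+ 4))).
  apply/funext => M; rewrite (_ : _ ^+ 4 = ((2 * c M.+1 * H M.+1 w) ^+ 2) ^+ 2); last by ring.
  by rewrite sqrtr_sqr (ger0_norm (sqr_ge0 _)) sqrtr_sqr.
have sqrt_0 (v : nat -> R) : v M @[M --> \oo] --> (0 : R) -> Num.sqrt (v M) @[M --> \oo] --> (0 : R).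
  move=> v0; have s0 : Num.sqrt x @[x --> (0 : R)] --> Num.sqrt (0 : R) by exact: sqrt_continuous.
  rewrite sqrtr0 in s0.
  exact: (@cvg_comp _ _ _ v (@Num.sqrt R) \oo (nbhs (0 : R)) _ v0 s0).
exact: (sqrt_0 _ (sqrt_0 _ r4)).
Qed.

Lemma statistic_clt (kappa : R) (X : nat -> T -> R) : kappa != 0 ->
  (forall M, measurable_fun setT (X M)) ->
  (forall M w, (0 < M)%N -> X M w = kappa * H M w) ->
  cvg_in_distribution P X (normal_prob 0 (Num.sqrt (kappa ^+ 2))).
Proof.
move=> kappa0 mX XH; apply: cvg_in_distribution_Rintegral => // f C cf fC.
have [D D0 hD] := Hstein kappa0.
apply/cvgrPdist_le => e e0.
have : (D * C * c M) @[M --> \oo] --> (0 : R).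
  by rewrite -(mulr0 (D * C)); apply: cvgM; [exact: cvg_cst|exact: @cvg_inv_sqrt_double].
move=> /cvgr0_norm_le /(_ e e0) h; near=> M.
have M0 : (0 < M)%N by near: M; exact: nbhs_infty_gt.
rewrite (@eq_Rintegral _ _ _ P setT (fun w => f (kappa * H M w))); last first.
  by move=> w _; rewrite XH.
rewrite distrC; apply: (le_trans (hD M C f M0 cf fC)); apply: (le_trans (ler_norm _)).
by near: M.
Unshelve. all: by end_near. Qed.

(** Division by the ratio with the denominator kept at least [1 / 2]. In the variable [z = kappa H]
    it is continuous, and it tends to the identity as [c] tends to 0. *)
Let clip (kappa : R) (c z : R) : R := z / Num.max (1 + 2 * c * (z / kappa)) 2^-1.

Let clip_den_neq0 (r : R) : Num.max r 2^-1 != 0.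
Proof. by rewrite gt_eqF// lt_max invr_gt0 ltr0n orbT. Qed.

Let clip_continuous kappa c' : continuous (clip kappa c').
Proof.
move=> z; apply: cvgM; first exact: cvg_id.
apply: cvgV; first exact: clip_den_neq0.
apply: (@continuous_max _ _ (fun z : R => 1 + 2 * c' * (z / kappa)) (fun=> 2^-1)); last exact: cvg_cst.
by apply: cvgD; [exact: cvg_cst|apply: cvgM; [exact: cvg_cst|apply: cvgM; [exact: cvg_id|exact: cvg_cst]]].
Qed.

Let clip_cvg kappa z : clip kappa (c M) z @[M --> \oo] --> z.
Proof.
have -> : nbhs z = nbhs (clip kappa 0 z).
  by rewrite /clip mulr0 mul0r addr0 (max_idPl _) ?divr1//; lra.
apply: (@cvg_comp _ _ _ c (fun c' => clip kappa c' z) \oo (nbhs (0 : R)) _ (@cvg_inv_sqrt_double R)).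
apply: cvgM; first exact: cvg_cst.
apply: cvgV; first exact: clip_den_neq0.
apply: (@continuous_max _ _ (fun c' : R => 1 + 2 * c' * (z / kappa)) (fun=> 2^-1)); last exact: cvg_cst.
by apply: cvgD; [exact: cvg_cst|apply: cvgM; [apply: cvgM; [exact: cvg_cst|exact: cvg_id]|exact: cvg_cst]].
Qed.

(* Delta method: off an event of probability [O(M^-2)] dividing by the ratio
   is a bounded continuous perturbation of the statistic, to which the
   quantitative bound applies uniformly in the test function. *)
Lemma ratio_clt (kappa : R) (X : nat -> T -> R) : kappa != 0 ->
  (forall M, measurable_fun setT (X M)) ->
  (forall M w, (0 < M)%N -> 1 + 2 * (Num.sqrt (2 * M%:R))^-1 * H M w != 0 ->
    X M w = kappa * H M w / (1 + 2 * (Num.sqrt (2 * M%:R))^-1 * H M w)) ->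
  cvg_in_distribution P X (normal_prob 0 (Num.sqrt (kappa ^+ 2))).
Proof.
move=> kappa0 mX XH; apply: cvg_in_distribution_Rintegral => // f C cf fC.
set mu := normal_prob 0 _.
have mf := continuous_measurable_fun cf.
have C0 : 0 <= C by apply: le_trans (fC 0).
have [D D0 hD] := Hstein kappa0.
pose g M := f \o clip kappa (c M).
have cg M : continuous (g M) by move=> z; apply: continuous_comp; [exact: clip_continuous|exact: cf].
have gC M z : `|g M z| <= C by exact: fC.
have g_lim : \int[mu]_x g M x @[M --> \oo] --> \int[mu]_x f x.
  apply: (@Rintegral_bounded_cvg _ _ (measurableTypeR R) mu g f C) => //.
    by move=> M; exact: (continuous_measurable_fun (cg M)).
  apply: nearW => z; apply: continuous_cvg; first exact: cf.
  exact: @clip_cvg.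
have c_lim := @cvg_inv_sqrt_double R.
have b_lim : D * C * c M + 2 * C * C4 * (4 * c M) ^+ 4 @[M --> \oo] --> (0 : R).
  have -> : (0 : R) = D * C * 0 + 2 * C * C4 * (4 * 0) ^+ 4 by ring.
  apply: cvgD; first by apply: cvgM; [exact: cvg_cst|exact: c_lim].
  by apply: cvgM; [exact: cvg_cst|apply: (@cvg_comp _ _ _ c (fun x => (4 * x) ^+ 4) \oo (nbhs (0 : R)) _ c_lim); apply: (@continuous_comp _ _ _ (fun x : R => 4 * x) (fun x => x ^+ 4)); [apply: cvgM; [exact: cvg_cst|exact: cvg_id]|exact: exprn_continuous]].
rewrite -(addr0 (\int[mu]_x f x)).
have -> : (fun M => \int[P]_w f (X M w)) =
    (fun M => \int[mu]_x g M x + (\int[P]_w f (X M w) - \int[mu]_x g M x)).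
  by apply/funext => M; rewrite addrC subrK.
apply: cvgD => //; apply/cvgr0Pnorm_le => e e0.
near=> M.
have M0 : (0 < M)%N by near: M; exact: nbhs_infty_gt.
have iX : P.-integrable setT (EFin \o (fun w => f (X M w))).
  by apply: (@bounded_integrable _ _ _ P _ C) => //; exact: measurableT_comp.
have ig : P.-integrable setT (EFin \o (fun w => g M (kappa * H M w))).
  apply: (@bounded_integrable _ _ _ P _ C) => //.
  by apply: measurableT_comp; [exact: (continuous_measurable_fun (cg M))|exact: measurable_funM].
(* Pointwise Chebyshev: clipping matters only when the ratio is below [1 / 2], where
   [|4 c H| > 1]. *)
have close w : `|f (X M w) - g M (kappa * H M w)| <= 2 * C * (4 * c M) ^+ 4 * H M w ^+ 4.
  have kH : kappa * H M w / kappa = H M w by field.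
  have [r2|r2] := leP 2^-1 (ratio M w).
    rewrite /g /clip/= kH (max_idPl r2) -XH//; last by rewrite gt_eqF// (lt_le_trans _ r2).
    by rewrite subrr normr0 mulr_ge0// mulr_ge0 ?exprn_ge0// mulr_ge0.
  apply: (@le_trans _ _ (2 * C)).
    by rewrite mulr2n mulrDl mul1r (le_trans (ler_normB _ _))// lerD.
  have : 1 <= (4 * c M) ^+ 4 * H M w ^+ 4.
    rewrite (_ : _ * _ = (2 * (2 * c M * H M w)) ^+ 4); last by ring.
    move: r2; rewrite /ratio; move: (2 * c M * H M w) => x xl.
    rewrite (_ : (2 * x) ^+ 4 = ((- (2 * x)) ^+ 4)); last by ring.
    by rewrite exprn_ege1//; lra.
  move=> /(ler_wpM2l C0); nra.
rewrite -[X in `|X|](subrKA (\int[P]_w g M (kappa * H M w))).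
apply: (le_trans (ler_normD _ _)).
apply: (@le_trans _ _ (2 * C * C4 * (4 * c M) ^+ 4 + D * C * c M)).
  apply: lerD; last exact: hD.
  rewrite -RintegralB//.
  have ic : P.-integrable setT (EFin \o (fun w => f (X M w) - g M (kappa * H M w))).
    by have := integrableB measurableT iX ig; apply: eq_integrable.
  apply: (le_trans (le_normr_Rintegral measurableT ic)).
  have i4 : P.-integrable setT (EFin \o (fun w => 2 * C * (4 * c M) ^+ 4 * H M w ^+ 4)).
    by have := integrableZl measurableT (2 * C * (4 * c M) ^+ 4) (integrable_H4 M0); apply: eq_integrable.
  apply: (@le_trans _ _ (\int[P]_w (2 * C * (4 * c M) ^+ 4 * H M w ^+ 4))).
    apply: le_Rintegral => //.
    by have := integrable_abse ic; apply: eq_integrable.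
  rewrite RintegralZl//; last exact: integrable_H4.
  rewrite (_ : 2 * C * C4 * (4 * c M) ^+ 4 = 2 * C * (4 * c M) ^+ 4 * C4); last by ring.
  by rewrite ler_wpM2l ?Rintegral_H4// mulr_ge0 ?exprn_ge0// mulr_ge0.
rewrite addrC; apply: (le_trans (ler_norm _)); near: M.
by move/cvgr0_norm_le : b_lim; apply.
Unshelve. all: by end_near. Qed.

End normalised_statistic.

(** * The quadratic variation of the heat equation *)

Section heat_quadratic_variation.
Context (R : realType) (d : measure_display) (T : measurableType d)
  (P : probability T R) (xi : nat -> {RV P >-> R}).
Hypothesis hxi : iid_standard_normal [set k | (0 < k)%N] xi.
Variables (theta sigma t : R).
Hypotheses (htheta : 0 < theta) (hsigma : 0 < sigma) (ht : 0 < t).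
Variable ux : R -> {RV P >-> R}.
Hypothesis hux : continuous_heat_dx xi theta sigma t ux.
Variables (a b : R).
Hypotheses (ha : 0 <= a) (hab : a < b) (hb : b <= pi).

Let ba0 : 0 < b - a. Proof. by rewrite subr_gt0. Qed.

Let scale (M : nat) : R := theta / (sigma * Num.sqrt ((b - a) / M%:R)).

Let scaleE M : scale M ^+ 2 = theta ^+ 2 / (sigma ^+ 2 * (b - a)) * M%:R.
Proof.
rewrite /scale exprMn exprVn exprMn sqr_sqrtr ?divr_ge0 ?(ltW ba0)//.
by rewrite !invfM invrK; ring.
Qed.

(** The upper index [n.+1] makes the partial sum run over the modes [1, ..., n], matching the [n]
    columns. *)
Let scaled_partial_incr (M n : nat) (j : 'I_M) w :
  scale M * (heat_dx_partial xi theta sigma n.+1 t (grid a b M j.+1) w -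
             heat_dx_partial xi theta sigma n.+1 t (grid a b M j) w) =
  \sum_(k < n) incr_matrix a b theta t j k * modes xi w k.
Proof.
rewrite /heat_dx_partial !big_add1/= !big_mkord -sumrB mulr_sumr.
apply: eq_bigr => k _; rewrite /incr_matrix /modes /scale invfM.
have s0 := gt_eqF hsigma; have t0 := gt_eqF htheta.
move: (Num.sqrt ((b - a) / _))^-1 (Num.sqrt (2 / pi)) (expR _) (cos _) (cos _) => x y z c1 c2.
by field; rewrite s0 t0 nat1r pnatr_eq0.
Qed.

Let qform_cvg M : (0 < M)%N ->
  {ae P, forall w, qform (incr_matrix a b theta t (M := M) (n := n)) (modes xi w) @[n --> \oo] -->
    quadratic_variation ux a b M w * scale M ^+ 2}.
Proof.
move=> M0; have [_ _ dx] := hux.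
(* Convergence is given almost surely at each fixed point; a countable union of null sets serves all
   grid points. *)
have : {ae P, forall w (j : nat), (j <= M)%N ->
    heat_dx_partial xi theta sigma n t (grid a b M j) w @[n --> \oo] --> ux (grid a b M j) w}.
  apply: ae_foralln => j; have [jM|jM] := leqP j M; last by apply: nearW.
  by apply: filterS (dx _ (grid_in ha hab hb M0 jM)) => w.
apply: filterS => w cv.
have -> : quadratic_variation ux a b M w * scale M ^+ 2 =
    \sum_(j < M) (scale M * (ux (grid a b M j.+1) w - ux (grid a b M j) w)) ^+ 2.
  rewrite /quadratic_variation big_add1/= big_mkord mulr_suml.
  by apply: eq_bigr => j _; rewrite [RHS]exprMn mulrC.
rewrite /qform; apply: cvg_sum_fin => j.
under eq_fun do rewrite -scaled_partial_incr.
have cvj : scale M * (heat_dx_partial xi theta sigma n.+1 t (grid a b M j.+1) w -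
    heat_dx_partial xi theta sigma n.+1 t (grid a b M j) w) @[n --> \oo] -->
    scale M * (ux (grid a b M j.+1) w - ux (grid a b M j) w).
  apply: cvgM; first exact: cvg_cst.
  apply: cvgB.
    by have := cv j.+1 (ltn_ord j); rewrite -cvg_shiftS.
  by have := cv j (ltnW (ltn_ord j)); rewrite -cvg_shiftS.
exact: (@cvgM _ _ _ _ _ _ _ _ cvj cvj).
Qed.

Definition heat_stat (M : nat) (w : T) : R :=
  (Num.sqrt (2 * M%:R))^-1 * (quadratic_variation ux a b M w * scale M ^+ 2 - M%:R).

Lemma measurable_quadratic_variation M :
  measurable_fun setT (quadratic_variation ux a b M).
Proof.
apply: measurable_sum => j; apply: measurable_funX.
by apply: measurable_funB; exact: measurable_funP.
Qed.

Lemma measurable_heat_stat M : measurable_fun setT (heat_stat M).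
Proof.
apply: measurable_funM => //; apply: measurable_funB => //; apply: measurable_funM => //.
exact: @measurable_quadratic_variation.
Qed.

Local Notation B M n := (@incr_matrix R a b theta t M n).
Let tau := trace_defect a b theta t.

Let qnorm_cvg M : (0 < M)%N ->
  {ae P, forall w, qnorm xi (B M n) w @[n --> \oo] --> heat_stat M w}.
Proof.
move=> M0; apply: filterS (qform_cvg M0) => w cv.
apply: cvgM; first exact: cvg_cst.
by apply: cvgB; [exact: cv|exact: cvg_cst].
Qed.

Lemma heat_stat_fourth_moment M : (0 < M)%N ->
  (\int[P]_w (heat_stat M w ^+ 4)%:E <= (2 * (64 * (tau + 6) ^+ 4 + 9))%:E)%E.
Proof.
move=> M0.
apply: (@fatou_bound _ _ _ _ (fun n w => qnorm xi (B M n) w ^+ 4)).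
- by move=> n; apply: measurable_funX; exact: (measurable_qnorm hxi).
- by apply: measurable_funX; exact: @measurable_heat_stat.
- by move=> n w; rewrite exprn_even_ge0.
- by move=> w; rewrite exprn_even_ge0.
- apply: filterS (qnorm_cvg M0) => w cv.
  exact: (@cvg_comp _ _ _ _ (fun x => x ^+ 4) _ _ _ cv (@exprn_continuous R 4 _)).
- apply: filterS (trace_defect_incr_matrix ha hab hb htheta ht M0) => n Hn.
  exact: (fourth_moment_le hxi M0 (incr_matrix_contraction ha hab hb htheta ht M0 (n := n)) Hn).
Qed.

(** At fixed [M] the finite bound passes to the limit in [n] by dominated convergence. The number of
    modes required depends on [M], the constant does not. *)
Lemma heat_stat_stein (kappa : R) : kappa != 0 -> exists2 C, 0 <= C &
  forall M K (g : R -> R), (0 < M)%N -> continuous g -> (forall x, `|g x| <= K) ->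
  `|\int[P]_w g (kappa * heat_stat M w) - \int[normal_prob 0 (Num.sqrt (kappa ^+ 2))]_x g x| <=
    C * K * (Num.sqrt (2 * M%:R))^-1.
Proof.
move=> kappa0; set s := Num.sqrt _.
have k2 : 0 < kappa ^+ 2 by rewrite exprn_even_gt0.
have s0 : s != 0 by rewrite gt_eqF// sqrtr_gt0.
have s2 : s ^+ 2 = kappa ^+ 2 by rewrite sqr_sqrtr// ltW.
have [C C0 hC] := stein_solution s0.
(* Read off from the trace bound on the grid with a single interval. *)
have tau0 : 0 <= tau.
  have [n _ /(_ n (leqnn n))] := trace_defect_incr_matrix ha hab hb htheta ht (ltn0Sn 0).
  exact: le_trans.
set E := kappa ^+ 2 * (2 * (1 + 2 * (64 * (tau + 6) ^+ 4 + 9)) + 2 * tau) + `|kappa| * tau.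
have E0 : 0 <= E.
  have u0 : 0 <= (tau + 6) ^+ 4 by rewrite exprn_even_ge0.
  apply: addr_ge0; apply: mulr_ge0 => //; first exact: ltW.
  by move: u0; move: ((tau + 6) ^+ 4) => u u0; lra.
exists (C * E); first by rewrite mulr_ge0.
move=> M K g M0 cg gK.
have [phi [dphi [dphiE cdphi phiC dphiC steinE]]] := hC K g cg gK.
have mg := continuous_measurable_fun cg.
have lim : \int[P]_w g (kappa * qnorm xi (B M n) w) @[n --> \oo] --> \int[P]_w g (kappa * heat_stat M w).
  apply: (@Rintegral_bounded_cvg _ _ _ P _ _ K).
  - by move=> n; apply: measurableT_comp => //; apply: measurable_funM => //; exact: (measurable_qnorm hxi).
  - by apply: measurableT_comp => //; apply: measurable_funM => //; exact: @measurable_heat_stat.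
  - by move=> n w.
  - apply: filterS (qnorm_cvg M0) => w cv.
    have cvk : kappa * qnorm xi (B M n) w @[n --> \oo] --> kappa * heat_stat M w.
      by apply: cvgM; [exact: cvg_cst|exact: cv].
    exact: (@cvg_comp _ _ _ _ g _ _ _ cvk (cg _)).
have bound : \forall n \near \oo,
    `|\int[P]_w g (kappa * qnorm xi (B M n) w) - \int[normal_prob 0 s]_x g x| <=
    C * E * K * (Num.sqrt (2 * M%:R))^-1.
  apply: filterS (trace_defect_incr_matrix ha hab hb htheta ht M0) => n Hn.
  have kE x : kappa ^+ 2 * dphi x - x * phi x = g x - \int[normal_prob 0 s]_y g y by rewrite -s2.
  have := qnorm_stein_bound hxi M0 (incr_matrix_contraction ha hab hb htheta ht M0 (n := n)) Hn
    dphiE cdphi phiC dphiC kE cg gK.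
  move=> /le_trans; apply; rewrite -/E le_eqVlt; apply/orP; left; apply/eqP; ring.
have nlim : `|\int[P]_w g (kappa * qnorm xi (B M n) w) - \int[normal_prob 0 s]_x g x| @[n --> \oo] -->
    `|\int[P]_w g (kappa * heat_stat M w) - \int[normal_prob 0 s]_x g x|.
  by apply: cvg_norm; apply: cvgB; [exact: lim|exact: cvg_cst].
rewrite -(cvg_lim _ nlim)//; apply: limr_le => //.
by apply/cvg_ex; eexists; exact: nlim.
Qed.

Lemma heat_ratio M w : (0 < M)%N ->
  1 + 2 * (Num.sqrt (2 * M%:R))^-1 * heat_stat M w =
  theta ^+ 2 * quadratic_variation ux a b M w / (sigma ^+ 2 * (b - a)).
Proof.
move=> M0; have MR0 : (0 : R) < M%:R by rewrite ltr0n.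
have c2 : (Num.sqrt (2 * M%:R : R))^-1 ^+ 2 = (2 * M%:R)^-1 by rewrite exprVn sqr_sqrtr// mulr_ge0.
have -> : 1 + 2 * (Num.sqrt (2 * M%:R))^-1 * heat_stat M w = 1 + 2 * (Num.sqrt (2 * M%:R : R))^-1 ^+ 2 *
    (quadratic_variation ux a b M w * scale M ^+ 2 - M%:R) by rewrite /heat_stat; ring.
by rewrite c2 scaleE; field; rewrite !gt_eqF.
Qed.


Let double_sqrt (M : nat) : (0 < M)%N ->
  Num.sqrt M%:R * (2 * (Num.sqrt (2 * M%:R))^-1) = Num.sqrt 2 :> R.
Proof.
move=> M0; have m0 : Num.sqrt M%:R != 0 :> R by rewrite sqrtr_eq0 -ltNge ltr0n.
have r0 : Num.sqrt 2 != 0 :> R by rewrite sqrtr_eq0 -ltNge.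
rewrite sqrtrM// -[X in _ * (X * _)](@sqr_sqrtr R 2)//.
by field; rewrite r0 m0.
Qed.

Lemma sigma2_check_heat_stat M w : (0 < M)%N ->
  Num.sqrt M%:R * (sigma2_check ux a b theta M w - sigma ^+ 2) =
  Num.sqrt 2 * sigma ^+ 2 * heat_stat M w.
Proof.
move=> M0; rewrite -(double_sqrt M0).
have -> : sigma2_check ux a b theta M w =
    sigma ^+ 2 * (1 + 2 * (Num.sqrt (2 * M%:R))^-1 * heat_stat M w).
  by rewrite heat_ratio// /sigma2_check; field; rewrite !gt_eqF.
by ring.
Qed.

Lemma theta2_checkE M w : (0 < M)%N -> theta2_check ux a b sigma M w =
  theta ^+ 2 / (1 + 2 * (Num.sqrt (2 * M%:R))^-1 * heat_stat M w).
Proof.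
move=> M0; rewrite heat_ratio// /theta2_check.
(* A vanishing quadratic variation gives 0 on both sides, by the convention that the inverse of 0 is
   0. *)
have [->|q0] := eqVneq (quadratic_variation ux a b M w) 0.
  by rewrite mulr0 mul0r !invr0 !mulr0.
by field; rewrite q0 !gt_eqF.
Qed.

(** From [theta^2 / rho - theta^2 = - theta^2 (rho - 1) / rho], whence the negative
    [kappa = - sqrt 2 theta^2]. *)
Lemma theta2_check_heat_stat M w : (0 < M)%N ->
  1 + 2 * (Num.sqrt (2 * M%:R))^-1 * heat_stat M w != 0 ->
  Num.sqrt M%:R * (theta2_check ux a b sigma M w - theta ^+ 2) =
  - (Num.sqrt 2 * theta ^+ 2) * heat_stat M w /
    (1 + 2 * (Num.sqrt (2 * M%:R))^-1 * heat_stat M w).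
Proof.
move=> M0 r0; rewrite theta2_checkE// -(double_sqrt M0).
move: r0; move: (Num.sqrt (2 * M%:R))^-1 => c r0.
by field.
Qed.

End heat_quadratic_variation.

Theorem theorem3p6 (R : realType) (d : measure_display) (T : measurableType d)
    (P : probability T R) (xi : nat -> {RV P >-> R})
    (hxi : iid_standard_normal [set k | (0 < k)%N] xi)
    (theta sigma : R) (htheta : 0 < theta) (hsigma : 0 < sigma)
    (t : R) (ht : 0 < t)
    (ux : R -> {RV P >-> R}) (hux : continuous_heat_dx xi theta sigma t ux)
    (a b : R) (ha : 0 <= a) (hab : a < b) (hb : b <= pi) :
  ({ae P, forall w,
      theta2_check ux a b sigma M w @[M --> \oo] --> theta ^+ 2} /\
   cvg_in_distribution P
     (fun M w => Num.sqrt M%:R * (theta2_check ux a b sigma M w - theta ^+ 2))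
     (normal_prob 0 (Num.sqrt (2 * theta ^+ 4)))) /\
  ({ae P, forall w,
      sigma2_check ux a b theta M w @[M --> \oo] --> sigma ^+ 2} /\
   cvg_in_distribution P
     (fun M w => Num.sqrt M%:R * (sigma2_check ux a b theta M w - sigma ^+ 2))
     (normal_prob 0 (Num.sqrt (2 * sigma ^+ 4)))).
Proof.
pose H := heat_stat theta sigma ux a b.
have mH M : measurable_fun setT (H M) by exact: @measurable_heat_stat.
have H4 M := heat_stat_fourth_moment hxi htheta hsigma ht hux ha hab hb (M := M).
have Hs := heat_stat_stein hxi htheta hsigma ht hux ha hab hb.
have mq M := @measurable_quadratic_variation _ _ _ _ ux a b M.
have r1 : {ae P, forall w, 1 + 2 * (Num.sqrt (2 * M%:R))^-1 * H M w @[M --> \oo] --> (1 : R)}.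
  exact: (ratio_cvg1 mH H4).
have sq2 (v : R) : (Num.sqrt 2 * v ^+ 2) ^+ 2 = 2 * v ^+ 4.
  by rewrite exprMn sqr_sqrtr// -exprM.
have k0 (v : R) : 0 < v -> Num.sqrt 2 * v ^+ 2 != 0.
  by move=> v0; rewrite mulf_neq0 ?expf_neq0 ?gt_eqF// sqrtr_gt0.
split; split.
- apply: filterS r1 => w r1.
  rewrite -[X in _ --> X]divr1.
  apply: (@cvg_trans _ (theta ^+ 2 / (1 + 2 * (Num.sqrt (2 * M%:R))^-1 * H M w) @[M --> \oo])).
    apply: near_eq_cvg; near=> M.
    have M0 : (0 < M)%N by near: M; exact: nbhs_infty_gt.
    by rewrite (theta2_checkE htheta hsigma ux hab w M0).
  by apply: cvgM; [exact: cvg_cst|apply: cvgV => //; exact: oner_neq0].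
(* Writes the variance as the square of the negative [kappa] of [theta2_check_heat_stat]. *)
- rewrite -sq2 -(sqrrN (Num.sqrt 2 * _)).
  apply: (ratio_clt mH H4 Hs); first by rewrite oppr_eq0 k0.
    move=> M; apply: measurable_funM => //; apply: measurable_funB => //.
    by apply: measurable_funM => //; apply: measurableT_comp (mq M); exact: @measurable_inv.
  by move=> M w M0 rn0; exact: theta2_check_heat_stat.
- apply: filterS r1 => w r1.
  rewrite -[X in _ --> X]mulr1.
  apply: (@cvg_trans _ (sigma ^+ 2 * (1 + 2 * (Num.sqrt (2 * M%:R))^-1 * H M w) @[M --> \oo])).
    apply: near_eq_cvg; near=> M.
    have M0 : (0 < M)%N by near: M; exact: nbhs_infty_gt.
    by rewrite /H heat_ratio// /sigma2_check; field; rewrite !gt_eqF// subr_gt0.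
  by apply: cvgM; [exact: cvg_cst|].
- rewrite -sq2; apply: (statistic_clt Hs); first exact: k0.
    move=> M; apply: measurable_funM => //; apply: measurable_funB => //.
    by apply: measurable_funM => //; apply: measurable_funM => //; exact: mq.
  by move=> M w M0; exact: sigma2_check_heat_stat.
Unshelve. all: by end_near. Qed.
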